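(* The Kac algebra $KQ(n)$ is self-dual if and only if $n$ is odd. When this is the case, one can take as Kac algebra isomorphism the map $\psi:KQ(n)\to\widehat{KQ(n)}$ defined by $$\lambda(a)\mapsto 2n\Bigl(\widehat{e^{n-1}_{1,1}}+\tfrac12\bigl(\mathrm{i}(\widehat{e^1_{2,2}}-\widehat{e^1_{1,1}})-\widehat{e^{n-1}_{1,2}}-\widehat{e^{n-1}_{2,1}}\bigr)\Bigr),\qquad \lambda(b)\mapsto 4n\,\widehat{e_4}.$$
   Context: A finite-dimensional Kac algebra is a finite-dimensional $C^*$-algebra $K$ with a Hopf algebra structure $(\Delta,\varepsilon,S)$ for which $\Delta$ is a $*$-homomorphism; isomorphisms are $*$-algebra isomorphisms compatible with coproducts. The dual $\hat K$ is the dual vector space with product $(fg)(x)=(f\otimes g)(\Delta(x))$, coproduct dual to the product of $K$, and involution $f^*(x)=\overline{f(S(x)^* )}$. $K$ is self-dual if $K\cong\hat K$. $KQ(n)$ ($n\ge1$): let $Q_n=\langle a,b\mid a^{2n}=1,\ b^2=a^n,\ ba=a^{-1}b\rangle$ (order $4n$), with canonical basis $\lambda(g)$ of $\mathbb{C}[Q_n]$ and $\Delta_s(\lambda(g))=\lambda(g)\otimes\lambda(g)$. For $\zeta\in\{1,-1,\mathrm{i},-\mathrm{i}\}$ let $P_\zeta=\frac14\sum_{s=0}^3\zeta^{-s}\lambda(b)^s$. Let $\Omega'=\sum_{\zeta,\eta}\omega(\zeta,\eta)P_\zeta\otimes P_\eta$ where $\omega(-1,\mathrm{i})=\omega(\mathrm{i},-\mathrm{i})=\omega(-\mathrm{i},-1)=\mathrm{i}$,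 $\omega(\mathrm{i},-1)=\omega(-\mathrm{i},\mathrm{i})=\omega(-1,-\mathrm{i})=-\mathrm{i}$, and $\omega=1$ otherwise. $KQ(n)$ is the $*$-algebra $\mathbb{C}[Q_n]$ with its usual counit and the coproduct $\Delta(x)=\Omega'\Delta_s(x)\Omega'^*$. Let $n$ be odd, $\epsilon=\mathrm{e}^{\mathrm{i}\pi/n}$, and for integers $j$ (these are matrix units of the $2\times2$ blocks when $1\le j\le n-1$): $e^j_{1,1}=\frac1{2n}\sum_{k=0}^{2n-1}\epsilon^{-jk}\lambda(a^k)$, $e^j_{2,2}=\frac1{2n}\sum_k\epsilon^{jk}\lambda(a^k)$, $e^j_{1,2}=\frac1{2n}\sum_k\epsilon^{-j(k-n)}\lambda(a^kb)$, $e^j_{2,1}=\frac1{2n}\sum_k\epsilon^{jk}\lambda(a^kb)$. Also $e_4=\frac1{4n}\sum_{k=0}^{2n-1}(-1)^k(\lambda(a^k)+\mathrm{i}\lambda(a^kb))$. Let $(\chi_g)$ be the basis of the dual space dual to $(\lambda(g))$. For $x=\sum_g x_g\lambda(g)$ write $\hat x=\sum_g x_g\chi_g$.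
   Formalization: The printed ψ is proved for the dual coproduct f ↦ f(yx); for the usual f ↦ f(xy) it fails for odd n ≥ 3 (both at once would make ℂ[Q_n] commutative), so there the sign of i(ê¹₂₂ − ê¹₁₁) is reversed. Self-duality iff n is odd is proved for both. *)

(* Defs.v *)
From HB Require Import structures.
From mathcomp Require Import all_boot all_order all_algebra all_fingroup.
From mathcomp Require Import complex.
From mathcomp Require Import reals trigo.

Set Implicit Arguments.
Unset Strict Implicit.
Unset Printing Implicit Defensive.

Import GRing.Theory.
Local Open Scope ring_scope.
Local Open Scope complex_scope.

(* Finite-dimensional complex vector spaces are taken with a basis indexed by *)
(* a finType I: a vector is its family of coordinates.  The tensor product of *)
(* vec R I and vec R J is vec R (I * J), with basis the tens (vbase i)        *)
(* (vbase j), and the dual space of vec R I is vec R I, with basis the dual   *)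
(* basis: f : vec R I is the linear form x |-> pairing f x.                   *)
Definition vec (R : realType) (I : finType) : Type := {ffun I -> R[i]}.
HB.instance Definition _ (R : realType) (I : finType) :=
  GRing.Lmodule.on (vec R I).

Definition vbase (R : realType) (I : finType) (i : I) : vec R I :=
  [ffun j => (j == i)%:R].

Definition pairing (R : realType) (I : finType) (f x : vec R I) : R[i] :=
  \sum_i f i * x i.

Definition tens (R : realType) (I J : finType)
    (x : vec R I) (y : vec R J) : vec R (I * J)%type :=
  [ffun p => x p.1 * y p.2].

(* f (x) g, for f and g linear *)
Definition tmap (R : realType) (I J I' J' : finType)
    (f : vec R I -> vec R I') (g : vec R J -> vec R J')
    (t : vec R (I * J)%type) : vec R (I' * J')%type :=
  \sum_p t p *: tens (f (vbase R p.1)) (g (vbase R p.2)).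

(* the product (x (x) y) (x' (x) y') = m x x' (x) m y y' of the tensor square *)
(* of an algebra with product m                                               *)
Definition tmul (R : realType) (I : finType)
    (m : vec R I -> vec R I -> vec R I) (t u : vec R (I * I)%type) :
    vec R (I * I)%type :=
  \sum_p \sum_q (t p * u q) *:
    tens (m (vbase R p.1) (vbase R q.1)) (m (vbase R p.2) (vbase R q.2)).

(* the conjugate-linear involution (x (x) y)^* = s x (x) s y *)
Definition tstar (R : realType) (I : finType) (s : vec R I -> vec R I)
    (t : vec R (I * I)%type) : vec R (I * I)%type :=
  \sum_p (t p)^*%C *: tens (s (vbase R p.1)) (s (vbase R p.2)).

Record kacData (R : realType) := KacData {
  kidx : finType;
  kmul : vec R kidx -> vec R kidx -> vec R kidx;
  kone : vec R kidx;
  kstar : vec R kidx -> vec R kidx;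
  kcomul : vec R kidx -> vec R (kidx * kidx)%type;
  kcounit : vec R kidx -> R[i];
  kantipode : vec R kidx -> vec R kidx
}.

Definition kcar (R : realType) (K : kacData R) : Type := vec R (kidx K).
HB.instance Definition _ (R : realType) (K : kacData R) :=
  GRing.Lmodule.on (kcar K).

Definition is_algebra (R : realType) (K : kacData R) : Prop :=
  [/\ forall (c : R[i]) (x y z : kcar K),
        kmul (c *: x + y) z = c *: kmul x z + kmul y z,
      forall (c : R[i]) (x y z : kcar K),
        kmul x (c *: y + z) = c *: kmul x y + kmul x z,
      forall x y z : kcar K, kmul x (kmul y z) = kmul (kmul x y) z,
      forall x : kcar K, kmul (kone K) x = x
    & forall x : kcar K, kmul x (kone K) = x].

(* A finite-dimensional normed space is complete. *)
Definition is_cstar_norm (R : realType) (K : kacData R) (N : kcar K -> R) :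
    Prop :=
  [/\ forall x, N x = 0 -> x = 0,
      forall x y, N (x + y) <= N x + N y,
      forall (c : R[i]) x, (N (c *: x))%:C = `|c| * (N x)%:C,
      forall x y, N (kmul x y) <= N x * N y
    & forall x, N (kmul (kstar x) x) = N x ^+ 2].

Definition is_cstar_algebra (R : realType) (K : kacData R) : Prop :=
  [/\ is_algebra K,
      forall (c : R[i]) (x y : kcar K),
        kstar (c *: x + y) = c^*%C *: kstar x + kstar y,
      forall x : kcar K, kstar (kstar x) = x,
      forall x y : kcar K, kstar (kmul x y) = kmul (kstar y) (kstar x)
    & exists N : kcar K -> R, is_cstar_norm N].

Definition is_bialgebra (R : realType) (K : kacData R) : Prop :=
  [/\ [/\ forall (c : R[i]) (x y : kcar K),
            kcomul (c *: x + y) = c *: kcomul x + kcomul y,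
          forall x y : kcar K,
            kcomul (kmul x y) = tmul (@kmul R K) (kcomul x) (kcomul y)
        & kcomul (kone K) = tens (kone K) (kone K)],
      [/\ forall (c : R[i]) (x y : kcar K),
            kcounit (c *: x + y) = c * kcounit x + kcounit y,
          forall x y : kcar K, kcounit (kmul x y) = kcounit x * kcounit y
        & kcounit (kone K) = 1],
      forall (x : kcar K) i j k,
        tmap (@kcomul R K) id (kcomul x) ((i, j), k)
        = tmap id (@kcomul R K) (kcomul x) (i, (j, k))
    & forall x : kcar K,
        \sum_p (kcomul x p * kcounit (vbase R p.1)) *: vbase R p.2 = x /\
        \sum_p (kcomul x p * kcounit (vbase R p.2)) *: vbase R p.1 = x].

Definition is_antipode (R : realType) (K : kacData R) : Prop :=
  (forall (c : R[i]) (x y : kcar K),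
     kantipode (c *: x + y) = c *: kantipode x + kantipode y) /\
  (forall x : kcar K,
     \sum_p kcomul x p *: kmul (kantipode (vbase R p.1)) (vbase R p.2)
       = kcounit x *: kone K /\
     \sum_p kcomul x p *: kmul (vbase R p.1) (kantipode (vbase R p.2))
       = kcounit x *: kone K).

Definition is_kac (R : realType) (K : kacData R) : Prop :=
  [/\ is_cstar_algebra K, is_bialgebra K, is_antipode K
    & forall x : kcar K, kcomul (kstar x) = tstar (@kstar R K) (kcomul x)].

Definition kac_iso (R : realType) (K L : kacData R) (f : kcar K -> kcar L) :
    Prop :=
  [/\ linear f /\ bijective f,
      forall x y : kcar K, f (kmul x y) = kmul (f x) (f y),
      f (kone K) = kone L,
      forall x : kcar K, f (kstar x) = kstar (f x)
    & forall x : kcar K, kcomul (f x) = tmap f f (kcomul x)].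

(* The coproduct D of the dual is (D f)(x (x) y) = f (x y) if o = false, and  *)
(* (D f)(x (x) y) = f (y x) if o = true, the two conventions in use for the   *)
(* coproduct dual to a product; an explicit isomorphism onto the dual depends *)
(* on this choice.  The other operations do not (the antipode of a Kac        *)
(* algebra is involutive, so that it is also that of the opposite coproduct). *)
Definition dual (R : realType) (o : bool) (K : kacData R) : kacData R :=
  @KacData R (kidx K)
    (fun f g => [ffun i => pairing (tens f g) (kcomul (vbase R i))])
    [ffun i => kcounit (vbase R i)]
    (fun f => [ffun i => (pairing f (kstar (kantipode (vbase R i))))^*%C])
    (fun f => [ffun p => pairing f
       (if o then kmul (vbase R p.2) (vbase R p.1)
        else kmul (vbase R p.1) (vbase R p.2))])
    (fun f => pairing f (kone K))
    (fun f => [ffun i => pairing f (kantipode (vbase R i))]).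

Definition self_dual (R : realType) (o : bool) (K : kacData R) : Prop :=
  exists f : kcar K -> kcar (dual o K), kac_iso f.

(* The image of x under the linear bijection taking the basis to the dual     *)
(* basis.                                                                     *)
Definition hat (R : realType) (o : bool) (K : kacData R) (x : kcar K) :
  kcar (dual o K) := x.

(* The group < a, b | a^(2n) = 1, b^2 = a^n, ba = a^-1 b >: the pair (k, s)   *)
(* stands for a^k b^s.  For n = 0, 'Z_(2 * n) is Z/2 and this is not the      *)
(* presented group.                                                           *)
Definition quat (n : nat) : Type := ('Z_(2 * n) * bool)%type.
HB.instance Definition _ (n : nat) := Finite.on (quat n).

Section QuatGroup.
Variable n : nat.
Implicit Types x y z : quat n.

Definition quat_mul x y : quat n :=
  (x.1 + (-1) ^+ x.2 * y.1 + n%:R *+ (x.2 && y.2), x.2 (+) y.2).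
Definition quat_one : quat n := (0, false).
Definition quat_inv x : quat n :=
  (if x.2 then x.1 + n%:R else - x.1, x.2).

Lemma quat_2n : n%:R + n%:R = 0 :> 'Z_(2 * n).
Proof.
case: n => [|m]; first by rewrite addr0.
by rewrite -natrD addnn -mul2n pchar_Zp // mul2n doubleS.
Qed.

Lemma quat_mulA : associative quat_mul.
Proof.
have nN : - n%:R = n%:R :> 'Z_(2 * n).
  by apply/eqP; rewrite eq_sym -subr_eq0 opprK quat_2n.
move=> [k s] [l t] [m u]; rewrite /quat_mul /= addbA; congr (_, _).
case: s t u => [] [] [] /=;
  rewrite ?expr0 ?expr1 ?mul1r ?mulN1r ?mulr0n ?mulr1n ?addr0 ?opprD ?opprK
          ?nN ?addrA //.
all: by rewrite [LHS]addrAC.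
Qed.

Lemma quat_mul1 : left_id quat_one quat_mul.
Proof. by move=> [k s]; rewrite /quat_mul /= expr0 mul1r add0r addr0. Qed.

Lemma quat_mulV : left_inverse quat_one quat_inv quat_mul.
Proof.
move=> [k []]; rewrite /quat_mul /quat_inv /quat_one /=; congr (_, _).
  by rewrite expr1 mulN1r mulr1n [k + _]addrC addrK quat_2n.
by rewrite expr0 mul1r addNr addr0.
Qed.
End QuatGroup.

HB.instance Definition _ (n : nat) :=
  Finite_isGroup.Build (quat n)
    (@quat_mulA n) (@quat_mul1 n) (@quat_mulV n).

Definition qa (n : nat) : quat n := (1, false).
Definition qb (n : nat) : quat n := (0, true).

Lemma qa_exp (n k : nat) : (qa n ^+ k)%g = (k%:R, false) :> quat n.
Proof.
elim: k => [|k IHk]; first by [].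
rewrite expgS IHk.
change (quat_mul (qa n) (k%:R, false) = (k.+1%:R, false) :> quat n).
by rewrite /quat_mul /= expr0 mul1r mulr0n addr0 -natr1 addrC.
Qed.

(* quat n is generated by elements satisfying the defining relations and has  *)
(* the order of the presented group.                                          *)
Lemma quat_presentation (n : nat) : (0 < n)%N ->
  [/\ (qa n ^+ (2 * n) = 1)%g, (qb n ^+ 2 = qa n ^+ n)%g,
      (qb n * qa n = (qa n)^-1 * qb n)%g,
      <<[set qa n; qb n]>>%g = [set: quat n]
    & #|[set: quat n]| = (4 * n)%N].
Proof.
move=> n_gt0; have n2_gt1 : (1 < 2 * n)%N by rewrite (leq_mul (leqnn 2) n_gt0).
split.
- by rewrite qa_exp pchar_Zp.
- rewrite qa_exp expgS expg1.
  change (quat_mul (qb n) (qb n) = (n%:R, false) :> quat n).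
  by rewrite /quat_mul /= mulr0 !add0r mulr1n.
- change (quat_mul (qb n) (qa n) = quat_mul (quat_inv (qa n)) (qb n)).
  by rewrite /quat_mul /= expr0 expr1 mulN1r add0r mulr0 !addr0.
- apply/eqP; rewrite -subTset; apply/subsetP=> -[k s] _.
  have -> : (k, s) = (qa n ^+ k * qb n ^+ s)%g :> quat n.
    rewrite qa_exp natr_Zp; case: s.
      change ((k, true) = quat_mul (k, false) (qb n)).
      by rewrite /quat_mul /= expr0 mulr0 !addr0.
    change ((k, false) = quat_mul (k, false) (quat_one n)).
    by rewrite /quat_mul /= expr0 mulr0 !addr0.
  by rewrite groupM // groupX // mem_gen // !inE eqxx ?orbT.
- rewrite cardsT (_ : #|_| = #|{: 'Z_(2 * n) * bool}|) //.
  by rewrite card_prod card_bool card_ord Zp_cast // mulnC mulnA.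
Qed.

Section GroupAlgebra.
Variables (R : realType) (gT : finGroupType).

Definition lam (g : gT) : vec R gT := vbase R g.

Definition gmul (x y : vec R gT) : vec R gT :=
  \sum_g \sum_h (x g * y h) *: lam (g * h)%g.

Definition gstar (x : vec R gT) : vec R gT :=
  \sum_g (x g)^*%C *: lam g^-1%g.

Definition gcomul (x : vec R gT) : vec R (gT * gT)%type :=
  \sum_g x g *: tens (lam g) (lam g).

Definition gantipode (x : vec R gT) : vec R gT :=
  \sum_g x g *: lam g^-1%g.
End GroupAlgebra.

Section KQ.
Variables (R : realType) (n : nat).
Local Notation a := (qa n).
Local Notation b := (qb n).

Definition fourth_roots : seq R[i] := [:: 1; -1; 'i%C; - 'i%C].

Definition Pz (z : R[i]) : vec R (quat n) :=
  4^-1 *: \sum_(s < 4) z ^- s *: lam R (b ^+ s)%g.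

Definition omega (z w : R[i]) : R[i] :=
  if (z, w) \in [:: (-1, 'i%C); ('i%C, - 'i%C); (- 'i%C, -1)] then 'i%C
  else if (z, w) \in [:: ('i%C, -1); (- 'i%C, 'i%C); (-1, - 'i%C)] then - 'i%C
  else 1.

Definition Omega : vec R (quat n * quat n)%type :=
  \sum_(z <- fourth_roots) \sum_(w <- fourth_roots)
    omega z w *: tens (Pz z) (Pz w).

Definition KQ_comul (x : vec R (quat n)) : vec R (quat n * quat n)%type :=
  tmul (@gmul R (quat n))
    (tmul (@gmul R (quat n)) Omega (gcomul x))
    (tstar (@gstar R (quat n)) Omega).

(* u = m (id (x) S) Omega, with m and S the product and the antipode of the   *)
(* group algebra; the antipode of the twisted coproduct is x |-> u S(x) u^*.  *)
Definition KQ_u : vec R (quat n) :=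
  \sum_p Omega p *: gmul (lam R p.1) (gantipode (lam R p.2)).

Definition KQ_antipode (x : vec R (quat n)) : vec R (quat n) :=
  gmul (gmul KQ_u (gantipode x)) (gstar KQ_u).

Definition KQ : kacData R :=
  @KacData R (quat n) (@gmul R (quat n)) (lam R 1%g) (@gstar R (quat n))
    KQ_comul (fun x => \sum_g x g) KQ_antipode.

Definition eps : R[i] := cos (pi / n%:R) +i* sin (pi / n%:R).

Definition e11 (j : int) : kcar KQ :=
  (2 * n)%:R^-1 *: \sum_(k < 2 * n) eps ^ (- (j * k%:Z)) *: lam R (a ^+ k)%g.

Definition e22 (j : int) : kcar KQ :=
  (2 * n)%:R^-1 *: \sum_(k < 2 * n) eps ^ (j * k%:Z) *: lam R (a ^+ k)%g.

Definition e12 (j : int) : kcar KQ :=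
  (2 * n)%:R^-1 *: \sum_(k < 2 * n)
    eps ^ (- (j * (k%:Z - n%:Z))) *: lam R (a ^+ k * b)%g.

Definition e21 (j : int) : kcar KQ :=
  (2 * n)%:R^-1 *: \sum_(k < 2 * n) eps ^ (j * k%:Z) *: lam R (a ^+ k * b)%g.

Definition e4 : kcar KQ :=
  (4 * n)%:R^-1 *: \sum_(k < 2 * n)
    (-1) ^+ k *: (lam R (a ^+ k)%g + 'i%C *: lam R (a ^+ k * b)%g).
End KQ.

(* Main.v *)
Require Import Defs.
From HB Require Import structures.
From mathcomp Require Import all_boot all_order all_algebra all_fingroup.
From mathcomp Require Import complex reals classical_sets trigo.
From mathcomp Require Import ring lra.

Set Implicit Arguments.
Unset Strict Implicit.
Unset Printing Implicit Defensive.

Import Order.TTheory GRing.Theory Num.Theory.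
Local Open Scope ring_scope.
Local Open Scope complex_scope.

(** Write [P_p], [p] in Z/4, for the spectral projections of [b], which has
    order 4 and a central square, so that the twist is
    [Omega = sum_(p, q) i^T(p, q) P_p (x) P_q] for an explicit exponent
    [T(p, q)] in Z/4, [omega_exp p q].

    _Kac algebra._  Elements built from [b] act by scalars on the products of
    the [P_p], and an identity between them is an identity between exponents.
    For the two threefold twists that coassociativity compares, the exponents
    differ by [2pqr] ([omega_exp_cocycle]).  Their quotient
    [sum (-1)^(pqr) P_p (x) P_q (x) P_r] is not [1], but it only involves the
    parities of [p], [q], [r], that is the central element [b^2]; it commutes
    with every [g (x) g (x) g] and drops out ([tw3_conj], [tcomulA]).  In
    the antipode axioms too the twist leaves at most a factor [b^2], which is
    central and cancels ([tantipode_left]).  The C*-norm is the operator norm of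
    the left regular representation ([opn_cstar]).

    _Even n._  The twist does not move [b (x) b], so [b] is group-like, and an
    isomorphism sends it to a group-like element of the dual, which is
    a character [chi] of the group.  The product of the dual squares [chi]
    pointwise on group elements, because [Omega] and [Omega^*] cancel under the
    multiplicative form [chi (x) chi].  When [n] is even the characters have
    square [1], while [b^2] is not [1] ([self_dual_odd]).

    _Odd n._  Now [c = a^(n+1)] has order [n], and every group element is
    [c^j b^s] with [s] in Z/4.  The even and odd parts [C_k] and [S_k] of [c^k]
    satisfy [P_q C_k = C_k P_q] and [P_q S_k = S_k P_(q+2)], so that the twist
    acts on them by scalars and the coproducts of the spanning elements
    [P_q C_k], [P_q S_k] are short explicit sums ([tcomul_cosg],
    [tcomul_sing]).  The isomorphism is given by the bilinear form with
    [<c^j b^s, P_q C_k> = (q == s) cos(j k t)] and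
    [<c^j b^s, P_q S_k> = i^w(s, q) sin(j k t) / 2], where [e^(i t) = - eps]
    and [w] is the exponent [wexp].  By the addition formulas of the cosine and
    the sine, the rule [<g h, x> = <g (x) h, Delta x>] becomes a finite list of
    identities in Z/4 ([dual_vec_prod]).  The transposed form is of the same
    kind, with the exponent that fits the product order required by [o]
    ([dual_kernel_sym]), and this gives compatibility with the coproducts.
    A row of the matrix of the form sums to [4n] for the unit and to [0] for
    the other group elements ([aug_dual_vec]), which makes the form
    nondegenerate.  Reading the form at [a = c b^2] and [b = c^0 b^1] gives the
    explicit values. *)

(** * Linear extension from bases, and tensors *)

Section LinearExtension.
Variables (R : realType) (I : finType).
Implicit Types (V : lmodType R[i]) (x : vec R I) (c : R[i]).

Definition lext V (F : I -> V) x : V := \sum_i x i *: F i.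

Lemma lext_is_linear V (F : I -> V) : linear (lext F).
Proof.
move=> c x y; rewrite /lext scaler_sumr -big_split /=.
by apply: eq_bigr => i _; rewrite !ffunE scalerDl scalerA.
Qed.
HB.instance Definition _ V (F : I -> V) :=
  GRing.isLinear.Build R[i] (vec R I) V _ (lext F) (@lext_is_linear V F).

Lemma vbaseE (i j : I) : vbase R i j = (j == i)%:R.
Proof. by rewrite ffunE. Qed.

Lemma vecZE (c : R[i]) x (i : I) : (c *: x : vec R I) i = c * x i.
Proof. by rewrite ffunE. Qed.

Lemma vecDE x y (i : I) : (x + y : vec R I) i = x i + y i.
Proof. by rewrite ffunE. Qed.

Lemma vec_sumE (K : Type) (r : seq K) (P : pred K) (F : K -> vec R I) i :
  (\sum_(k <- r | P k) F k : vec R I) i = \sum_(k <- r | P k) F k i.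
Proof. by elim/big_rec2: _ => [|k y x _ <-]; rewrite ffunE. Qed.

Lemma lext_base V (F : I -> V) i : lext F (vbase R i) = F i.
Proof.
rewrite /lext (bigD1 i) //= vbaseE eqxx scale1r big1 ?addr0 // => j ji.
by rewrite vbaseE (negbTE ji) scale0r.
Qed.

Lemma vec_sum x : x = \sum_i x i *: vbase R i.
Proof.
apply/ffunP => j; apply/esym; rewrite vec_sumE.
under eq_bigr => i _ do rewrite vecZE vbaseE.
rewrite (bigD1 j) //= eqxx mulr1 big1 ?addr0 // => i ij.
by rewrite eq_sym (negbTE ij) mulr0.
Qed.

Lemma linear_lext V (f : {linear vec R I -> V}) x :
  f x = lext (fun i => f (vbase R i)) x.
Proof. by rewrite {1}[x]vec_sum linear_sum; apply: eq_bigr => i _; rewrite linearZ. Qed.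

Lemma linear_ext V (f g : {linear vec R I -> V}) :
  (forall i, f (vbase R i) = g (vbase R i)) -> f =1 g.
Proof.
move=> fg x; rewrite (linear_lext f) (linear_lext g).
by apply: eq_bigr => i _; rewrite fg.
Qed.

Lemma vbase_inj : injective (@vbase R I).
Proof.
move=> i j /ffunP/(_ i); rewrite !vbaseE eqxx; case: eqP => // _ /eqP.
by rewrite oner_eq0.
Qed.
End LinearExtension.

Section Tensor.
Variables (R : realType) (I J : finType).
Implicit Types (x : vec R I) (y : vec R J).

Lemma tensE x y p : tens x y p = x p.1 * y p.2.
Proof. by rewrite ffunE. Qed.

Lemma tens_is_linear x : linear (@tens R I J x).
Proof.
move=> c y z; apply/ffunP=> p.
by rewrite vecDE vecZE !tensE vecDE vecZE mulrDr mulrCA.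
Qed.
HB.instance Definition _ x :=
  GRing.isLinear.Build R[i] (vec R J) (vec R (I * J)%type) _ (@tens R I J x) (tens_is_linear x).

Definition tensr y x := @tens R I J x y.
Lemma tensr_is_linear y : linear (tensr y).
Proof.
move=> c x z; apply/ffunP=> p.
by rewrite vecDE vecZE !tensE vecDE vecZE mulrDl mulrA.
Qed.
HB.instance Definition _ y :=
  GRing.isLinear.Build R[i] (vec R I) (vec R (I * J)%type) _ (tensr y) (tensr_is_linear y).

Lemma tens_base (i : I) (j : J) : tens (vbase R i) (vbase R j) = vbase R (i, j).
Proof.
apply/ffunP=> -[k l]; rewrite tensE !vbaseE /= xpair_eqE.
by case: (k == i); rewrite ?mul1r ?mul0r.
Qed.

Lemma tens_sum x y :
  tens x y = \sum_i \sum_j (x i * y j) *: vbase R (i, j).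
Proof.
rewrite {1}[y]vec_sum linear_sum exchange_big /=; apply: eq_bigr => j _.
rewrite linearZ /= -[tens _ _]/(tensr _ x) {1}[x]vec_sum linear_sum scaler_sumr.
by apply: eq_bigr => i _; rewrite linearZ /= /tensr tens_base scalerA mulrC.
Qed.

Lemma lext_tens (V : lmodType R[i]) (F : I * J -> V) x y :
  lext F (tens x y) = \sum_i \sum_j (x i * y j) *: F (i, j).
Proof.
rewrite tens_sum linear_sum; apply: eq_bigr => i _; rewrite linear_sum.
by apply: eq_bigr => j _; rewrite linearZ /= lext_base.
Qed.

End Tensor.

Lemma tmap_tens (R : realType) (I J I' J' : finType)
    (f : {linear vec R I -> vec R I'}) (g : {linear vec R J -> vec R J'}) x y :
  tmap f g (tens x y) = tens (f x) (g y).
Proof.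
rewrite [LHS](lext_tens _ x y) /= (linear_lext g y) linear_sum.
rewrite exchange_big; apply: eq_bigr => j _; rewrite linearZ /=.
rewrite -[tens (f x) _]/(tensr _ (f x)) (linear_lext f x) linear_sum scaler_sumr.
by apply: eq_bigr => i _; rewrite linearZ scalerA /= mulrC.
Qed.

(** * The group algebra as a ring *)

Definition galg (R : realType) (gT : finGroupType) : Type := vec R gT.

HB.instance Definition _ (R : realType) (gT : finGroupType) :=
  GRing.Lmodule.on (galg R gT).

HB.lock Definition gprod (R : realType) (gT : finGroupType)
  (x y : galg R gT) : galg R gT := gmul x y.

Section GroupAlgebraRing.
Variables (R : realType) (gT : finGroupType).
Local Notation A := (galg R gT).
Implicit Types x y z : A.

Lemma gmulE x y :
  gmul x y = lext (fun g => lext (fun h => lam R (g * h)%g) y) x.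
Proof.
apply: eq_bigr => g _; rewrite scaler_sumr.
by apply: eq_bigr => h _; rewrite scalerA.
Qed.

Lemma gmul_linearl z c x y :
  gmul (c *: x + y) z = c *: gmul x z + gmul y z :> A.
Proof. by rewrite !gmulE linearP. Qed.

Lemma gmul_linearr z c x y :
  gmul z (c *: x + y) = c *: gmul z x + gmul z y :> A.
Proof.
rewrite !gmulE /lext scaler_sumr -big_split; apply: eq_bigr => g _ /=.
by rewrite -!/(lext _ _) linearP scalerDr !scalerA mulrC.
Qed.

HB.instance Definition _ z :=
  GRing.isLinear.Build R[i] A A _ (gmul z) (gmul_linearr z).

Definition gmulr z x : A := gmul x z.
HB.instance Definition _ z :=
  GRing.isLinear.Build R[i] A A _ (gmulr z) (gmul_linearl z).

Lemma gmul_lam (g h : gT) : gmul (lam R g) (lam R h) = lam R (g * h)%g.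
Proof. by rewrite gmulE !lext_base. Qed.

Lemma gmulA : associative (@gmul R gT : A -> A -> A).
Proof.
move=> x y z.
have lamlamz g h : gmul (lam R g) (gmul (lam R h) z) = gmul (lam R (g * h)%g) z.
  apply: (linear_ext (f := gmul (lam R g) \o gmul (lam R h)) (g := gmul (lam R (g * h)%g))).
  by move=> k; rewrite /= !gmul_lam mulgA.
have lamyz g : gmul (lam R g) (gmul y z) = gmul (gmul (lam R g) y) z.
  apply: (linear_ext (f := gmul (lam R g) \o gmulr z) (g := gmulr z \o gmul (lam R g))).
  by move=> h; rewrite /= /gmulr lamlamz gmul_lam.
by apply: (linear_ext (f := gmulr (gmul y z)) (g := gmulr z \o gmulr y)).
Qed.

Lemma gmul1 : left_id (lam R 1%g : A) (@gmul R gT).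
Proof.
apply: (linear_ext (f := gmul (lam R 1%g)) (g := idfun)) => g.
by rewrite /= gmul_lam mul1g.
Qed.

Lemma gmulr1 : right_id (lam R 1%g : A) (@gmul R gT).
Proof.
apply: (linear_ext (f := gmulr (lam R 1%g)) (g := idfun)) => g.
by rewrite /= /gmulr gmul_lam mulg1.
Qed.

Lemma gprodE x y : gprod x y = gmul x y.
Proof. by rewrite gprod.unlock. Qed.

Fact gprodA : associative (@gprod R gT).
Proof. by move=> x y z; rewrite !gprodE gmulA. Qed.
Fact gprod1 : left_id (lam R 1%g : A) (@gprod R gT).
Proof. by move=> x; rewrite gprodE gmul1. Qed.
Fact gprodr1 : right_id (lam R 1%g : A) (@gprod R gT).
Proof. by move=> x; rewrite gprodE gmulr1. Qed.
Fact gprodDl : left_distributive (@gprod R gT) +%R.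
Proof. by move=> x y z; rewrite !gprodE -[LHS]/(gmulr z (x + y)) linearD. Qed.
Fact gprodDr : right_distributive (@gprod R gT) +%R.
Proof. by move=> x y z; rewrite !gprodE linearD. Qed.

Fact gone_neq0 : (lam R 1%g : A) != 0.
Proof.
apply/eqP => /ffunP/(_ 1%g); rewrite vbaseE eqxx ffunE => /eqP.
by rewrite oner_eq0.
Qed.

HB.instance Definition _ :=
  GRing.Zmodule_isNzRing.Build A gprodA gprod1 gprodr1 gprodDl gprodDr
    gone_neq0.

Lemma mulgalgE x y : x * y = gmul x y. Proof. exact: gprodE. Qed.

Fact gscaleAl (c : R[i]) x y : c *: (x * y) = c *: x * y.
Proof. by rewrite !mulgalgE -[RHS]/(gmulr y (c *: x)) linearZ. Qed.
HB.instance Definition _ := GRing.Lmodule_isLalgebra.Build R[i] A gscaleAl.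
Fact gscaleAr (c : R[i]) x y : c *: (x * y) = x * (c *: y).
Proof. by rewrite !mulgalgE linearZ. Qed.
HB.instance Definition _ := GRing.Lalgebra_isAlgebra.Build R[i] A gscaleAr.

Lemma galg_sum x : x = \sum_g x g *: (lam R g : A).
Proof. exact: vec_sum. Qed.

Lemma lamM (g h : gT) : lam R (g * h)%g = (lam R g : A) * lam R h.
Proof. by rewrite mulgalgE gmul_lam. Qed.
End GroupAlgebraRing.

(** * Maps induced by group homomorphisms, and the involution *)

HB.lock Definition gmap (R : realType) (gT hT : finGroupType) (phi : gT -> hT)
    (x : galg R gT) : galg R hT :=
  lext (fun g => lam R (phi g) : galg R hT) x.

Section InducedMaps.
Variable R : realType.
Implicit Types gT hT kT : finGroupType.
Local Notation gmap := (@gmap R _ _).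

Lemma gmapE gT hT (phi : gT -> hT) x :
  gmap phi x = lext (fun g => lam R (phi g) : galg R hT) x.
Proof. by rewrite gmap.unlock. Qed.

Lemma gmap_is_linear gT hT (phi : gT -> hT) : linear (gmap phi).
Proof. by move=> c x y; rewrite !gmapE linearP. Qed.
HB.instance Definition _ gT hT (phi : gT -> hT) :=
  GRing.isLinear.Build R[i] (galg R gT) (galg R hT) _ (gmap phi)
    (gmap_is_linear phi).

Lemma gmap_lam gT hT (phi : gT -> hT) g : gmap phi (lam R g) = lam R (phi g).
Proof. by rewrite gmapE; apply: lext_base. Qed.

Lemma gmapM gT hT (phi : gT -> hT) :
  {morph phi : g h / (g * h)%g} -> {morph gmap phi : x y / x * y}.
Proof.
move=> phiM x y.
rewrite [x in LHS]galg_sum [x in RHS]galg_sum mulr_suml !linear_sum mulr_suml.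
apply: eq_bigr => g _; rewrite -scalerAl !linearZ -scalerAl /=; congr (_ *: _).
rewrite [y in LHS]galg_sum [y in RHS]galg_sum mulr_sumr !linear_sum mulr_sumr.
apply: eq_bigr => h _; rewrite -scalerAr !linearZ -scalerAr /=; congr (_ *: _).
by rewrite -[LHS]/(gmap phi ((lam R g : galg R gT) * lam R h)) -lamM !gmap_lam phiM lamM.
Qed.

Lemma gmap_comp gT hT kT (phi : gT -> hT) (psi : hT -> kT) x :
  gmap psi (gmap phi x) = gmap (psi \o phi) x.
Proof.
apply: (linear_ext (f := gmap psi \o gmap phi) (g := gmap (psi \o phi))) => g.
by rewrite /= !gmap_lam.
Qed.

Lemma gmap_inj_coef gT hT (phi : gT -> hT) x g :
  injective phi -> gmap phi x (phi g) = x g.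
Proof.
move=> phi_inj; rewrite gmapE /lext vec_sumE.
under eq_bigr => h _ do rewrite vecZE vbaseE (inj_eq phi_inj).
rewrite (bigD1 g) //= eqxx mulr1 big1 ?addr0 // => h hg.
by rewrite eq_sym (negbTE hg) mulr0.
Qed.
End InducedMaps.

HB.lock Definition star (R : realType) (gT : finGroupType) (x : galg R gT) :
  galg R gT := gstar x.

Section Involution.
Variables (R : realType) (gT : finGroupType).
Local Notation A := (galg R gT).
Implicit Types x y : A.
Local Notation gmap := (@gmap R _ _).

Definition gconj x : A := [ffun g => (x g)^*%C].

Lemma gconjE x g : gconj x g = (x g)^*%C.
Proof. by rewrite ffunE. Qed.

Lemma star_gstar x : star x = gstar x.
Proof. by rewrite star.unlock. Qed.

Lemma starE x : star x = gmap (@inv gT) (gconj x).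
Proof. by rewrite star_gstar gmapE; apply: eq_bigr => g _; rewrite gconjE. Qed.

Lemma gconj_semilinear (c : R[i]) x y :
  gconj (c *: x + y) = (c^*)%C *: gconj x + gconj y.
Proof.
apply/ffunP=> g; rewrite gconjE vecDE vecZE [RHS]vecDE vecZE !gconjE.
by rewrite rmorphD rmorphM.
Qed.

Lemma star_semilinear (c : R[i]) x y :
  star (c *: x + y) = (c^*)%C *: star x + star y.
Proof. by rewrite !starE gconj_semilinear linearP. Qed.

Lemma starD x y : star (x + y) = star x + star y.
Proof. by rewrite -[x in LHS]scale1r star_semilinear conjc1 scale1r. Qed.

Lemma star0 : star (0 : A) = 0.
Proof.
by apply: (addrI (star (0 : A) : A)); rewrite -starD !addr0.
Qed.

Lemma starN x : star (- x) = - star x.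
Proof. by apply: (addIr (star x)); rewrite -starD !addNr star0. Qed.

Lemma starZ (c : R[i]) x : star (c *: x) = (c^*)%C *: star x.
Proof. by rewrite -[_ *: x]addr0 star_semilinear star0 addr0. Qed.

Lemma star_sum (I : Type) (r : seq I) (P : pred I) (F : I -> A) :
  star (\sum_(i <- r | P i) F i) = \sum_(i <- r | P i) star (F i).
Proof. exact: (big_morph (@star R gT) starD star0). Qed.

Lemma star_lam (g : gT) : star (lam R g) = lam R g^-1%g.
Proof.
rewrite starE -[RHS]gmap_lam; congr (gmap _ _).
by apply/ffunP => h; rewrite gconjE vbaseE conjc_nat.
Qed.

Lemma starM x y : star (x * y) = star y * star x.
Proof.
rewrite [x in LHS]galg_sum [x in RHS]galg_sum mulr_suml !star_sum mulr_sumr.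
apply: eq_bigr => g _; rewrite -scalerAl !starZ -scalerAr; congr (_ *: _).
rewrite [y in LHS]galg_sum [y in RHS]galg_sum mulr_sumr !star_sum mulr_suml.
apply: eq_bigr => h _; rewrite -scalerAr !starZ -scalerAl; congr (_ *: _).
rewrite -[LHS]/(star ((lam R g : A) * lam R h) : A) -lamM !star_lam.
by rewrite invMg lamM.
Qed.

Lemma starK x : star (star x) = x.
Proof.
rewrite [RHS]galg_sum [x in LHS]galg_sum !star_sum.
by apply: eq_bigr => g _; rewrite !starZ conjcK !star_lam invgK.
Qed.

Lemma star1 : star (1 : A) = 1.
Proof. by rewrite -[X in star X]/(lam R 1%g : A) star_lam invg1. Qed.
End Involution.

Lemma star_gmap (R : realType) (gT hT : finGroupType) (phi : gT -> hT)
    (x : galg R gT) :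
  {morph phi : g h / (g * h)%g} ->
  star (gmap phi x) = gmap phi (star x).
Proof.
move=> phiM; have phi1 : phi 1%g = 1%g.
  by apply: (mulgI (phi 1%g)); rewrite -phiM !mulg1.
rewrite [x in LHS]galg_sum [x in RHS]galg_sum star_sum !linear_sum star_sum.
apply: eq_bigr => g _; rewrite starZ !linearZ starZ /=; congr (_ *: _).
rewrite !star_lam !gmap_lam star_lam; congr (lam R _).
by apply: (mulgI (phi g)); rewrite -phiM !mulgV phi1.
Qed.

(** * Tensor products of group algebras are group algebras *)

(** Seen in the group algebra of [gT * hT], a tensor is subject to the ring
    structure, the involution and the induced maps [gmap] of that group. *)

HB.lock Definition gtens (R : realType) (gT hT : finGroupType)
    (x : galg R gT) (y : galg R hT) : galg R (gT * hT)%type := tens x y.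

Section GroupTensor.
Variable R : realType.
Implicit Types gT hT kT : finGroupType.
Local Notation gmap := (@gmap R _ _).

Lemma gtensE gT hT (x : galg R gT) (y : galg R hT) : gtens x y = tens x y.
Proof. by rewrite gtens.unlock. Qed.
Definition gtensr gT hT (y : galg R hT) (x : galg R gT) := gtens x y.

Lemma gtens_is_linear gT hT (x : galg R gT) : linear (@gtens R gT hT x).
Proof. by move=> c y z; rewrite !gtensE; apply: tens_is_linear. Qed.
HB.instance Definition _ gT hT (x : galg R gT) :=
  GRing.isLinear.Build R[i] (galg R hT) (galg R (gT * hT)%type) _
    (@gtens R gT hT x) (gtens_is_linear x).
Lemma gtensr_is_linear gT hT (y : galg R hT) : linear (@gtensr gT hT y).
Proof. by move=> c x z; rewrite /gtensr !gtensE; apply: tensr_is_linear. Qed.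
HB.instance Definition _ gT hT (y : galg R hT) :=
  GRing.isLinear.Build R[i] (galg R gT) (galg R (gT * hT)%type) _
    (@gtensr gT hT y) (gtensr_is_linear y).

Lemma gtensZl gT hT (c : R[i]) (x : galg R gT) (y : galg R hT) :
  gtens (c *: x) y = c *: gtens x y.
Proof. exact: (linearZ_LR (gtensr y)). Qed.
Lemma gtensZr gT hT (c : R[i]) (x : galg R gT) (y : galg R hT) :
  gtens x (c *: y) = c *: gtens x y.
Proof. exact: (linearZ_LR (gtens x)). Qed.
Lemma gtensDl gT hT (x x' : galg R gT) (y : galg R hT) :
  gtens (x + x') y = gtens x y + gtens x' y.
Proof. exact: (linearD (gtensr y)). Qed.
Lemma gtensDr gT hT (x : galg R gT) (y y' : galg R hT) :
  gtens x (y + y') = gtens x y + gtens x y'.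
Proof. exact: (linearD (gtens x)). Qed.
Lemma gtens_suml gT hT I (r : seq I) (P : pred I) (F : I -> galg R gT)
    (y : galg R hT) :
  gtens (\sum_(i <- r | P i) F i) y = \sum_(i <- r | P i) gtens (F i) y.
Proof. exact: (linear_sum (gtensr y)). Qed.
Lemma gtens_sumr gT hT I (r : seq I) (P : pred I) (F : I -> galg R hT)
    (x : galg R gT) :
  gtens x (\sum_(i <- r | P i) F i) = \sum_(i <- r | P i) gtens x (F i).
Proof. exact: (linear_sum (gtens x)). Qed.

Lemma gtens_lam gT hT (g : gT) (h : hT) :
  gtens (lam R g) (lam R h) = lam R (g, h).
Proof. by rewrite gtensE; apply: tens_base. Qed.

Lemma gtensM gT hT (x x' : galg R gT) (y y' : galg R hT) :
  gtens x y * gtens x' y' = gtens (x * x') (y * y').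
Proof.
rewrite (galg_sum x) mulr_suml !gtens_suml mulr_suml; apply: eq_bigr => g _.
rewrite -scalerAl !gtensZl -scalerAl; congr (_ *: _).
rewrite (galg_sum x') mulr_sumr !gtens_suml mulr_sumr; apply: eq_bigr => g' _.
rewrite -scalerAr !gtensZl -scalerAr; congr (_ *: _).
rewrite (galg_sum y) mulr_suml !gtens_sumr mulr_suml; apply: eq_bigr => h _.
rewrite -scalerAl !gtensZr -scalerAl; congr (_ *: _).
rewrite (galg_sum y') mulr_sumr !gtens_sumr mulr_sumr; apply: eq_bigr => h' _.
rewrite -scalerAr !gtensZr -scalerAr; congr (_ *: _).
by rewrite -!lamM !gtens_lam -lamM.
Qed.

Lemma gtens1 gT hT : gtens (1 : galg R gT) (1 : galg R hT) = 1.
Proof. exact: gtens_lam. Qed.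

Lemma star_gtens gT hT (x : galg R gT) (y : galg R hT) :
  star (gtens x y) = gtens (star x) (star y).
Proof.
rewrite (galg_sum x) !star_sum !gtens_suml !star_sum; apply: eq_bigr => g _.
rewrite !starZ !gtensZl starZ; congr (_ *: _).
rewrite (galg_sum y) !star_sum !gtens_sumr !star_sum; apply: eq_bigr => h _.
rewrite !starZ !gtensZr starZ; congr (_ *: _).
by rewrite !star_lam !gtens_lam star_lam.
Qed.

Lemma gmap_gtens gT hT gT' hT' (phi : gT -> gT') (psi : hT -> hT') x y :
  gmap (fun p => (phi p.1, psi p.2)) (gtens x y)
  = gtens (gmap phi x) (gmap psi y).
Proof.
rewrite (galg_sum x) gtens_suml !linear_sum gtens_suml; apply: eq_bigr => g _.
rewrite gtensZl !linearZ gtensZl /=; congr (_ *: _).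
rewrite (galg_sum y) !linear_sum; apply: eq_bigr => h _.
rewrite !linearZ /=; congr (_ *: _).
by rewrite gtens_lam !gmap_lam gtens_lam.
Qed.

Lemma tmul_galg gT (t u : galg R (gT * gT)%type) :
  tmul (@gmul R gT) t u = t * u.
Proof.
rewrite [t in RHS]galg_sum mulr_suml; apply: eq_bigr => p _.
rewrite [u in RHS]galg_sum mulr_sumr; apply: eq_bigr => q _.
rewrite -scalerAl -scalerAr scalerA; congr (_ *: _).
rewrite !gmul_lam -lamM; by rewrite -gtens_lam gtensE.
Qed.

Lemma tstar_galg gT (t : galg R (gT * gT)%type) :
  tstar (@gstar R gT) t = star t.
Proof.
rewrite [t in RHS]galg_sum star_sum; apply: eq_bigr => p _.
rewrite starZ star_lam -!star_gstar !star_lam; congr (_ *: _).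
by rewrite -gtens_lam gtensE.
Qed.

Definition diag gT (g : gT) : gT * gT := (g, g).
Lemma diagM gT : {morph @diag gT : g h / (g * h)%g}.
Proof. by []. Qed.

Lemma gcomul_galg gT (x : galg R gT) : gcomul x = gmap (@diag gT) x.
Proof.
rewrite gmapE; apply: eq_bigr => g _; congr (_ *: _); by rewrite -gtens_lam gtensE.
Qed.
End GroupTensor.

(** * The operator norm of the regular representation *)

Section OperatorNorm.
Local Open Scope classical_set_scope.
Variables (R : realType) (gT : finGroupType).
Local Notation A := (galg R gT).
Implicit Types (x y z u v w : A) (c : R[i]).

Lemma lam_mul_coef (g : gT) x h : ((lam R g : A) * x) h = x (g^-1 * h)%g.
Proof.
rewrite [x in LHS]galg_sum mulr_sumr vec_sumE.
under eq_bigr => k _ do rewrite -scalerAr -lamM vecZE vbaseE.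
rewrite (bigD1 (g^-1 * h)%g) //= mulKVg eqxx mulr1 big1 ?addr0 // => k kh.
by case: eqP => [hE|]; rewrite ?mulr0 //; rewrite hE mulKg eqxx in kh.
Qed.

Definition herm u v : R[i] := \sum_g (u g)^*%C * v g.

Lemma herm_lin u c v w : herm u (c *: v + w) = c * herm u v + herm u w.
Proof.
rewrite /herm mulr_sumr -big_split; apply: eq_bigr => g _ /=.
by rewrite vecDE vecZE mulrDr mulrCA.
Qed.

Lemma herm_sym u v : herm u v = (herm v u)^*%C.
Proof.
rewrite /herm rmorph_sum; apply: eq_bigr => g _.
by rewrite rmorphM /= conjcK mulrC.
Qed.

Lemma herm_linl u c v w :
  herm (c *: v + w) u = (c^*)%C * herm v u + herm w u.
Proof. by rewrite herm_sym herm_lin rmorphD rmorphM /= -!herm_sym. Qed.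

Lemma herm0l u : herm 0 u = 0.
Proof. by rewrite /herm big1 // => g _; rewrite ffunE conjc0 mul0r. Qed.
Lemma herm0r u : herm u 0 = 0.
Proof. by rewrite herm_sym herm0l conjc0. Qed.

Lemma herm_suml (I : finType) (c : I -> R[i]) (v : I -> A) u :
  herm (\sum_i c i *: v i) u = \sum_i (c i)^*%C * herm (v i) u.
Proof.
elim/big_rec2: _ => [|i a w _ IH]; first exact: herm0l.
by rewrite herm_linl IH.
Qed.
Lemma herm_sumr (I : finType) (c : I -> R[i]) (v : I -> A) u :
  herm u (\sum_i c i *: v i) = \sum_i c i * herm u (v i).
Proof.
elim/big_rec2: _ => [|i a w _ IH]; first exact: herm0r.
by rewrite herm_lin IH.
Qed.

Lemma herm_lam (g : gT) z w :
  herm ((lam R g : A) * z) w = herm z ((lam R g^-1 : A) * w).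
Proof.
rewrite /herm (reindex_inj (mulgI g)); apply: eq_bigr => h _.
congr (_^*%C * _); first by rewrite lam_mul_coef mulKg.
by rewrite lam_mul_coef invgK.
Qed.

Lemma herm_adj x z w : herm (x * z) w = herm z (star x * w).
Proof.
rewrite (galg_sum x) star_sum !mulr_suml.
under eq_bigr do rewrite -scalerAl.
under [in RHS]eq_bigr do rewrite starZ star_lam -scalerAl.
by rewrite herm_suml herm_sumr; apply: eq_bigr => g _; rewrite herm_lam.
Qed.

(** The real part of the Hermitian form: a real inner product with the same
    norm, so that the estimates below stay in [R]. *)
Definition ip u v : R := complex.Re (herm u v).

Lemma ReM_real (r : R) c : complex.Re (r%:C * c) = r * complex.Re c.
Proof. by case: c => a b /=; rewrite mul0r subr0. Qed.
Lemma ip_lin u (r : R) v w : ip u (r%:C *: v + w) = r * ip u v + ip u w.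
Proof. by rewrite /ip herm_lin raddfD /= ReM_real. Qed.
Lemma ip_sym u v : ip u v = ip v u.
Proof. by rewrite /ip herm_sym; case: (herm v u). Qed.
Lemma ip_linl u (r : R) v w : ip (r%:C *: v + w) u = r * ip v u + ip w u.
Proof. by rewrite ip_sym ip_lin !(ip_sym u). Qed.
Lemma ip_adj x z w : ip (x * z) w = ip z (star x * w).
Proof. by rewrite /ip herm_adj. Qed.

Lemma ip_normE u :
  ip u u = \sum_g ((complex.Re (u g)) ^+ 2 + (complex.Im (u g)) ^+ 2).
Proof.
rewrite /ip /herm raddf_sum; apply: eq_bigr => g _.
by case: (u g) => a b /=; rewrite mulNr opprK !expr2.
Qed.
Lemma ip_ge0 u : 0 <= ip u u.
Proof.
by rewrite ip_normE; apply: sumr_ge0 => g _; rewrite addr_ge0 ?sqr_ge0.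
Qed.
Lemma ip_eq0 u : ip u u = 0 -> u = 0.
Proof.
rewrite ip_normE => /eqP; rewrite psumr_eq0 => [/allP u0|g _]; last first.
  by rewrite addr_ge0 ?sqr_ge0.
apply/ffunP => g; rewrite ffunE; have := u0 g; rewrite mem_index_enum => /(_ isT).
rewrite implyTb paddr_eq0 ?sqr_ge0 // !sqrf_eq0.
by case: (u g) => a b /= /andP[/eqP-> /eqP->].
Qed.
Lemma ipZ c u :
  ip (c *: u) (c *: u) = (complex.Re c ^+ 2 + complex.Im c ^+ 2) * ip u u.
Proof.
rewrite !ip_normE mulr_sumr; apply: eq_bigr => g _; rewrite vecZE.
by case: c (u g) => a b [a' b'] /=; ring.
Qed.

Lemma cauchy_schwarz u v : ip u v ^+ 2 <= ip u u * ip v v.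
Proof.
have [v0|v0] := eqVneq (ip v v) 0.
  rewrite v0 mulr0 (ip_eq0 v0) /ip herm0r /=.
  by rewrite expr0n.
have vv : 0 < ip v v by rewrite lt_neqAle eq_sym v0 ip_ge0.
have := ip_ge0 ((ip v v)%:C *: u + ((- ip u v)%:C *: v + 0)).
have E : forall w, ip w 0 = 0 by move=> w; rewrite /ip herm0r.
rewrite !(ip_lin, ip_linl) !E (ip_sym v u) !(ip_sym 0) !E.
set a := ip u u; set b := ip v v in vv *; set s := ip u v => H.
have : 0 <= b * (a * b - s ^+ 2) by move: H; congr (_ <= _); ring.
by rewrite pmulr_rge0 // subr_ge0.
Qed.

Definition nrm u : R := Num.sqrt (ip u u).

Lemma nrm_ge0 u : 0 <= nrm u. Proof. exact: sqrtr_ge0. Qed.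
Lemma nrm_sqr u : nrm u ^+ 2 = ip u u. Proof. by rewrite sqr_sqrtr ?ip_ge0. Qed.
Lemma nrm0 : nrm 0 = 0. Proof. by rewrite /nrm /ip herm0l sqrtr0. Qed.
Lemma nrm_eq0 u : nrm u = 0 -> u = 0.
Proof. by move=> u0; apply: ip_eq0; rewrite -nrm_sqr u0 expr0n. Qed.

Lemma ip_le u v : ip u v <= nrm u * nrm v.
Proof.
apply: le_trans (ler_norm _) _; rewrite -ler_sqr ?nnegrE ?mulr_ge0 ?nrm_ge0 //.
by rewrite real_normK ?num_real // exprMn !nrm_sqr cauchy_schwarz.
Qed.

Lemma nrmD u v : nrm (u + v) <= nrm u + nrm v.
Proof.
rewrite -ler_sqr ?nnegrE ?addr_ge0 ?nrm_ge0 // nrm_sqr.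
rewrite -[u]scale1r -[1]/(1%:C) ip_lin !ip_linl [1%:C *: u]scale1r.
rewrite (ip_sym v u) sqrrD !nrm_sqr; have := ip_le u v; lra.
Qed.

Lemma nrmZ c u : nrm (c *: u) = complex.Re `|c| * nrm u.
Proof. by rewrite /nrm ipZ sqrtrM ?addr_ge0 ?sqr_ge0 // normc_def. Qed.

Lemma normc_real c : `|c| = (complex.Re `|c|)%:C.
Proof. by rewrite normc_def. Qed.

Lemma Re_norm_ge0 c : 0 <= complex.Re `|c|.
Proof. by rewrite normc_def /= sqrtr_ge0. Qed.

Lemma nrm_lam (g : gT) u : nrm ((lam R g : A) * u) = nrm u.
Proof. by rewrite /nrm ip_adj star_lam mulrA -lamM mulVg mul1r. Qed.

Definition unit_values x : set R :=
  [set r | exists2 y, nrm y <= 1 & r = nrm (x * y)].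
Definition opn x : R := sup (unit_values x).

(** The coefficients bound the operator, since translations are isometries. *)
Lemma nrm_mul_bounded x : exists2 M, 0 <= M & forall y, nrm (x * y) <= M * nrm y.
Proof.
exists (\sum_g complex.Re `|x g|); first by apply: sumr_ge0 => g _; apply: Re_norm_ge0.
move=> y; rewrite [x in nrm (x * y)]galg_sum mulr_suml.
elim/big_rec2: _ => [|g z M _ IH]; first by rewrite nrm0 mul0r.
by rewrite (le_trans (nrmD _ _)) // mulrDl lerD // -scalerAl nrmZ nrm_lam.
Qed.

Lemma unit_values0 x : unit_values x !=set0.
Proof. by exists (nrm (x * 0)), 0; rewrite // nrm0. Qed.

Lemma has_sup_unit_values x : has_sup (unit_values x).
Proof.
split; first exact: unit_values0.
have [M M0 xM] := nrm_mul_bounded x; exists M => _ [y y1 ->].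
by rewrite (le_trans (xM y)) // ler_piMr.
Qed.

Lemma opn_ge0 x : 0 <= opn x.
Proof.
apply: sup_upper_bound (has_sup_unit_values x) _ _.
by exists 0; rewrite ?mulr0 nrm0.
Qed.

Lemma opn_bound x y : nrm (x * y) <= opn x * nrm y.
Proof.
have [y0|y0] := eqVneq (nrm y) 0.
  by rewrite (nrm_eq0 y0) mulr0 !nrm0 mulr0.
have y_gt0 : 0 < nrm y by rewrite lt_neqAle eq_sym y0 nrm_ge0.
rewrite -ler_pdivrMr //; apply: sup_upper_bound (has_sup_unit_values x) _ _.
have sE : complex.Re `|(nrm y)^-1%:C| = (nrm y)^-1.
  by rewrite normc_def /= expr0n addr0 sqrtr_sqr ger0_norm // invr_ge0 ltW.
exists ((nrm y)^-1%:C *: y); first by rewrite nrmZ sE mulVf.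
by rewrite -scalerAr nrmZ sE mulrC.
Qed.

Lemma opn_le x M : 0 <= M -> (forall y, nrm (x * y) <= M * nrm y) -> opn x <= M.
Proof.
move=> M0 xM; apply: ge_sup; first exact: unit_values0.
by move=> _ [y y1 ->]; rewrite (le_trans (xM y)) // ler_piMr.
Qed.

Lemma opnM x y : opn (x * y) <= opn x * opn y.
Proof.
apply: opn_le => [|z]; first by rewrite mulr_ge0 ?opn_ge0.
rewrite -!mulrA (le_trans (opn_bound _ _)) //.
by rewrite ler_wpM2l ?opn_ge0 ?opn_bound.
Qed.

Lemma opnD x y : opn (x + y) <= opn x + opn y.
Proof.
apply: opn_le => [|z]; first by rewrite addr_ge0 ?opn_ge0.
by rewrite !mulrDl (le_trans (nrmD _ _)) // lerD ?opn_bound.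
Qed.

Lemma opn_eq0 x : opn x = 0 -> x = 0.
Proof.
move=> x0; have := opn_bound x 1; rewrite mulr1 x0 mul0r => xle.
by apply: nrm_eq0; apply/le_anti; rewrite xle nrm_ge0.
Qed.

Lemma opnZ c x : opn (c *: x) = complex.Re `|c| * opn x.
Proof.
have le d z : opn (d *: z) <= complex.Re `|d| * opn z.
  apply: opn_le => [|y]; first by rewrite mulr_ge0 ?opn_ge0 ?Re_norm_ge0.
  by rewrite -scalerAl nrmZ -mulrA ler_wpM2l ?opn_bound ?Re_norm_ge0.
have [->|c0] := eqVneq c 0.
  rewrite normr0 mul0r scale0r; apply/le_anti; rewrite opn_ge0 andbT.
  by apply: opn_le => // y; rewrite mul0r nrm0 mul0r.
apply/le_anti; rewrite le /=.
have := le c^-1 (c *: x); rewrite scalerA mulVf // scale1r => xle.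
have nc : 0 < complex.Re `|c|.
  rewrite lt_neqAle Re_norm_ge0 andbT eq_sym; apply: contra_neq c0 => n0.
  by apply/eqP; rewrite -normr_eq0 normc_real n0.
rewrite -ler_pdivlMl // (le_trans xle) // normfV.
suff -> : complex.Re (`|c|^-1) = (complex.Re `|c|)^-1 by [].
by rewrite [in LHS]normc_real -fmorphV.
Qed.

(** Cauchy-Schwarz on [|x y|^2 = <y, x^* x y>] gives [N x ^ 2 <= N (x^* x)];
    submultiplicativity then yields [N x <= N x^*], hence equality of the two,
    and the converse bound. *)
Lemma opn_cstar x : opn (star x * x) = opn x ^+ 2.
Proof.
have le1 z : opn z ^+ 2 <= opn (star z * z).
  rewrite -(sqr_sqrtr (opn_ge0 (star z * z))) ler_sqr ?nnegrE ?opn_ge0 ?sqrtr_ge0 //.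
  apply: opn_le => [|y]; first exact: sqrtr_ge0.
  rewrite -ler_sqr ?nnegrE ?mulr_ge0 ?nrm_ge0 ?sqrtr_ge0 // exprMn.
  rewrite (sqr_sqrtr (opn_ge0 _)) nrm_sqr ip_adj (le_trans (ip_le _ _)) //.
  by rewrite expr2 [X in _ <= X]mulrA [X in _ <= X]mulrC mulrA ler_wpM2l ?nrm_ge0 ?opn_bound.
have le2 z : opn z <= opn (star z).
  have [->|z0] := eqVneq (opn z) 0; first exact: opn_ge0.
  have z_gt0 : 0 < opn z by rewrite lt_neqAle eq_sym z0 opn_ge0.
  by rewrite -(ler_pM2r z_gt0) -expr2 (le_trans (le1 z)) // opnM.
apply/le_anti; rewrite le1 andbT expr2 (le_trans (opnM _ _)) //.
by rewrite ler_wpM2r ?opn_ge0 // -[X in _ <= opn X]starK le2.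
Qed.
End OperatorNorm.

(** * Fourth roots of unity *)

Lemma Z4_ind (P : 'Z_4 -> Prop) : P 0 -> P 1 -> P 2 -> P 3 -> forall p, P p.
Proof.
move=> P0 P1 P2 P3 [[|[|[|[|//]]]] lt4].
- by rewrite (_ : Ordinal _ = 0) //; apply: val_inj.
- by rewrite (_ : Ordinal _ = 1) //; apply: val_inj.
- by rewrite (_ : Ordinal _ = 2) //; apply: val_inj.
- by rewrite (_ : Ordinal _ = 3) //; apply: val_inj.
Qed.

Lemma sumZ4 (V : zmodType) (F : 'Z_4 -> V) :
  \sum_p F p = F 0 + F 1 + F 2 + F 3.
Proof.
rewrite !big_ord_recl big_ord0 addr0 !addrA.
by congr (F _ + F _ + F _ + F _); apply: val_inj.
Qed.

(** [omega] on fourth roots of unity is [i] to this power ([omega_i4]). *)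
Definition omega_exp (p q : 'Z_4) : 'Z_4 :=
  if (p, q) \in [:: (2, 1); (1, 3); (3, 2)] then 1
  else if (p, q) \in [:: (1, 2); (3, 1); (2, 3)] then 3 else 0.

(** The twist fails to be a 2-cocycle by a sign, which only sees parities. *)
Lemma omega_exp_cocycle (p q r : 'Z_4) :
  omega_exp p q + omega_exp (p + q) r
  = omega_exp q r + omega_exp p (q + r) + 2 * (p * q * r).
Proof.
by elim/Z4_ind: p; elim/Z4_ind: q; elim/Z4_ind: r; apply/eqP; vm_compute.
Qed.

Lemma omega_exp0l q : omega_exp 0 q = 0.
Proof. by elim/Z4_ind: q; apply/eqP; vm_compute. Qed.
Lemma omega_exp0r q : omega_exp q 0 = 0.
Proof. by elim/Z4_ind: q; apply/eqP; vm_compute. Qed.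

Lemma omega_exp_antipode (p : 'Z_4) :
  omega_exp p (- p) = omega_exp (- p) p + 2 * p.
Proof. by elim/Z4_ind: p; apply/eqP; vm_compute. Qed.

Section FourthRoots.
Variable R : realType.

Definition i4 (p : 'Z_4) : R[i] := 'i%C ^+ p.

Lemma i_exp4 : 'i%C ^+ 4 = 1 :> R[i].
Proof. by rewrite (exprM _ 2 2) sqr_i sqrrN expr1n. Qed.

Lemma i4_nat (m : nat) : i4 m%:R = 'i%C ^+ m.
Proof. by rewrite /i4 val_Zp_nat // expr_mod // i_exp4. Qed.

Lemma i4D p q : i4 (p + q) = i4 p * i4 q.
Proof. by rewrite -[p]natr_Zp -[q]natr_Zp -natrD !i4_nat exprD. Qed.

Lemma i4_0 : i4 0 = 1. Proof. by []. Qed.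
Lemma i4_1 : i4 1 = 'i%C. Proof. by []. Qed.

Lemma i4V p : i4 (- p) * i4 p = 1.
Proof. by rewrite -i4D addNr. Qed.

Lemma i4_neq0 p : i4 p != 0.
Proof. by apply: contra_eq_neq (i4V p) => ->; rewrite mulr0 eq_sym oner_eq0. Qed.

Lemma i4N p : i4 (- p) = (i4 p)^-1.
Proof. by apply: (mulIf (i4_neq0 p)); rewrite i4V mulVf ?i4_neq0. Qed.

Lemma conj_i4 p : (i4 p)^*%C = i4 (- p).
Proof.
rewrite i4N /i4 rmorphXn /= -exprVn -i4_1; congr (_ ^+ _).
apply: (mulIf (i4_neq0 1)); rewrite mulVf ?i4_neq0 // i4_1.
by simpc.
Qed.

Lemma i4_2 : i4 2 = -1. Proof. by rewrite i4_nat sqr_i. Qed.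
Lemma i4_3 : i4 3 = - 'i%C. Proof. by rewrite i4_nat exprS sqr_i mulrN1. Qed.

Lemma i4_eq1 p : (i4 p == 1) = (p == 0).
Proof.
elim/Z4_ind: p; rewrite ?i4_0 ?i4_1 ?i4_2 ?i4_3 ?eqxx // eq_complex /=.
- by rewrite oner_eq0 andbF.
- by rewrite -subr_eq0 -opprD oppr_eq0 (pnatr_eq0 _ 2).
- by rewrite oppr_eq0 oner_eq0 andbF.
Qed.

Lemma i4_inj : injective i4.
Proof.
move=> p q pq; apply/eqP; rewrite -subr_eq0 -i4_eq1 i4D pq -i4D subrr.
by rewrite i4_eq1.
Qed.

Lemma i4_sum p : \sum_s i4 (p * s) = 4 * (p == 0)%:R.
Proof.
have e22 : 2 * 2 = 0 :> 'Z_4 by apply: val_inj.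
have e23 : 2 * 3 = 2 :> 'Z_4 by apply: val_inj.
have e32 : 3 * 2 = 2 :> 'Z_4 by apply: val_inj.
have e33 : 3 * 3 = 1 :> 'Z_4 by apply: val_inj.
rewrite sumZ4 mulr0 mulr1 i4_0; elim/Z4_ind: p.
- by rewrite !mul0r i4_0 eqxx /=; ring.
- by rewrite !mul1r i4_1 i4_2 i4_3 (_ : (1 == _) = false) //=; ring.
- by rewrite e22 e23 i4_0 i4_2 (_ : (2 == _) = false) //=; ring.
- by rewrite e32 e33 i4_1 i4_2 i4_3 (_ : (3 == _) = false) //=; ring.
Qed.

Lemma omega_i4 p q : omega (i4 p) (i4 q) = i4 (omega_exp p q).
Proof.
pose f (u : 'Z_4 * 'Z_4) : R[i] * R[i] := (i4 u.1, i4 u.2).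
have f_inj : injective f by move=> [a b] [c d] [/i4_inj-> /i4_inj->].
rewrite /omega /omega_exp -[(i4 p, i4 q)]/(f (p, q)) -i4_1 -i4_2 -i4_3.
rewrite -[[:: (i4 2, _); _; _]]/(map f [:: (2, 1); (1, 3); (3, 2)]).
rewrite -[[:: (i4 1, _); _; _]]/(map f [:: (1, 2); (3, 1); (2, 3)]).
by rewrite !(mem_map f_inj); case: ifP => // _; case: ifP.
Qed.
End FourthRoots.

Lemma sum_delta (R : pzRingType) (V : lmodType R) (I : finType) (i : I)
    (F : I -> V) : \sum_j (i == j)%:R *: F j = F i.
Proof.
rewrite (bigD1 i) //= eqxx scale1r big1 ?addr0 // => j.
by rewrite eq_sym => /negbTE ->; rewrite scale0r.
Qed.

Lemma sum_deltaM (R : pzRingType) (I : finType) (i : I) (F : I -> R) :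
  \sum_j (i == j)%:R * F j = F i.
Proof. exact: (sum_delta i (F : I -> R^o)). Qed.

(** * Elements acting diagonally on a resolution of the identity *)

Section Diagonal.
Variables (R : realType) (gT : finGroupType) (K : finType).
Variable E : K -> galg R gT.
Implicit Types (t u : galg R gT) (f h : K -> R[i]).

(** [t] is the combination of the [E k] with coefficients [f k] as soon as the
    [E k] are a resolution of the identity.  Stating this through products on
    both sides lets identities be checked on the coefficients [f], also in
    tensor products. *)
Definition diag_on t f :=
  forall k, E k * t = f k *: E k /\ t * E k = f k *: E k.

Lemma diagonal1 : diag_on 1 (fun=> 1).
Proof. by move=> k; rewrite mul1r mulr1 scale1r. Qed.

Lemma diagonalM t u f h :
  diag_on t f -> diag_on u h -> diag_on (t * u) (fun k => f k * h k).
Proof.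
move=> tf uh k; have [Et tE] := tf k; have [Eu uE] := uh k; split.
  by rewrite mulrA Et -scalerAl Eu scalerA.
by rewrite -mulrA uE -scalerAr tE scalerA mulrC.
Qed.

Lemma diagonalZ c t f : diag_on t f -> diag_on (c *: t) (fun k => c * f k).
Proof.
by move=> tf k; have [Et tE] := tf k; rewrite -scalerAl -scalerAr Et tE scalerA.
Qed.

Lemma diagonal_sum (I : finType) (t : I -> galg R gT) (f : I -> K -> R[i]) :
  (forall i, diag_on (t i) (f i)) ->
  diag_on (\sum_i t i) (fun k => \sum_i f i k).
Proof.
move=> tf k; rewrite mulr_sumr mulr_suml !scaler_suml.
by split; apply: eq_bigr => i _; have [] := tf i k.
Qed.

Lemma diagonal_ext t f h : f =1 h -> diag_on t f -> diag_on t h.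
Proof. by move=> fh tf k; rewrite -!fh. Qed.

Lemma diagonal_star t f : (forall k, star (E k) = E k) ->
  diag_on t f -> diag_on (star t) (fun k => (f k)^*%C).
Proof.
move=> Estar tf k; have [Et tE] := tf k; split.
  by rewrite -[E k in LHS]Estar -starM tE starZ Estar.
by rewrite -[E k in LHS]Estar -starM Et starZ Estar.
Qed.

Hypothesis E_sum : \sum_k E k = 1.

Lemma diagonal_eq t u f : diag_on t f -> diag_on u f -> t = u.
Proof.
move=> tf uf; rewrite -[t]mulr1 -[u]mulr1 -E_sum !mulr_sumr.
by apply: eq_bigr => k _; rewrite (tf k).2 (uf k).2.
Qed.

Lemma diagonal_is1 t f : f =1 (fun=> 1) -> diag_on t f -> t = 1.
Proof. by move=> f1 /(diagonal_ext f1) tf; apply: diagonal_eq tf diagonal1. Qed.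

Lemma sandwich_eq t u :
  (forall k l, E k * t * E l = E k * u * E l) -> t = u.
Proof.
have dec v : v = \sum_k \sum_l E k * v * E l.
  under eq_bigr do rewrite -mulr_sumr E_sum mulr1.
  by rewrite -mulr_suml E_sum mul1r.
move=> tu; rewrite (dec t) (dec u).
by apply: eq_bigr => k _; apply: eq_bigr => l _.
Qed.
End Diagonal.

Lemma diagonal_tens (R : realType) (gT hT : finGroupType) (K L : finType)
    (E : K -> galg R gT) (F : L -> galg R hT) t f u h :
  diag_on E t f -> diag_on F u h ->
  diag_on (fun k : K * L => gtens (E k.1) (F k.2)) (gtens t u)
    (fun k => f k.1 * h k.2).
Proof.
move=> tf uh [k l] /=; have [Et tE] := tf k; have [Fu uF] := uh l.
by rewrite !gtensM Et tE Fu uF gtensZl gtensZr scalerA.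
Qed.

Lemma diagonal_gmap (R : realType) (gT hT : finGroupType) (K : finType)
    (E : K -> galg R gT) (phi : gT -> hT) t f :
  {morph phi : g h / (g * h)%g} -> diag_on E t f ->
  diag_on (fun k => gmap phi (E k)) (gmap phi t) f.
Proof.
by move=> phiM tf k; have [Et tE] := tf k; rewrite -!gmapM // Et tE linearZ.
Qed.

Lemma gmap1 (R : realType) (gT hT : finGroupType) (phi : gT -> hT) :
  {morph phi : g h / (g * h)%g} -> gmap phi 1 = 1 :> galg R hT.
Proof.
move=> phiM; rewrite -[1 in LHS]/(lam R 1%g : galg R gT) gmap_lam.
congr (lam R _); by apply: (mulgI (phi 1%g)); rewrite -phiM !mulg1.
Qed.

(** * The spectral projections of an element of order dividing 4 *)

HB.lock Definition lb (R : realType) (gT : finGroupType) (b : gT) (s : 'Z_4) :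
  galg R gT := lam R (b ^+ s)%g.
HB.lock Definition proj (R : realType) (gT : finGroupType) (b : gT) (p : 'Z_4) :
  galg R gT := 4^-1 *: \sum_s i4 R (- (p * s)) *: lb R b s.

Section Projections.
Variables (R : realType) (gT : finGroupType) (b : gT).
Hypothesis b4 : (b ^+ 4 = 1)%g.
Local Notation A := (galg R gT).
Local Notation ii := (i4 R).
Implicit Types p q s : 'Z_4.

Local Notation lb := (@lb R gT b).
Local Notation proj := (@proj R gT b).

Lemma lbE s : lb s = lam R (b ^+ s)%g.
Proof. by rewrite lb.unlock. Qed.
Lemma projE p : proj p = 4^-1 *: \sum_s ii (- (p * s)) *: lb s.
Proof. by rewrite proj.unlock. Qed.

Lemma lb_nat m : lb m%:R = lam R (b ^+ m)%g.
Proof. by rewrite lbE val_Zp_nat // expg_mod. Qed.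

Lemma lbD s t : lb (s + t) = lb s * lb t.
Proof. by rewrite -[s]natr_Zp -[t]natr_Zp -natrD !lb_nat expgD lamM. Qed.

Lemma lb0 : lb 0 = 1. Proof. exact: lbE. Qed.

Lemma star_lb s : star (lb s) = lb (- s).
Proof.
have sV : star (lb s) * lb s = 1 by rewrite lbE star_lam -lamM mulVg.
by rewrite -[LHS]mulr1 -lb0 -(subrr s) lbD mulrA sV mul1r.
Qed.

Lemma lb_proj s p : lb s * proj p = ii (p * s) *: proj p.
Proof.
rewrite projE -scalerAr scalerA mulrC -scalerA; congr (_ *: _).
rewrite mulr_sumr scaler_sumr [RHS](reindex_inj (addrI s)).
apply: eq_bigr => t _; rewrite -scalerAr -lbD scalerA -i4D; congr (ii _ *: _).
by ring.
Qed.

Lemma proj_lb s p : proj p * lb s = ii (p * s) *: proj p.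
Proof.
rewrite -lb_proj [proj p]projE -scalerAl -scalerAr; congr (_ *: _).
rewrite mulr_suml mulr_sumr; apply: eq_bigr => t _.
by rewrite -scalerAl -scalerAr -!lbD addrC.
Qed.

Lemma four_neq0 : (4 : R[i]) != 0. Proof. by rewrite pnatr_eq0. Qed.

Lemma lb_sum s : lb s = \sum_p ii (p * s) *: proj p.
Proof.
under eq_bigr => p _.
  rewrite projE scalerA mulrC -scalerA scaler_sumr.
  under eq_bigr => t _ do rewrite scalerA -i4D -mulrBr [p * _]mulrC.
  over.
rewrite -scaler_sumr exchange_big /=.
under eq_bigr => t _ do rewrite -scaler_suml i4_sum subr_eq0 -scalerA.
by rewrite -scaler_sumr sum_delta scalerA mulVf ?four_neq0 ?scale1r.
Qed.

Lemma proj_sum : \sum_p proj p = 1.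
Proof.
rewrite -lb0 lb_sum; apply: eq_bigr => p _.
by rewrite mulr0 scale1r.
Qed.

Lemma projM p q : proj p * proj q = (p == q)%:R *: proj p.
Proof.
rewrite (projE q) -scalerAr mulr_sumr.
under eq_bigr => s _ do rewrite -scalerAr proj_lb scalerA -i4D -mulNr -mulrDl addrC.
rewrite -scaler_suml scalerA i4_sum subr_eq0 mulrA mulVf ?four_neq0 // mul1r.
by [].
Qed.

Lemma star_proj p : star (proj p) = proj p.
Proof.
rewrite projE starZ star_sum; congr (_ *: _).
  by rewrite conjc_inv conjc_nat.
rewrite [RHS](reindex_inj (@oppr_inj 'Z_4)); apply: eq_bigr => s _.
by rewrite starZ conj_i4 star_lb opprK mulrN opprK.
Qed.

Lemma gmap_inv_lb s : gmap (@inv gT) (lb s) = lb (- s).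
Proof. by rewrite lbE gmap_lam -star_lam -lbE star_lb. Qed.

Lemma gmap_inv_proj p : gmap (@inv gT) (proj p) = proj (- p).
Proof.
rewrite !projE linearZ linear_sum /=; congr (_ *: _).
rewrite [RHS](reindex_inj (@oppr_inj 'Z_4)); apply: eq_bigr => s _.
by rewrite linearZ /= gmap_inv_lb mulrNN.
Qed.

Lemma gmap_diag_proj p :
  gmap (@diag gT) (proj p) = \sum_q gtens (proj q) (proj (p - q)).
Proof.
rewrite [in LHS]projE linearZ linear_sum /=.
under eq_bigr => s _.
  rewrite linearZ /= lbE gmap_lam -gtens_lam -lbE lb_sum gtens_suml scaler_sumr.
  under eq_bigr => q _.
    rewrite gtens_sumr scaler_sumr.
    under eq_bigr => r _.
      rewrite gtensZl gtensZr !scalerA -!i4D -mulNr -!mulrDl.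
      over.
    over.
  over.
rewrite exchange_big /= scaler_sumr; apply: eq_bigr => q _.
rewrite exchange_big /= scaler_sumr.
under eq_bigr => r _.
  rewrite -scaler_suml i4_sum scalerA mulrA mulVf ?four_neq0 // mul1r.
  rewrite (_ : (_ == 0) = (p - q == r)); first over.
  by rewrite -[RHS]subr_eq0 -[LHS]oppr_eq0; congr (_ == _); ring.
by rewrite sum_delta.
Qed.

Lemma diagonal_lb s : diag_on proj (lb s) (fun p => ii (p * s)).
Proof. by move=> p; split; [exact: proj_lb | exact: lb_proj]. Qed.

Lemma diagonal_proj p : diag_on proj (proj p) (fun q => (p == q)%:R).
Proof.
move=> q; split; first by rewrite projM [p == q]eq_sym.
rewrite projM /=; have [->|_] := eqVneq p q; first by [].
by rewrite /= !mulr0n !scale0r.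
Qed.

(** On the ranges of [P_p] and [P_q], [b ^+ 2] is the sign [(-1) ^ p] and the
    sign [(-1) ^ q]: an element that commutes with [b ^+ 2] maps one to the
    other only if the parities agree. *)
Lemma proj_parity (x : A) p q : lb 2 * x = x * lb 2 -> p * 2 != q * 2 ->
  proj p * x * proj q = 0.
Proof.
move=> x2 pq.
have: ii (p * 2) *: (proj p * x * proj q) = ii (q * 2) *: (proj p * x * proj q).
  rewrite [LHS]scalerAl scalerAl -proj_lb [RHS]scalerAr -lb_proj.
  by rewrite -[proj p * lb 2 * x]mulrA x2 !mulrA.
move/eqP; rewrite -subr_eq0 -scalerBl => /eqP z.
have c0 : ii (p * 2) - ii (q * 2) != 0.
  by rewrite subr_eq0 (inj_eq (@i4_inj R)).
by rewrite -[LHS](scalerK c0) z scaler0.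
Qed.
End Projections.

(** * The twisted coproduct *)

HB.lock Definition twistor (R : realType) (gT : finGroupType) (b : gT) :
    galg R (gT * gT)%type :=
  \sum_p \sum_q i4 R (omega_exp p q) *: gtens (proj R b p) (proj R b q).

HB.lock Definition tcomul (R : realType) (gT : finGroupType) (b : gT)
    (x : galg R gT) : galg R (gT * gT)%type :=
  twistor R b * gmap (@diag gT) x * star (twistor R b).

(** The product of the first leg of the twist and the antipode of the second:
    the unitary that corrects the antipode of the group algebra. *)
HB.lock Definition tunit (R : realType) (gT : finGroupType) (b : gT) :
    galg R gT :=
  \sum_p i4 R (omega_exp p (- p)) *: proj R b p.

HB.lock Definition tantipode (R : realType) (gT : finGroupType) (b : gT)
    (x : galg R gT) : galg R gT :=
  tunit R b * gmap (@inv gT) x * star (tunit R b).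

Section Twist.
Variables (R : realType) (gT : finGroupType) (b : gT).
Hypothesis b4 : (b ^+ 4 = 1)%g.
Local Notation A := (galg R gT).
Local Notation ii := (i4 R).
Local Notation gmap := (@gmap R _ _).
Local Notation lb := (@lb R gT b).
Local Notation proj := (@proj R gT b).
Local Notation Om := (@twistor R gT b).
Local Notation Dl := (@tcomul R gT b).
Implicit Types (p q : 'Z_4) (x y : A).

Definition proj2 (k : 'Z_4 * 'Z_4) : galg R (gT * gT)%type :=
  gtens (proj k.1) (proj k.2).

Lemma proj2_sum : \sum_k proj2 k = 1.
Proof.
rewrite -(pair_bigA _ (fun p q => gtens (proj p) (proj q))) /=.
under eq_bigr do rewrite -gtens_sumr (proj_sum R b).
by rewrite -gtens_suml (proj_sum R b) gtens1.
Qed.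

Lemma star_proj2 k : star (proj2 k) = proj2 k.
Proof. by rewrite star_gtens !star_proj. Qed.

Lemma sum2_delta (F : 'Z_4 -> 'Z_4 -> R[i]) k l :
  \sum_p \sum_q F p q * ((p == k)%:R * (q == l)%:R) = F k l.
Proof.
under eq_bigr => p _.
  under eq_bigr => q _ do rewrite mulrCA [F p q * _]mulrC eq_sym [q == l]eq_sym.
  rewrite -mulr_sumr sum_deltaM.
  over.
exact: sum_deltaM.
Qed.

Lemma diagonal_twistor : diag_on proj2 Om (fun k => ii (omega_exp k.1 k.2)).
Proof.
rewrite twistor.unlock; apply: diagonal_ext; last first.
  apply: diagonal_sum => p; apply: diagonal_sum => q; apply: diagonalZ.
  exact: (diagonal_tens (diagonal_proj R b4 p) (diagonal_proj R b4 q)).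
by move=> [k l] /=; rewrite sum2_delta.
Qed.

Lemma diagonal_twistor_star :
  diag_on proj2 (star Om) (fun k => ii (- omega_exp k.1 k.2)).
Proof.
apply: diagonal_ext (diagonal_star star_proj2 diagonal_twistor) => k.
exact: conj_i4.
Qed.

Lemma twistorV : star Om * Om = 1.
Proof.
apply: (diagonal_is1 proj2_sum _ (diagonalM diagonal_twistor_star diagonal_twistor)).
by move=> k; rewrite -i4D addNr.
Qed.

Lemma twistorVr : Om * star Om = 1.
Proof.
apply: (diagonal_is1 proj2_sum _ (diagonalM diagonal_twistor diagonal_twistor_star)).
by move=> k; rewrite -i4D subrr.
Qed.

Lemma tcomulE x : Dl x = Om * gmap (@diag gT) x * star Om.
Proof. by rewrite tcomul.unlock. Qed.

Lemma tcomul_is_linear : linear Dl.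
Proof. by move=> c x y; rewrite !tcomulE linearP mulrDr mulrDl -scalerAr -scalerAl. Qed.
HB.instance Definition _ :=
  GRing.isLinear.Build R[i] A (galg R (gT * gT)%type) _ Dl tcomul_is_linear.

Lemma tcomulM x y : Dl (x * y) = Dl x * Dl y.
Proof.
rewrite !tcomulE gmapM; last exact: diagM.
by rewrite !mulrA -[_ * star Om * Om]mulrA twistorV mulr1.
Qed.

Lemma tcomul1 : Dl 1 = 1.
Proof. by rewrite tcomulE gmap1 ?mulr1 ?twistorVr //; apply: diagM. Qed.

Lemma tcomul_star x : Dl (star x) = star (Dl x).
Proof.
rewrite !tcomulE !starM starK star_gmap ?mulrA //; exact: diagM.
Qed.

Lemma gmap_diag_lb s : gmap (@diag gT) (lb s) = gtens (lb s) (lb s).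
Proof. by rewrite lbE gmap_lam gtens_lam. Qed.

(** [b] is still group-like, as [b (x) b] commutes with the twist. *)
Lemma tcomul_lb s : Dl (lb s) = gtens (lb s) (lb s).
Proof.
rewrite tcomulE gmap_diag_lb.
have lbs := diagonal_tens (diagonal_lb R b4 s) (diagonal_lb R b4 s).
have := diagonalM (diagonalM diagonal_twistor lbs) diagonal_twistor_star.
move=> /diagonal_ext lhs; apply: (diagonal_eq proj2_sum _ lbs); apply: lhs.
by move=> k; rewrite -!i4D /=; congr (ii _); ring.
Qed.

(** * The counit *)

Definition aug x : R[i] := \sum_g x g.

Lemma aug_is_scalar : scalar aug.
Proof.
move=> c x y; rewrite /aug mulr_sumr -big_split; apply: eq_bigr => g _ /=.
by rewrite vecDE vecZE.
Qed.
HB.instance Definition _ :=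
  GRing.isLinear.Build R[i] A R[i] _ aug aug_is_scalar.

Lemma aug_lam g : aug (lam R g) = 1.
Proof.
rewrite /aug (bigD1 g) //= vbaseE eqxx big1 ?addr0 // => h hg.
by rewrite vbaseE (negbTE hg).
Qed.

Lemma augM x y : aug (x * y) = aug x * aug y.
Proof.
rewrite (galg_sum x) mulr_suml !linear_sum mulr_suml; apply: eq_bigr => g _.
rewrite -scalerAl !linearZ -scalerAl /=; congr (_ * _).
rewrite (galg_sum y) mulr_sumr !linear_sum mulr_sumr; apply: eq_bigr => h _.
rewrite -scalerAr !linearZ /= -lamM !aug_lam mul1r.
by rewrite mulr1.
Qed.
End Twist.

Section TwistKac.
Variables (R : realType) (gT : finGroupType) (b : gT).
Hypothesis b4 : (b ^+ 4 = 1)%g.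
Hypothesis b2 : forall g, (b ^+ 2 * g = g * b ^+ 2)%g.
Local Notation A := (galg R gT).
Local Notation ii := (i4 R).
Local Notation gmap := (@gmap R _ _).
Local Notation lb := (@lb R gT b).
Local Notation proj := (@proj R gT b).
Local Notation proj2 := (@proj2 R gT b).
Local Notation Om := (@twistor R gT b).
Local Notation Dl := (@tcomul R gT b).
Implicit Types (p q : 'Z_4) (x y : A).

(** * Coassociativity *)

Lemma gmap_id (hT : finGroupType) (x : galg R hT) : gmap (fun h => h) x = x.
Proof. by rewrite [RHS]galg_sum gmapE. Qed.

Definition diagl (p : gT * gT) : gT * gT * gT := (diag p.1, p.2).
Definition diagr (p : gT * gT) : gT * (gT * gT) := (p.1, diag p.2).
Definition assoc (p : gT * (gT * gT)) : gT * gT * gT := (p.1, p.2.1, p.2.2).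

Lemma diaglM : {morph diagl : g h / (g * h)%g}. Proof. by []. Qed.
Lemma diagrM : {morph diagr : g h / (g * h)%g}. Proof. by []. Qed.
Lemma assocM : {morph assoc : g h / (g * h)%g}. Proof. by []. Qed.

Lemma gmap_diagl x y : gmap diagl (gtens x y) = gtens (gmap (@diag gT) x) y.
Proof.
by rewrite -[y in RHS]gmap_id -(gmap_gtens (@diag gT)).
Qed.

Lemma gmap_diagr x y : gmap diagr (gtens x y) = gtens x (gmap (@diag gT) y).
Proof.
by rewrite -[x in RHS]gmap_id -(gmap_gtens _ (@diag gT)).
Qed.

Lemma gmap_assoc x y z : gmap assoc (gtens x (gtens y z)) = gtens (gtens x y) z.
Proof.
rewrite (galg_sum x) !gtens_suml !linear_sum; apply: eq_bigr => g _.
rewrite !gtensZl linearZ /=; congr (_ *: _).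
rewrite (galg_sum y) !(gtens_suml, gtens_sumr) !linear_sum; apply: eq_bigr => h _.
rewrite !(gtensZl, gtensZr) linearZ /=; congr (_ *: _).
rewrite (galg_sum z) !gtens_sumr !linear_sum; apply: eq_bigr => k _.
rewrite !gtensZr linearZ /=; congr (_ *: _).
by rewrite !gtens_lam gmap_lam.
Qed.

Lemma tmap_tcomul_l (t : galg R (gT * gT)%type) :
  tmap Dl id t = gtens Om 1 * gmap diagl t * star (gtens Om 1).
Proof.
rewrite [t in RHS]galg_sum linear_sum mulr_sumr mulr_suml.
apply: eq_bigr => -[g h] _; rewrite linearZ /= -scalerAr -scalerAl; congr (_ *: _).
rewrite -gtens_lam gmap_diagl star_gtens star1 !gtensM mul1r mulr1 -tcomulE.
by rewrite gtensE.
Qed.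

Lemma tmap_tcomul_r (t : galg R (gT * gT)%type) :
  tmap id Dl t = gtens 1 Om * gmap diagr t * star (gtens 1 Om).
Proof.
rewrite [t in RHS]galg_sum linear_sum mulr_sumr mulr_suml.
apply: eq_bigr => -[g h] _; rewrite linearZ /= -scalerAr -scalerAl; congr (_ *: _).
rewrite -gtens_lam gmap_diagr star_gtens star1 !gtensM mul1r mulr1 -tcomulE.
by rewrite gtensE.
Qed.

Definition proj3 (k : 'Z_4 * 'Z_4 * 'Z_4) : galg R (gT * gT * gT)%type :=
  gtens (proj2 k.1) (proj k.2).
Definition proj3' (k : 'Z_4 * ('Z_4 * 'Z_4)) : galg R (gT * (gT * gT))%type :=
  gtens (proj k.1) (proj2 k.2).

Lemma proj3_sum : \sum_k proj3 k = 1.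
Proof.
rewrite -(pair_bigA _ (fun (p : 'Z_4 * 'Z_4) q => gtens (proj2 p) (proj q))) /=.
under eq_bigr do rewrite -gtens_sumr (proj_sum R b).
by rewrite -gtens_suml proj2_sum gtens1.
Qed.

Lemma star_proj3 k : star (proj3 k) = proj3 k.
Proof. by rewrite star_gtens star_proj2 // star_proj. Qed.

Lemma diagonal_gmap_diag p :
  diag_on proj2 (gmap (@diag gT) (proj p)) (fun k => (p == k.1 + k.2)%:R).
Proof.
rewrite gmap_diag_proj //; apply: diagonal_ext; last first.
  apply: diagonal_sum => q.
  exact: (diagonal_tens (diagonal_proj R b4 q) (diagonal_proj R b4 (p - q))).
move=> [k l] /=; under eq_bigr => q _ do rewrite eq_sym.
by rewrite sum_deltaM subr_eq addrC.
Qed.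

Lemma diagonal_diagl_twistor :
  diag_on proj3 (gmap diagl Om) (fun k => ii (omega_exp (k.1.1 + k.1.2) k.2)).
Proof.
rewrite twistor.unlock linear_sum; apply: diagonal_ext; last first.
  apply: diagonal_sum => p; rewrite linear_sum; apply: diagonal_sum => q.
  rewrite linearZ /= gmap_diagl; apply: diagonalZ.
  exact: (diagonal_tens (diagonal_gmap_diag p) (diagonal_proj R b4 q)).
by move=> [[k l] m] /=; rewrite sum2_delta.
Qed.

Lemma diagonal_diagr_twistor :
  diag_on proj3' (gmap diagr Om) (fun k => ii (omega_exp k.1 (k.2.1 + k.2.2))).
Proof.
rewrite twistor.unlock linear_sum; apply: diagonal_ext; last first.
  apply: diagonal_sum => p; rewrite linear_sum; apply: diagonal_sum => q.
  rewrite linearZ /= gmap_diagr; apply: diagonalZ.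
  exact: (diagonal_tens (diagonal_proj R b4 p) (diagonal_gmap_diag q)).
by move=> [k [l m]] /=; rewrite sum2_delta.
Qed.

(** The threefold twists of the two sides of the coassociativity identity. *)
Definition tw3l := gtens Om 1 * gmap diagl Om.
Definition tw3r := gmap assoc (gtens 1 Om * gmap diagr Om).
Definition exp3l (k : 'Z_4 * 'Z_4 * 'Z_4) : 'Z_4 :=
  omega_exp k.1.1 k.1.2 + omega_exp (k.1.1 + k.1.2) k.2.
Definition exp3r (k : 'Z_4 * 'Z_4 * 'Z_4) : 'Z_4 :=
  omega_exp k.1.2 k.2 + omega_exp k.1.1 (k.1.2 + k.2).

Lemma diagonal_tw3l : diag_on proj3 tw3l (fun k => ii (exp3l k)).
Proof.
apply: diagonal_ext; last first.
  apply: diagonalM diagonal_diagl_twistor.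
  exact: (diagonal_tens (diagonal_twistor R b4) (diagonal1 proj)).
by move=> k; rewrite /= mulr1 -i4D.
Qed.

Lemma diagonal_tw3r : diag_on proj3 tw3r (fun k => ii (exp3r k)).
Proof.
have H : diag_on proj3' (gtens 1 Om * gmap diagr Om)
    (fun k => ii (exp3r (k.1, k.2.1, k.2.2))).
  apply: diagonal_ext; last first.
    apply: diagonalM diagonal_diagr_twistor.
    exact: (diagonal_tens (diagonal1 proj) (diagonal_twistor R b4)).
  by move=> k; rewrite /= mul1r -i4D.
move=> [[k l] m]; have := diagonal_gmap assocM H (k, (l, m)).
by rewrite /= /proj3' gmap_assoc.
Qed.

(** Cut by the projections on both sides: a block joining different parities
    vanishes since [b ^+ 2] is central, and on a block of equal parities the
    cocycle defects of the two ends are the same sign and cancel. *)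
Lemma tw3_conj g : let z := gtens (gtens (lam R g : A) (lam R g : A)) (lam R g : A) in
  tw3l * z * star tw3l = tw3r * z * star tw3r.
Proof.
move=> z; apply: (sandwich_eq proj3_sum) => k l.
have cut t f : diag_on proj3 t (fun k => ii (f k)) ->
    proj3 k * (t * z * star t) * proj3 l
    = ii (f k - f l) *: (proj3 k * z * proj3 l).
  move=> tf; rewrite !mulrA (tf k).1 -!scalerAl -mulrA.
  rewrite (diagonal_star star_proj3 tf l).2 conj_i4 -scalerAr scalerA.
  by rewrite i4D mulrC.
rewrite (cut _ _ diagonal_tw3l) (cut _ _ diagonal_tw3r).
have [kl|kl] := boolP [&& k.1.1 * 2 == l.1.1 * 2, k.1.2 * 2 == l.1.2 * 2
                        & k.2 * 2 == l.2 * 2].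
  congr (ii _ *: _); rewrite /exp3l /exp3r !omega_exp_cocycle.
  suff -> : 2 * (k.1.1 * k.1.2 * k.2) = 2 * (l.1.1 * l.1.2 * l.2) by ring.
  have /and3P[/eqP e1 /eqP e2 /eqP e3] := kl.
  have -> : 2 * (k.1.1 * k.1.2 * k.2) = k.1.1 * 2 * (k.1.2 * k.2) by ring.
  rewrite e1.
  have -> : l.1.1 * 2 * (k.1.2 * k.2) = l.1.1 * (k.1.2 * 2) * k.2 by ring.
  rewrite e2.
  have -> : l.1.1 * (l.1.2 * 2) * k.2 = l.1.1 * l.1.2 * (k.2 * 2) by ring.
  by rewrite e3; ring.
rewrite (_ : proj3 k * z * proj3 l = 0) ?scaler0 //.
have central : lb 2 * lam R g = (lam R g : A) * lb 2.
  by rewrite (lb_nat R b4 2) -!lamM b2.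
rewrite /proj3 /proj2 /z !gtensM.
have par p q : p * 2 != q * 2 -> proj p * lam R g * proj q = 0.
  exact: proj_parity.
have [e1|/par->] := eqVneq (k.1.1 * 2) (l.1.1 * 2); last first.
  by rewrite -[gtens 0 _]/(gtensr _ 0) linear0 -[gtens 0 _]/(gtensr _ 0) linear0.
have [e2|/par->] := eqVneq (k.1.2 * 2) (l.1.2 * 2); last first.
  by rewrite linear0 -[gtens 0 _]/(gtensr _ 0) linear0.
have [e3|/par->] := eqVneq (k.2 * 2) (l.2 * 2); last by rewrite linear0.
by move: kl; rewrite e1 e2 e3 !eqxx.
Qed.

(** Both sides are the thrice-repeated diagonal conjugated by a threefold
    twist. *)
Lemma tcomulA x : tmap Dl id (Dl x) = gmap assoc (tmap id Dl (Dl x)).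
Proof.
have assocD := gmapM (R := R) assocM; have diaglD := gmapM (R := R) diaglM.
have diagrD := gmapM (R := R) diagrM.
transitivity (tw3l * gmap (diagl \o @diag gT) x * star tw3l).
  rewrite tmap_tcomul_l tcomulE !diaglD gmap_comp /tw3l starM !mulrA.
  by rewrite star_gmap.
transitivity (tw3r * gmap (diagl \o @diag gT) x * star tw3r); last first.
  rewrite tmap_tcomul_r tcomulE !diagrD !assocD !gmap_comp /tw3r.
  rewrite assocD starM !mulrA !star_gmap ?star_gtens //.
  by rewrite !gmap_comp.
rewrite (galg_sum x) linear_sum !mulr_sumr !mulr_suml; apply: eq_bigr => g _.
rewrite linearZ /= -!scalerAr -[in LHS]scalerAl -[in RHS]scalerAl gmap_lam.
congr (_ *: _).
by have := tw3_conj g; rewrite !gtens_lam.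
Qed.

(** * The counit and antipode axioms *)

Lemma gmap_fst x y : gmap (fun p : gT * gT => p.1) (gtens x y) = aug y *: x.
Proof.
rewrite (galg_sum y) gtens_sumr !linear_sum scaler_suml.
apply: eq_bigr => h _; rewrite gtensZr !linearZ /= aug_lam mulr1; congr (_ *: _).
rewrite [RHS]galg_sum {1}(galg_sum x) gtens_suml linear_sum.
by apply: eq_bigr => g _; rewrite gtensZl linearZ /= gtens_lam gmap_lam.
Qed.

Lemma gmap_snd x y : gmap (fun p : gT * gT => p.2) (gtens x y) = aug x *: y.
Proof.
rewrite (galg_sum x) gtens_suml !linear_sum scaler_suml.
apply: eq_bigr => g _; rewrite gtensZl !linearZ /= aug_lam mulr1; congr (_ *: _).
rewrite [RHS]galg_sum {1}(galg_sum y) gtens_sumr linear_sum.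
by apply: eq_bigr => h _; rewrite gtensZr linearZ /= gtens_lam gmap_lam.
Qed.

Lemma aug_proj p : aug (proj p) = (p == 0)%:R.
Proof.
rewrite projE linearZ linear_sum /=.
under eq_bigr => s _ do rewrite linearZ /= lbE aug_lam mulr1 -mulNr.
by rewrite i4_sum oppr_eq0 mulrA mulVf ?mul1r // four_neq0.
Qed.

Lemma tcomul_counitl x : gmap (fun p : gT * gT => p.2) (Dl x) = x.
Proof.
have sndM : {morph (fun p : gT * gT => p.2) : g h / (g * h)%g} by [].
have Om1 : gmap (fun p : gT * gT => p.2) Om = 1.
  rewrite twistor.unlock !linear_sum.
  under eq_bigr => p _.
    rewrite linear_sum; under eq_bigr => q _.
      rewrite linearZ /= gmap_snd aug_proj scalerA mulrC -scalerA eq_sym.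
      over.
    rewrite -scaler_sumr.
    over.
  rewrite sum_delta -(proj_sum R b); apply: eq_bigr => q _.
  by rewrite omega_exp0l i4_0 scale1r.
rewrite tcomulE !gmapM // -star_gmap // Om1 star1 mul1r mulr1 gmap_comp.
exact: gmap_id.
Qed.

Lemma tcomul_counitr x : gmap (fun p : gT * gT => p.1) (Dl x) = x.
Proof.
have fstM : {morph (fun p : gT * gT => p.1) : g h / (g * h)%g} by [].
have Om1 : gmap (fun p : gT * gT => p.1) Om = 1.
  rewrite twistor.unlock !linear_sum -(proj_sum R b); apply: eq_bigr => p _.
  rewrite linear_sum; under eq_bigr => q _.
    rewrite linearZ /= gmap_fst aug_proj scalerA mulrC -scalerA eq_sym.
    over.
  by rewrite sum_delta omega_exp0r i4_0 scale1r.
rewrite tcomulE !gmapM // -star_gmap // Om1 star1 mul1r mulr1 gmap_comp.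
exact: gmap_id.
Qed.
End TwistKac.

Lemma exchange4 (V : nmodType) (I J K L : finType) (F : I -> J -> K -> L -> V) :
  \sum_i \sum_j \sum_k \sum_l F i j k l = \sum_k \sum_l \sum_i \sum_j F i j k l.
Proof.
under eq_bigr => i _ do rewrite exchange_big.
rewrite exchange_big; apply: eq_bigr => k _ /=.
under eq_bigr => i _ do rewrite exchange_big.
exact: exchange_big.
Qed.

Section Antipode.
Variables (R : realType) (gT : finGroupType) (b : gT).
Hypothesis b4 : (b ^+ 4 = 1)%g.
Hypothesis b2 : forall g, (b ^+ 2 * g = g * b ^+ 2)%g.
Local Notation A := (galg R gT).
Local Notation ii := (i4 R).
Local Notation gmap := (@gmap R _ _).
Local Notation lb := (@lb R gT b).
Local Notation proj := (@proj R gT b).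
Local Notation Om := (@twistor R gT b).
Local Notation Dl := (@tcomul R gT b).
Local Notation u := (@tunit R gT b).
Local Notation S' := (@tantipode R gT b).
Implicit Types (p q : 'Z_4) (x y : A).

Lemma lb2_central g : lb 2 * lam R g = (lam R g : A) * lb 2.
Proof. by rewrite (lb_nat R b4 2) -!lamM b2. Qed.

Lemma diagonal_proj_sum (f : 'Z_4 -> R[i]) :
  diag_on proj (\sum_p f p *: proj p) f.
Proof.
apply: diagonal_ext; last first.
  by apply: diagonal_sum => p; apply: diagonalZ; apply: diagonal_proj.
by move=> p /=; under eq_bigr do rewrite mulrC eq_sym; rewrite sum_deltaM.
Qed.

Lemma diagonal_tunit : diag_on proj u (fun p => ii (omega_exp p (- p))).
Proof. by rewrite tunit.unlock; apply: diagonal_proj_sum. Qed.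

Lemma diagonal_tunit_star :
  diag_on proj (star u) (fun p => ii (- omega_exp p (- p))).
Proof.
apply: diagonal_ext (diagonal_star (star_proj R b4) diagonal_tunit) => p.
exact: conj_i4.
Qed.

Lemma tunitV : star u * u = 1.
Proof.
apply: (diagonal_is1 (proj_sum R b) _ (diagonalM diagonal_tunit_star diagonal_tunit)).
by move=> p; rewrite -i4D addNr.
Qed.

Lemma tunitVr : u * star u = 1.
Proof.
apply: (diagonal_is1 (proj_sum R b) _ (diagonalM diagonal_tunit diagonal_tunit_star)).
by move=> p; rewrite -i4D subrr.
Qed.

Lemma gmap_invM x y :
  gmap (@inv gT) (x * y) = gmap (@inv gT) y * gmap (@inv gT) x.
Proof.
rewrite (galg_sum x) mulr_suml !linear_sum mulr_sumr; apply: eq_bigr => g _.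
rewrite -scalerAl !linearZ -scalerAr /=; congr (_ *: _).
rewrite (galg_sum y) mulr_sumr !linear_sum mulr_suml; apply: eq_bigr => h _.
rewrite -scalerAr !linearZ -scalerAl /=; congr (_ *: _).
by rewrite -lamM !gmap_lam invMg lamM.
Qed.

Lemma tantipodeE x : S' x = u * gmap (@inv gT) x * star u.
Proof. by rewrite tantipode.unlock. Qed.

Lemma tantipode_is_linear : linear S'.
Proof.
by move=> c x y; rewrite !tantipodeE linearP mulrDr mulrDl -scalerAr -scalerAl.
Qed.
HB.instance Definition _ :=
  GRing.isLinear.Build R[i] A A _ S' tantipode_is_linear.

Lemma tantipode_projl p x : S' (proj p * x) = S' x * proj (- p).
Proof.
rewrite !tantipodeE gmap_invM gmap_inv_proj // -!mulrA; congr (_ * (_ * _)).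
by rewrite (diagonal_tunit_star _).1 (diagonal_tunit_star _).2.
Qed.

Lemma tantipode_projr p x : S' (x * proj p) = proj (- p) * S' x.
Proof.
rewrite !tantipodeE gmap_invM gmap_inv_proj // !mulrA; congr (_ * _ * _).
by rewrite (diagonal_tunit _).1 (diagonal_tunit _).2.
Qed.

Lemma lext_gtens (f h : {linear A -> A}) x y :
  lext (fun p : gT * gT => f (lam R p.1) * h (lam R p.2)) (gtens x y) = f x * h y.
Proof.
rewrite gtensE lext_tens /= [x in RHS]galg_sum linear_sum mulr_suml.
apply: eq_bigr => g _; rewrite linearZ -scalerAl.
rewrite [y in RHS]galg_sum linear_sum mulr_sumr scaler_sumr.
by apply: eq_bigr => k _; rewrite linearZ -scalerAr scalerA.
Qed.

Lemma twistorE :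
  Om = \sum_p \sum_q ii (omega_exp p q) *: gtens (proj p) (proj q).
Proof. by rewrite twistor.unlock. Qed.

Lemma tcomul_lam g :
  Dl (lam R g) = \sum_p \sum_q \sum_r \sum_s
    (ii (omega_exp p q) * ii (- omega_exp r s)) *:
      gtens (proj p * (lam R g : A) * proj r) (proj q * (lam R g : A) * proj s).
Proof.
rewrite tcomulE gmap_lam -gtens_lam.
rewrite [X in X * _ * _]twistorE !mulr_suml; apply: eq_bigr => p _.
rewrite !mulr_suml; apply: eq_bigr => q _.
rewrite twistorE star_sum mulr_sumr; apply: eq_bigr => r _.
rewrite star_sum mulr_sumr; apply: eq_bigr => s _.
rewrite starZ conj_i4 star_gtens !star_proj // -!scalerAl -scalerAr scalerA.
by rewrite !gtensM mulrC.
Qed.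

(** Only the terms with opposite indices survive, by orthogonality. *)
Lemma sum_proj_sandwich (F : 'Z_4 -> 'Z_4 -> R[i]) x f : diag_on proj x f ->
  \sum_p \sum_q F p q *: (proj (- p) * x * proj q)
  = \sum_p (F (- p) p * f p) *: proj p.
Proof.
move=> xf; rewrite (reindex_inj (@oppr_inj 'Z_4)) /=; apply: eq_bigr => p _.
under eq_bigr => q _.
  rewrite opprK (xf p).1 -scalerAl projM // !scalerA mulrC -scalerA.
  over.
by rewrite sum_delta.
Qed.

Lemma sum_proj_sandwichr (F : 'Z_4 -> 'Z_4 -> R[i]) x f : diag_on proj x f ->
  \sum_p \sum_q F p q *: (proj p * x * proj (- q))
  = \sum_p (F p (- p) * f p) *: proj p.
Proof.
move=> xf; apply: eq_bigr => p _; rewrite (reindex_inj (@oppr_inj 'Z_4)) /=.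
under eq_bigr => q _.
  rewrite opprK (xf p).1 -scalerAl projM // !scalerA mulrC -scalerA.
  over.
by rewrite sum_delta.
Qed.

(** The inner legs of the twist and of its adjoint collect into
    [v = sum_p i^T(-p, p) P_p], for which [u^* v = b ^+ 2]; this central element
    passes through [g], and the outer legs cancel it. *)
Lemma tantipode_left g :
  lext (fun p : gT * gT => S' (lam R p.1) * (lam R p.2 : A)) (Dl (lam R g)) = 1.
Proof.
pose v := \sum_p \sum_q ii (omega_exp p q) *: (proj (- p) * 1 * proj q).
have vE : diag_on proj v (fun p => ii (omega_exp (- p) p)).
  rewrite /v (sum_proj_sandwich _ (diagonal1 proj)).
  by apply: diagonal_ext (diagonal_proj_sum _) => p; rewrite mulr1.
have uv : star u * v = lb 2.
  apply: (diagonal_eq (proj_sum R b) _ (diagonal_lb R b4 2)).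
  apply: diagonal_ext (diagonalM diagonal_tunit_star vE) => p.
  rewrite -i4D omega_exp_antipode; congr (ii _).
  have -> : - (omega_exp (- p) p + 2 * p) + omega_exp (- p) p = p * 2 - 4 * p by ring.
  by rewrite (_ : 4 = 0) ?mul0r ?subr0 //; apply: val_inj.
have S'v : S' (lam R g) * v * lam R g = u * lb 2.
  rewrite tantipodeE gmap_lam -!mulrA; congr (_ * _).
  by rewrite [star u * _]mulrA uv lb2_central mulrA -lamM mulVg mul1r.
rewrite tcomul_lam.
transitivity
    (\sum_r \sum_s ii (- omega_exp r s) *: (proj (- r) * (u * lb 2) * proj s)).
  rewrite -S'v.
  transitivity (\sum_r \sum_s \sum_p \sum_q ii (- omega_exp r s) *:
      (proj (- r) * (S' (lam R g) * (ii (omega_exp p q) *: (proj (- p) * 1 * proj q))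
                     * lam R g) * proj s)); last first.
    apply: eq_bigr => r _; apply: eq_bigr => s _; rewrite /v.
    rewrite !(mulr_sumr, mulr_suml) scaler_sumr; apply: eq_bigr => p _.
    by rewrite !(mulr_sumr, mulr_suml) scaler_sumr.
  rewrite -exchange4 linear_sum; apply: eq_bigr => p _.
  rewrite linear_sum; apply: eq_bigr => q _.
  rewrite linear_sum; apply: eq_bigr => r _.
  rewrite linear_sum; apply: eq_bigr => s _.
  rewrite linearZ /= (lext_gtens S' idfun) /= tantipode_projr tantipode_projl.
  rewrite mulr1 -!scalerAr -!scalerAl -!scalerAr -!scalerAl scalerA !mulrA.
  by rewrite [X in X *: _]mulrC.
rewrite (sum_proj_sandwich _ (diagonalM diagonal_tunit (diagonal_lb R b4 2))).
rewrite -(proj_sum R b); apply: eq_bigr => p _; rewrite -!i4D omega_exp_antipode.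
have -> : - omega_exp (- p) p + (omega_exp (- p) p + 2 * p + p * 2) = 4 * p by ring.
by rewrite (_ : 4 = 0) ?mul0r ?i4_0 ?scale1r //; apply: val_inj.
Qed.

(** Here the inner legs collect into [u^*] itself, which cancels with the first
    factor of [S' g], and the outer legs then give [u u^*]. *)
Lemma tantipode_right g :
  lext (fun p : gT * gT => (lam R p.1 : A) * S' (lam R p.2)) (Dl (lam R g)) = 1.
Proof.
pose w := \sum_r \sum_s ii (- omega_exp r s) *: (proj r * 1 * proj (- s)).
have wE : w = star u.
  apply: (diagonal_eq (proj_sum R b) _ diagonal_tunit_star).
  rewrite /w (sum_proj_sandwichr _ (diagonal1 proj)).
  by apply: diagonal_ext (diagonal_proj_sum _) => p; rewrite mulr1.
have wS' : (lam R g : A) * w * S' (lam R g) = star u.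
  rewrite wE tantipodeE gmap_lam -!mulrA [star u * _]mulrA tunitV mul1r.
  by rewrite mulrA -lamM mulgV mul1r.
rewrite tcomul_lam.
transitivity
    (\sum_p \sum_q ii (omega_exp p q) *: (proj p * star u * proj (- q))).
  rewrite -wS' linear_sum; apply: eq_bigr => p _.
  rewrite linear_sum; apply: eq_bigr => q _.
  rewrite /w !(mulr_sumr, mulr_suml) scaler_sumr linear_sum.
  apply: eq_bigr => r _.
  rewrite !(mulr_sumr, mulr_suml) scaler_sumr linear_sum.
  apply: eq_bigr => s _.
  rewrite linearZ /= (lext_gtens idfun S') /= tantipode_projr tantipode_projl.
  by rewrite mulr1 -!scalerAr -!scalerAl -!scalerAr -!scalerAl scalerA !mulrA.
rewrite (sum_proj_sandwichr _ diagonal_tunit_star).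
rewrite -(proj_sum R b); apply: eq_bigr => p _.
by rewrite -!i4D subrr i4_0 scale1r.
Qed.

Lemma tantipode_axioml x :
  lext (fun p : gT * gT => S' (lam R p.1) * (lam R p.2 : A)) (Dl x) = aug x *: 1.
Proof.
rewrite (galg_sum x) !linear_sum scaler_suml; apply: eq_bigr => g _.
by rewrite !linearZ /= tantipode_left aug_lam mulr1.
Qed.

Lemma tantipode_axiomr x :
  lext (fun p : gT * gT => (lam R p.1 : A) * S' (lam R p.2)) (Dl x) = aug x *: 1.
Proof.
rewrite (galg_sum x) !linear_sum scaler_suml; apply: eq_bigr => g _.
by rewrite !linearZ /= tantipode_right aug_lam mulr1.
Qed.
End Antipode.

(** * [KQ n] is a Kac algebra *)

Section QuatFacts.
Variable n : nat.
Hypothesis n_gt0 : (0 < n)%N.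
Local Notation b := (qb n).

Lemma quat_mulE (x y : quat n) : (x * y)%g = quat_mul x y.
Proof. by []. Qed.

Lemma qb_sqr : (b ^+ 2)%g = (n%:R, false) :> quat n.
Proof. by have [_ -> _ _ _] := quat_presentation n_gt0; rewrite qa_exp. Qed.

Lemma qb_exp4 : (b ^+ 4 = 1)%g.
Proof.
have [a2n b2 _ _ _] := quat_presentation n_gt0.
by rewrite (expgM _ 2 2) b2 -expgM mulnC a2n.
Qed.

Lemma natN_Z2n : - n%:R = n%:R :> 'Z_(2 * n).
Proof. by apply/eqP; rewrite eq_sym -subr_eq0 opprK quat_2n. Qed.

Lemma qb_sqr_central (g : quat n) : (b ^+ 2 * g = g * b ^+ 2)%g.
Proof.
case: g => k s; rewrite qb_sqr !quat_mulE /quat_mul /= expr0 mul1r andbF.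
rewrite mulr0n !addr0 addbF; congr (_, _); rewrite addrC; congr (_ + _).
by case: s => /=; rewrite ?expr1 ?mulN1r ?natN_Z2n ?expr0 ?mul1r.
Qed.
End QuatFacts.

Section KQisKac.
Variables (R : realType) (n : nat).
Hypothesis n_gt0 : (0 < n)%N.
Local Notation G := (quat n).
Local Notation b := (qb n).
Local Notation b4 := (qb_exp4 n_gt0).
Local Notation b2 := (qb_sqr_central n_gt0).
Local Notation A := (galg R G).
Local Notation gmap := (@gmap R _ _).

Lemma i4X p m : i4 R p ^+ m = i4 R (p * m%:R).
Proof.
elim: m => [|m IH]; first by rewrite mulr0.
by rewrite exprSr IH -i4D -natr1 mulrDr mulr1.
Qed.

Lemma Pz_proj p : Pz n (i4 R p) = proj R b p.
Proof.
rewrite projE; congr (_ *: _); apply: eq_bigr => s _.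
by rewrite lbE i4N i4X natr_Zp.
Qed.

Lemma sum_fourth_roots (V : zmodType) (F : R[i] -> V) :
  \sum_(z <- fourth_roots R) F z = \sum_p F (i4 R p).
Proof.
rewrite /fourth_roots !big_cons big_nil addr0 sumZ4 i4_0 i4_1 i4_2 i4_3.
by rewrite !addrA [F 1 + _ + _]addrAC.
Qed.

Lemma Omega_twistor : Omega R n = twistor R b.
Proof.
rewrite twistor.unlock /Omega sum_fourth_roots; apply: eq_bigr => p _.
rewrite sum_fourth_roots; apply: eq_bigr => q _.
by rewrite omega_i4 !Pz_proj gtensE.
Qed.

Lemma KQ_comulE (x : A) : KQ_comul x = tcomul b x.
Proof.
by rewrite /KQ_comul !tmul_galg gcomul_galg tstar_galg Omega_twistor -tcomulE.
Qed.

Lemma gantipode_gmap (gT : finGroupType) (x : galg R gT) :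
  gantipode x = gmap (@inv gT) x.
Proof. by rewrite gmapE. Qed.

Lemma KQ_uE : KQ_u R n = tunit R b.
Proof.
transitivity (lext (fun p : G * G => (lam R p.1 : A) * gmap (@inv G) (lam R p.2))
  (Omega R n)).
  by apply: eq_bigr => p _; rewrite gantipode_gmap mulgalgE.
rewrite Omega_twistor twistorE linear_sum tunit.unlock; apply: eq_bigr => p _.
rewrite linear_sum (reindex_inj (@oppr_inj 'Z_4)) /=.
under eq_bigr => q _.
  rewrite linearZ /= (lext_gtens idfun (gmap (@inv G))) /= gmap_inv_proj ?b4 //.
  rewrite opprK (projM R b4) scalerA mulrC -scalerA.
  over.
by rewrite sum_delta.
Qed.

Lemma KQ_antipodeE (x : A) : KQ_antipode x = tantipode b x.
Proof.
by rewrite tantipodeE /KQ_antipode KQ_uE gantipode_gmap !mulgalgE star_gstar.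
Qed.

Lemma eq_tmap (I J I' J' : finType) (f f' : vec R I -> vec R I')
    (g g' : vec R J -> vec R J') t :
  f =1 f' -> g =1 g' -> tmap f g t = tmap f' g' t.
Proof. by move=> ff gg; apply: eq_bigr => p _; rewrite ff gg. Qed.

Lemma KQ_is_kac : is_kac (KQ R n).
Proof.
have mulE (x y : A) : @kmul R (KQ R n) x y = x * y by rewrite mulgalgE.
have starE' (x : A) : @kstar R (KQ R n) x = star x by rewrite star_gstar.
have comulE (x : A) : @kcomul R (KQ R n) x = tcomul b x by exact: KQ_comulE.
have antE (x : A) : @kantipode R (KQ R n) x = tantipode b x by exact: KQ_antipodeE.
split.
- split.
  + split.
    * by move=> c x y z; rewrite !mulE mulrDl -scalerAl.
    * by move=> c x y z; rewrite !mulE mulrDr -scalerAr.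
    * by move=> x y z; rewrite !mulE mulrA.
    * by move=> x; rewrite mulE; apply: (@mul1r A).
    * by move=> x; rewrite mulE; apply: (@mulr1 A).
  + by move=> c x y; rewrite !starE' star_semilinear.
  + by move=> x; rewrite !starE' starK.
  + by move=> x y; rewrite !starE' !mulE -starM.
  + exists (@opn R G); split.
    * exact: opn_eq0.
    * exact: opnD.
    * by move=> c x; rewrite opnZ rmorphM /= -normc_real.
    * by move=> x y; rewrite mulE; apply: opnM.
    * by move=> x; rewrite mulE starE'; apply: opn_cstar.
- split.
  + split.
    * by move=> c x y; rewrite !comulE linearP.
    * by move=> x y; rewrite !comulE mulE tcomulM ?b4 // -tmul_galg.
    * by rewrite comulE (tcomul1 R b4) -gtens1 gtensE.
  + split.
    * by move=> c x y; apply: (aug_is_scalar c (x : A) y).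
    * by move=> x y; rewrite mulE; apply: augM.
    * exact: aug_lam.
  + move=> x i j k.
    rewrite (eq_tmap _ comulE (frefl id)) (eq_tmap _ (frefl id) comulE) comulE.
    rewrite (tcomulA b4 b2) -[(i, j, k)]/(assoc (i, (j, k))) gmap_inj_coef //.
    by move=> [? [? ?]] [? [? ?]] [-> -> ->].
  + move=> x; split.
      rewrite -[RHS](tcomul_counitl b) gmapE comulE; apply: eq_bigr => p _.
      by rewrite [kcounit _](aug_lam R p.1) mulr1.
    rewrite -[RHS](tcomul_counitr b) gmapE comulE; apply: eq_bigr => p _.
    by rewrite [kcounit _](aug_lam R p.2) mulr1.
- split.
  + by move=> c x y; rewrite !antE linearP.
  + move=> x; split.
      rewrite -[RHS](tantipode_axioml b4 b2) comulE; apply: eq_bigr => p _.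
      by rewrite antE mulE.
    rewrite -[RHS](tantipode_axiomr b4) comulE; apply: eq_bigr => p _.
    by rewrite antE mulE.
- by move=> x; rewrite !comulE !starE' (tcomul_star b) -tstar_galg.
Qed.
End KQisKac.

(** * The pairing with the dual space *)

Section Pairing.
Variables (R : realType) (I : finType).
Implicit Types f x : vec R I.

Lemma pairing_is_scalar f : scalar (pairing f).
Proof.
move=> c x y; rewrite /pairing mulr_sumr -big_split; apply: eq_bigr => i _ /=.
by rewrite vecDE vecZE mulrDr mulrCA.
Qed.
HB.instance Definition _ f :=
  GRing.isLinear.Build R[i] (vec R I) R[i] _ (pairing f) (pairing_is_scalar f).

Lemma pairing_base f i : pairing f (vbase R i) = f i.
Proof.
rewrite /pairing (bigD1 i) //= vbaseE eqxx mulr1 big1 ?addr0 // => j ji.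
by rewrite vbaseE (negbTE ji) mulr0.
Qed.
End Pairing.

Lemma pairing_tens (R : realType) (I J : finType) (f x : vec R I) (g y : vec R J) :
  pairing (tens f g) (tens x y) = pairing f x * pairing g y.
Proof.
transitivity (\sum_i \sum_j f i * g j * (x i * y j)).
  by rewrite pair_bigA /pairing; apply: eq_bigr => p _; rewrite !tensE.
rewrite /pairing mulr_suml; apply: eq_bigr => i _; rewrite mulr_sumr.
by apply: eq_bigr => j _; rewrite mulrACA.
Qed.

Lemma pairing_char (R : realType) (gT : finGroupType) (chi : vec R gT) :
  (forall g h, chi (g * h)%g = chi g * chi h) ->
  forall x y : galg R gT, pairing chi (x * y) = pairing chi x * pairing chi y.
Proof.
move=> chiM x y.
rewrite (galg_sum x) mulr_suml !linear_sum mulr_suml; apply: eq_bigr => g _.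
rewrite -scalerAl !linearZ -scalerAl /=; congr (_ * _).
rewrite (galg_sum y) mulr_sumr !linear_sum mulr_sumr; apply: eq_bigr => h _.
rewrite -scalerAr !linearZ /= -lamM !pairing_base chiM.
by rewrite mulrCA.
Qed.

(** * Self-duality forces [n] to be odd *)

Section EvenCase.
Variables (R : realType) (n : nat) (o : bool).
Hypothesis n_gt0 : (0 < n)%N.
Local Notation G := (quat n).
Local Notation a := (qa n).
Local Notation b := (qb n).
Local Notation K := (KQ R n).

Lemma qb_sqr_neq1 : (b ^+ 2 != 1)%g.
Proof.
have n2_gt1 : (1 < 2 * n)%N by rewrite (leq_mul (leqnn 2) n_gt0).
rewrite qb_sqr // xpair_eqE andbT -val_eqE /= val_Zp_nat // modn_small ?gtn_eqF //.
by rewrite mul2n -addnn -[X in (X < _)%N]add0n ltn_add2r.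
Qed.

Lemma quat_generated (g : G) : g = (a ^+ g.1 * b ^+ g.2)%g.
Proof.
case: g => k [] /=; rewrite ?expg0 ?expg1 ?mulg1 qa_exp natr_Zp //.
by rewrite quat_mulE /quat_mul /= expr0 mulr0 !addr0.
Qed.

(** The relation [b a = a^-1 b] forces [chi a] to have square 1, and then
    [chi b ^ 2 = chi a ^ n = 1] when [n] is even. *)
Lemma char_sqr (chi : G -> R[i]) : ~~ odd n ->
  (forall g h, chi (g * h)%g = chi g * chi h) -> chi 1%g = 1 ->
  forall g, chi g * chi g = 1.
Proof.
move=> even_n chiM chi1.
have chiX g m : chi (g ^+ m)%g = chi g ^+ m.
  by elim: m => [|m IH]; rewrite ?expg0 ?chi1 // expgS exprS chiM IH.
have [_ b2 ba _ _] := quat_presentation n_gt0.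
have chi_a : chi a * chi a = 1.
  have chib : chi b != 0.
    apply: contra_eq_neq chi1 => b0.
    by rewrite -(mulgV b) chiM b0 mul0r eq_sym oner_eq0.
  rewrite -chi1 -(mulVg a) [RHS]chiM; congr (_ * _); apply: (mulfI chib).
  by rewrite -chiM ba chiM mulrC.
have chi_b : chi b * chi b = 1.
  have n2 : n = (2 * n./2)%N.
    by rewrite mul2n -[LHS]odd_double_half (negbTE even_n).
  by rewrite -expr2 -chiX b2 chiX [X in _ ^+ X]n2 exprM expr2 chi_a expr1n.
move=> g; rewrite (quat_generated g) chiM !chiX mulrACA -!exprMn chi_a chi_b.
by rewrite !expr1n mulr1.
Qed.

(** The image of [b] under an isomorphism is group-like, hence a character of
    the group, and its square is trivial; but [b ^+ 2] is not. *)
Lemma self_dual_odd : self_dual o K -> odd n.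
Proof.
move=> [f [[f_lin f_bij] fM f1 _ f_comul]]; apply: contraT => even_n.
have b4 := qb_exp4 n_gt0.
have f_inj := bij_inj f_bij.
pose F : {linear vec R G -> vec R G} :=
  HB.pack (f : vec R G -> vec R G) (GRing.isLinear.Build _ _ _ _ f f_lin).
pose chi : vec R G := f (lam R b).
have chiM g h : chi (g * h)%g = chi g * chi h.
  have comul_b : @kcomul R K (lam R b) = tens (lam R b) (lam R b).
    rewrite [LHS]KQ_comulE //.
    by have := tcomul_lb R b4 1%:R; rewrite (lb_nat R b4) expg1 gtensE.
  have := f_comul (lam R b); rewrite comul_b (tmap_tens F F) => /ffunP E.
  case: o f_comul E => _ E.
    have := E (h, g); rewrite ffunE tensE /= gmul_lam pairing_base => ->.
    by rewrite mulrC.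
  by have := E (g, h); rewrite ffunE tensE /= gmul_lam pairing_base.
have chi1 : chi 1%g = 1.
  have /eqP : chi 1%g * (chi 1%g - 1) = 0 by rewrite mulrBr -chiM mulg1 mulr1 subrr.
  rewrite mulf_eq0 subr_eq0 => /orP[/eqP chi0|/eqP//].
  have f0 : f 0 = 0 := linear0 F.
  have /f_inj b0 : f (lam R b) = f 0.
    rewrite f0; apply/ffunP => g; rewrite [RHS]ffunE -[g in LHS]mul1g.
    by rewrite -/chi chiM chi0 mul0r.
  have := vbaseE R b b; rewrite -/(lam R b) b0 ffunE eqxx => /eqP.
  by rewrite eq_sym oner_eq0.
have chi2 := char_sqr even_n chiM chi1.
have /f_inj/vbase_inj b2 : f (lam R (b ^+ 2)%g) = f (lam R 1%g).
  rewrite [RHS]f1 -gmul_lam [LHS]fM -/chi; apply/ffunP => g; rewrite !ffunE.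
  rewrite [kcounit _]aug_lam [kcomul _]KQ_comulE tcomulE gmap_lam.
  have tchiM (p q : G * G) : tens chi chi (p * q)%g = tens chi chi p * tens chi chi q.
    by rewrite !tensE /= !chiM mulrACA.
  (* the form chi (x) chi is multiplicative: the twist and its adjoint cancel *)
  rewrite !(pairing_char tchiM) mulrAC -(pairing_char tchiM) (twistorVr R b4).
  by rewrite !pairing_base !tensE /= chi1 chi2 !mulr1.
by have := qb_sqr_neq1; rewrite b2 eqxx.
Qed.
End EvenCase.

(** * The exponents of the self-duality pairing *)

Definition Z4s : seq 'Z_4 := [:: 0; 1; 2; 3].

Lemma all_Z4 (P : pred 'Z_4) : all P Z4s -> forall p, P p.
Proof. by rewrite /= andbT => /and4P[P0 P1 P2 P3]; elim/Z4_ind. Qed.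

Lemma all_Z4_2 (P : 'Z_4 -> pred 'Z_4) :
  all (fun p => all (P p) Z4s) Z4s -> forall p q, P p q.
Proof. by move=> allP p; apply/all_Z4; apply: (all_Z4 allP). Qed.

Lemma all_Z4_3 (P : 'Z_4 -> 'Z_4 -> pred 'Z_4) :
  all (fun p => all (fun q => all (P p q) Z4s) Z4s) Z4s ->
  forall p q r, P p q r.
Proof. by move=> allP p; apply/all_Z4_2; apply: (all_Z4 allP). Qed.

Definition odd4 (p : 'Z_4) : bool := odd p.

(** The exponent of the scalar by which the twist acts on
    [P_p C_k (x) P_q S_k]. *)
Definition rho_exp (p q : 'Z_4) : 'Z_4 := omega_exp p q - omega_exp p (q + 2).

(** The exponent of the coefficient that pairs [c^j b^s] with [P_q S_k].  The
    flag [e] tells whether products of group elements are taken in the reverse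
    order: [e = false] is the isomorphism itself and [e = o] its transpose.
    The choice made on odd differences [q - s] is what the convention [o] for
    the coproduct of the dual requires. *)
Definition wexp (o e : bool) (s q : 'Z_4) : 'Z_4 :=
  (if e then 0 else 2 * s) + rho_exp s (q - s)
  + (if odd4 (q - s) then (if o then 0 else 2) else 1).

(** Moving [c^j] past [b^s] replaces [j] by [(-1)^s j]: these are the exponents
    of the signs acquired by the two factors of a product. *)
Definition sgnl (e : bool) (r : 'Z_4) : 'Z_4 := if e then 2 * r else 0.
Definition sgnr (e : bool) (s : 'Z_4) : 'Z_4 := if e then 0 else 2 * s.

(** Equality of sums of fourth roots of unity as a condition on exponents: only
    the excess of 0 over 2 and that of 1 over 3 matter. *)
Definition same_i4_sum (l l' : seq 'Z_4) : bool :=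
  (addn (count_mem 0 l) (count_mem 2 l') == addn (count_mem 2 l) (count_mem 0 l'))
  && (addn (count_mem 1 l) (count_mem 3 l')
      == addn (count_mem 3 l) (count_mem 1 l')).

Definition same_sum (E E' : 'Z_4 -> 'Z_4) : bool :=
  same_i4_sum (map E Z4s) (map E' Z4s).

(** The three addition rules of the exponents: for the terms sine times cosine,
    cosine times sine and sine times sine of a product. *)
Lemma wexp_sc o e s r q : e ==> o ->
  sgnl e r + wexp o e (s + r) q
  = omega_exp (q - r) r - omega_exp (q - r + 2) r + wexp o e s (q - r).
Proof.
move=> eo; apply/eqP; move: s r q; apply: all_Z4_3.
case: o e eo => [] [] eo; [ | | by case: (notF eo) | ].
all: by vm_compute.
Qed.

Lemma wexp_cs o e s r q : e ==> o ->
  sgnr e s + wexp o e (s + r) q = rho_exp s (q - s) + wexp o e r (q - s).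
Proof.
move=> eo; apply/eqP; move: s r q; apply: all_Z4_3.
case: o e eo => [] [] eo; [ | | by case: (notF eo) | ].
all: by vm_compute.
Qed.

(** In the sine times sine rule a convolution over [p] has to be [0] or four
    times a single root: it is compared with a sum over all the roots or over
    a constant exponent. *)
Definition ss_exp o e s r q (p : 'Z_4) : 'Z_4 :=
  omega_exp p (q - p) - omega_exp (p + 2) (q - p + 2)
  + (wexp o e s p + wexp o e r (q - p)).
Definition ss_val e s r q (p : 'Z_4) : 'Z_4 :=
  if q == s + r then 2 + sgnl e r + sgnr e s else p.

Lemma ss_exp_cnt o e s r q : e ==> o ->
  same_sum (ss_exp o e s r q) (ss_val e s r q).
Proof.
move=> eo; move: s r q; apply: all_Z4_3.
case: o e eo => [] [] eo; [ | | by case: (notF eo) | ].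
all: by vm_compute.
Qed.

(** The transposed pairing has the same shape, after Fourier transform. *)
Lemma wexp_transpose_cnt o s t :
  same_sum (fun q => q * t + wexp o false s (q + 2))
           (fun q => q * s + wexp o o t (q + 2)).
Proof.
by move: s t; apply: all_Z4_2; case: o; vm_compute.
Qed.

Lemma wexp_star o s q :
  2 + 2 * s + wexp o false (- s) q
  = omega_exp (2 - q) (- (2 - q)) - omega_exp (- q) q - wexp o false s (- q).
Proof.
by apply/eqP; move: s q; apply: all_Z4_2; case: o; vm_compute.
Qed.

Section FourthRootSums.
Variable R : realType.
Local Notation ii := (i4 R).

Lemma sum_i4_count (l : seq 'Z_4) :
  \sum_(p <- l) ii p = ((count_mem 0 l)%:R - (count_mem 2 l)%:R)
                    + 'i%C * ((count_mem 1 l)%:R - (count_mem 3 l)%:R).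
Proof.
have i4E p : ii p = (p == 0)%:R - (p == 2)%:R + 'i%C * ((p == 1)%:R - (p == 3)%:R).
  elim/Z4_ind: p; rewrite -!val_eqE /=.
  - by rewrite i4_0; ring.
  - by rewrite i4_1; ring.
  - by rewrite i4_2; ring.
  - by rewrite i4_3; ring.
elim: l => [|p l IH]; first by rewrite big_nil !subrr mulr0 addr0.
by rewrite big_cons IH i4E /= !natrD; ring.
Qed.

Lemma sum_i4_eq (E E' : 'Z_4 -> 'Z_4) :
  same_sum E E' -> \sum_q ii (E q) = \sum_q ii (E' q).
Proof.
have sumE F : \sum_q ii (F q) = \sum_(p <- map F Z4s) ii p.
  by rewrite sumZ4 !big_cons big_nil addr0 !addrA.
case/andP => /eqP e02 /eqP e13; rewrite !sumE !sum_i4_count.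
have move_sub (m m' k k' : nat) : (m + k' = k + m')%N -> m%:R - k%:R = m'%:R - k'%:R :> R[i].
  move=> e; apply/eqP; rewrite subr_eq addrAC -natrD [(m' + _)%N]addnC -e natrD.
  by rewrite addrK.
by rewrite (move_sub _ _ _ _ e02) (move_sub _ _ _ _ e13).
Qed.
End FourthRootSums.

(** * Coordinates adapted to odd [n] *)

Section Coordinates.
Variable n : nat.
Hypothesis odd_n : odd n.
Local Notation G := (quat n).
Local Notation Zn := 'Z_(2 * n).
Implicit Types (j k m : Zn) (s t : 'Z_4).

Lemma n_gt0 : (0 < n)%N. Proof. exact: odd_gt0. Qed.
Lemma n2_gt1 : (1 < 2 * n)%N. Proof. by rewrite (leq_mul (leqnn 2) n_gt0). Qed.

Lemma odd_Zn_nat (m : nat) : odd (m%:R : Zn) = odd m.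
Proof. by rewrite val_Zp_nat ?n2_gt1 // odd_mod // oddM. Qed.

Lemma odd_ZnD j k : odd (j + k : Zn)%R = odd j (+) odd k.
Proof. by rewrite -[j in LHS]natr_Zp -[k in LHS]natr_Zp -natrD odd_Zn_nat oddD. Qed.

Lemma odd_ZnMn j (m : nat) : odd (j *+ m : Zn)%R = odd j && odd m.
Proof. by rewrite -[j in LHS]natr_Zp -mulrnA odd_Zn_nat oddM. Qed.

Lemma n_mulrn (m : nat) : n%:R *+ m = n%:R *+ odd m :> Zn.
Proof.
rewrite -[in LHS](odd_double_half m) mulrnDr -addnn mulrnDr -mulrnDl quat_2n.
by rewrite mul0rn addr0.
Qed.

Lemma n_addb (x y : bool) : n%:R *+ (x (+) y) = n%:R *+ x + n%:R *+ y :> Zn.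
Proof. by case: x y => [] []; rewrite ?mulr0n ?addr0 ?add0r //= mulr1n quat_2n. Qed.

(** [c ^+ j * b ^+ s] for [c = a ^+ n.+1], of odd order [n]: the half of [s]
    counts the factors [b ^+ 2 = a ^+ n].  The index [j] is left in Z/2n, where
    it is only determined modulo [n]. *)
Definition gel (j : Zn) (s : 'Z_4) : G := (j *+ n.+1 + n%:R *+ s./2, odd s).

(** The exponent of [b]: [c] is an even power of [a] and [b ^+ 2] an odd one, so
    the parity of the rotation part counts the factors [b ^+ 2]. *)
Definition gel_s (g : G) : 'Z_4 := 2 *+ odd g.1 + 1 *+ g.2.

Lemma odd_half4D s t : odd (s + t : 'Z_4)%R./2
  = odd s./2 (+) odd t./2 (+) (odd s && odd t) /\ odd (s + t : 'Z_4)%R = odd s (+) odd t.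
Proof. by split; apply/eqP; move: s t; apply: all_Z4_2; vm_compute. Qed.

Lemma gelM j k s t :
  (gel j s * gel k t)%g = gel (if odd s then j - k else j + k) (s + t).
Proof.
have [half par] := odd_half4D s t.
rewrite quat_mulE /quat_mul /gel /= par; congr (_, _).
rewrite ![n%:R *+ _./2]n_mulrn half !n_addb.
have nN := natN_Z2n n.
have nbN (x : bool) : - (n%:R *+ x) = n%:R *+ x :> Zn by rewrite -mulNrn nN.
case: (odd s) => /=; rewrite ?expr1 ?expr0 ?mulN1r ?mul1r.
  by rewrite opprD nbN mulrnBl addrACA !addrA.
by rewrite mulrnDl addrACA !mulr0n !addr0.
Qed.

Lemma gel_sK j s : gel_s (gel j s) = s.
Proof.
rewrite /gel_s /gel /= odd_ZnD odd_ZnMn /= odd_n andbF /= odd_ZnMn odd_Zn_nat odd_n.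
by apply/eqP; move: s; apply: all_Z4; vm_compute.
Qed.

Lemma gel_coord (g : G) : g = gel g.1 (gel_s g).
Proof.
have mn (m : Zn) : m *+ n = n%:R *+ odd m.
  by rewrite -n_mulrn -[m in LHS]natr_Zp mulrnAC.
case: g => m x; rewrite /gel /gel_s /=.
have half (y z : bool) : (2 *+ y + 1 *+ z : 'Z_4)%R./2 = y by case: y z => [] [].
have par (y z : bool) : odd (2 *+ y + 1 *+ z : 'Z_4)%R = z by case: y z => [] [].
by rewrite half par mulrS mn -addrA -mulrnDl quat_2n mul0rn addr0.
Qed.

Lemma gel0 : gel 0 0 = 1%g.
Proof. by rewrite /gel mul0rn mulr0n addr0. Qed.

Lemma qb_gel s : (qb n ^+ s)%g = gel 0 s.
Proof.
have qbX (m : nat) : (qb n ^+ m)%g = gel 0 m%:R.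
  elim: m => [|m IH]; first by rewrite expg0 gel0.
  have b1 : qb n = gel 0 1 by rewrite /gel mul0rn addr0.
  by rewrite expgS IH b1 gelM /= subr0 -natr1 addrC.
by rewrite qbX natr_Zp.
Qed.

Lemma qa_gel : qa n = gel 1 2.
Proof.
rewrite /gel /=; congr (_, _).
by rewrite mulrS mulr1n -addrA quat_2n addr0.
Qed.

Lemma gelV j s : (gel j s)^-1%g = gel (if odd s then j else - j) (- s).
Proof.
apply: (mulgI (gel j s)); rewrite mulgV gelM subrr -gel0.
by case: (odd s); rewrite subrr.
Qed.
End Coordinates.

(** * The root of unity *)

Section RootOfUnity.
Variables (R : realType) (n : nat).
Hypothesis odd_n : odd n.
Local Notation Zn := 'Z_(2 * n).
Local Notation th := (pi / n%:R : R).

Lemma eps_exp m : eps R n ^+ m = cos (th *+ m) +i* sin (th *+ m).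
Proof.
elim: m => [|m IH]; first by rewrite mulr0n cos0 sin0.
rewrite exprSr IH mulrSr cosD sinD /eps; simpc.
by congr (_ +i* _); ring.
Qed.

Lemma eps_n : eps R n ^+ n = -1.
Proof.
have n0 : n%:R != 0 :> R by rewrite pnatr_eq0 -lt0n odd_gt0.
rewrite eps_exp -[th *+ n]mulr_natr divfK // cospi sinpi; simpc.
by [].
Qed.

(** As [n] is odd, [- eps] is a root of unity of order [n], hence a value at [c]
    of a character of the group that [c] generates. *)
Definition eta : R[i] := - eps R n.

Lemma eta_n : eta ^+ n = 1.
Proof. by rewrite /eta exprNn eps_n -signr_odd odd_n expr1 mulrN1 opprK. Qed.

Lemma eta_primitive m : (0 < m < n)%N -> eta ^+ m != 1.
Proof.
case/andP => m0 mn.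
have sin_pos : 0 < sin (th *+ m).
  have n0 : 0 < n%:R :> R by rewrite ltr0n odd_gt0.
  apply: sin_gt0_pi; rewrite -[th *+ m]mulr_natr.
  apply/andP; split; first by rewrite mulr_gt0 ?ltr0n ?(divr_gt0 _ n0) ?pi_gt0.
  by rewrite mulrAC ltr_pdivrMr // ltr_pM2l ?pi_gt0 // ltr_nat.
rewrite /eta exprNn eps_exp -signr_odd; case: (odd m); rewrite ?expr0 ?expr1.
  by rewrite mulN1r eq_complex /= oppr_eq0 (gt_eqF sin_pos) andbF.
by rewrite mul1r eq_complex /= (gt_eqF sin_pos) andbF.
Qed.

(** A function on residues modulo [2n], as [eta ^+ n = 1]. *)
Definition Ech (m : Zn) : R[i] := eta ^+ m.

Lemma Ech_nat (m : nat) : Ech m%:R = eta ^+ m.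
Proof.
rewrite /Ech val_Zp_nat ?n2_gt1 // expr_mod //.
by rewrite mulnC exprM eta_n expr1n.
Qed.

Lemma EchD j k : Ech (j + k) = Ech j * Ech k.
Proof. by rewrite -[j]natr_Zp -[k]natr_Zp -natrD !Ech_nat exprD. Qed.

Lemma Ech0 : Ech 0 = 1. Proof. by rewrite -[0]/(0%:R) Ech_nat. Qed.

Lemma Ech_neq0 j : Ech j != 0.
Proof.
have := Ech0; rewrite -(subrr j) EchD; apply: contra_eq_neq => ->.
by rewrite mul0r eq_sym oner_eq0.
Qed.

Lemma EchN j : Ech (- j) = (Ech j)^-1.
Proof.
by apply: (mulIf (Ech_neq0 j)); rewrite -EchD addNr Ech0 mulVf ?Ech_neq0.
Qed.

Lemma EchMn j m : Ech (j *+ m) = Ech j ^+ m.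
Proof. by elim: m => [|m IH]; rewrite ?mulr0n ?Ech0 // mulrSr EchD IH exprSr. Qed.

Lemma Ech_n (j : Zn) : Ech (j *+ n) = 1.
Proof. by rewrite EchMn /Ech -exprM mulnC exprM eta_n expr1n. Qed.

Lemma conj_Ech j : (Ech j)^*%C = Ech (- j).
Proof.
have etaV : eta^*%C * eta = 1.
  rewrite /eta rmorphN mulrNN /eps; apply/eqP; rewrite eq_complex /=.
  apply/andP; split; apply/eqP; last by ring.
  by rewrite -[RHS](cos2Dsin2 th); ring.
apply: (mulIf (Ech_neq0 j)); rewrite -EchD addNr Ech0 /Ech rmorphXn.
by rewrite -exprMn etaV expr1n.
Qed.

Lemma EchM (j k : Zn) : Ech (j * k) = Ech j ^+ k.
Proof. by rewrite -[k in LHS]natr_Zp mulr_natr EchMn. Qed.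

Lemma Ech_sum j : \sum_k Ech (j * k) = (2 * n)%:R * (Ech j == 1)%:R.
Proof.
under eq_bigr => k _ do rewrite EchM.
have cZ : (Zp_trunc (2 * n)).+2 = (2 * n)%N by rewrite Zp_cast ?n2_gt1.
have [->|j1] := eqVneq (Ech j) 1.
  under eq_bigr => k _ do rewrite expr1n.
  by rewrite sumr_const card_ord cZ mulr1.
rewrite mulr0; apply/eqP; have := subrX1 (Ech j) (Zp_trunc (2 * n)).+2.
rewrite {1}cZ mulnC exprM -EchMn Ech_n expr1n subrr => /esym/eqP.
by rewrite mulf_eq0 subr_eq0 (negbTE j1).
Qed.

Lemma Ech_eq1 j : Ech j = 1 -> j *+ n.+1 = 0.
Proof.
move=> Ej; have nj : (n %| j)%N.
  rewrite /dvdn; apply: contraT; rewrite -lt0n => r0.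
  have r1 : eta ^+ (j %% n)%N = 1.
    by rewrite (expr_mod _ eta_n).
  have := eta_primitive (m := (j %% n)%N); rewrite r0 ltn_mod odd_gt0 // => /(_ isT).
  by rewrite r1 eqxx.
rewrite -[j]natr_Zp; case/dvdnP: nj => q ->; rewrite -mulrnA.
have -> : (q * n * n.+1 = 2 * n * (q * n.+1./2))%N.
  have n1 : (n.+1 = 2 * n.+1./2)%N by rewrite mul2n -[LHS]odd_double_half /= odd_n.
  by rewrite {1}n1; ring.
by rewrite mulrnA pchar_Zp ?n2_gt1 // mul0rn.
Qed.
End RootOfUnity.

(** * Even and odd parts of rotations *)

HB.lock Definition cpow (R : realType) (n : nat) (k : 'Z_(2 * n)) :
  galg R (quat n) := lam R (gel k 0).
HB.lock Definition cosg (R : realType) (n : nat) (k : 'Z_(2 * n)) :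
  galg R (quat n) := 2^-1 *: (cpow R k + cpow R (- k)).
HB.lock Definition sing (R : realType) (n : nat) (k : 'Z_(2 * n)) :
  galg R (quat n) := 2^-1 *: (cpow R k - cpow R (- k)).

(** The cosine and the sine of [j t], where [eta = e^(i t)]; through [Ech] they
    depend on the residue of [j] only. *)
HB.lock Definition cs (R : realType) (n : nat) (j : 'Z_(2 * n)) : R[i] :=
  2^-1 * (Ech R j + Ech R (- j)).
HB.lock Definition sn (R : realType) (n : nat) (j : 'Z_(2 * n)) : R[i] :=
  2^-1 * (- 'i%C) * (Ech R j - Ech R (- j)).

Section CosineSine.
Variables (R : realType) (n : nat).
Hypothesis odd_n : odd n.
Local Notation G := (quat n).
Local Notation A := (galg R G).
Local Notation Zn := 'Z_(2 * n).
Local Notation ii := (i4 R).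
Local Notation b := (qb n).
Local Notation lb := (@lb R G b).
Local Notation proj := (@proj R G b).
Local Notation gmap := (@gmap R _ _).
Local Notation Ech := (@Ech R n).
Implicit Types (j k : Zn) (q s t p : 'Z_4).

Local Notation cs := (@cs R n).
Local Notation sn := (@sn R n).

Lemma csE j : cs j = 2^-1 * (Ech j + Ech (- j)).
Proof. by rewrite cs.unlock. Qed.
Lemma snE j : sn j = 2^-1 * (- 'i%C) * (Ech j - Ech (- j)).
Proof. by rewrite sn.unlock. Qed.

Lemma csN j : cs (- j) = cs j. Proof. by rewrite !csE opprK addrC. Qed.
Lemma snN j : sn (- j) = - sn j. Proof. by rewrite !snE opprK -mulrN opprB. Qed.

Lemma sqr_i' : 'i%C * 'i%C = -1 :> R[i]. Proof. by rewrite -expr2 sqr_i. Qed.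

Lemma csD j k : cs (j + k) = cs j * cs k - sn j * sn k.
Proof.
rewrite !csE !snE opprD !EchD //.
transitivity (2^-1 * (2^-1 * ((Ech j + Ech (- j)) * (Ech k + Ech (- k))
   - ('i%C * 'i%C) * ((Ech j - Ech (- j)) * (Ech k - Ech (- k)))))).
  by rewrite sqr_i'; field.
by ring.
Qed.

Lemma snD j k : sn (j + k) = sn j * cs k + cs j * sn k.
Proof. by rewrite !csE !snE opprD !EchD //; field. Qed.

Lemma cs_i_sn j : cs j + 'i%C * sn j = Ech j.
Proof.
rewrite !csE !snE.
transitivity (2^-1 * (Ech j + Ech (- j) - ('i%C * 'i%C) * (Ech j - Ech (- j)))).
  by ring.
by rewrite sqr_i'; field.
Qed.

Lemma cs0 : cs 0 = 1.
Proof. by rewrite !csE oppr0 Ech0 //; field. Qed.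
Lemma sn0 : sn 0 = 0.
Proof. by rewrite !snE oppr0 subrr mulr0. Qed.

Lemma conj_half : (2^-1)^*%C = 2^-1 :> R[i].
Proof. by rewrite conjc_inv conjc_nat. Qed.

Lemma conj_cs j : (cs j)^*%C = cs j.
Proof.
rewrite !csE rmorphM rmorphD [X in X * _]conj_half [X in _ * (X + _)]conj_Ech //.
by rewrite [X in _ * (_ + X)]conj_Ech // opprK [Ech (- j) + _]addrC.
Qed.

Lemma conj_sn j : (sn j)^*%C = sn j.
Proof.
rewrite !snE !rmorphM rmorphB [X in X * _ * _]conj_half.
rewrite [X in _ * (X - _)]conj_Ech // [X in _ * (_ - X)]conj_Ech // opprK.
have conj_Ni : (- 'i)^*%C = 'i%C :> R[i].
  by rewrite -i4_3 conj_i4 -i4_1; congr (ii _); apply: val_inj.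
rewrite [X in _ * X * _ = _]conj_Ni.
by rewrite mulrN mulNr -mulrN opprB.
Qed.

Lemma Ech_gel j s k t : Ech ((gel j s).1 * (gel k t).1) = Ech (j * k).
Proof.
have gl i r m : Ech ((gel i r).1 * m) = Ech (i * m).
  have -> : (gel i r).1 * m = i * m + (i * m *+ n + m *+ r./2 *+ n).
    rewrite -[(gel i r).1]/(i *+ n.+1 + n%:R *+ r./2) mulrDl !mulrnAl mulrS.
    by rewrite mul1r [m *+ n *+ _]mulrnAC addrA.
  by rewrite !EchD // !Ech_n // !mulr1.
by rewrite gl mulrC gl mulrC.
Qed.

Local Notation cpow := (@cpow R n).
Local Notation cosg := (@cosg R n).
Local Notation sing := (@sing R n).

Lemma cpowE k : cpow k = lam R (gel k 0). Proof. by rewrite cpow.unlock. Qed.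
Lemma cosgE k : cosg k = 2^-1 *: (cpow k + cpow (- k)).
Proof. by rewrite cosg.unlock. Qed.
Lemma singE k : sing k = 2^-1 *: (cpow k - cpow (- k)).
Proof. by rewrite sing.unlock. Qed.

Lemma lb_gel t : lb t = lam R (gel 0 t).
Proof. by rewrite lbE qb_gel. Qed.

Lemma lb_cpow t k : lb t * cpow k = lam R (gel (if odd t then - k else k) t).
Proof.
by rewrite lb_gel cpowE -lamM gelM addr0 sub0r add0r.
Qed.

Lemma cpow_lb t k : cpow k * lb t = lam R (gel k t).
Proof.
by rewrite lb_gel cpowE -lamM gelM addr0 add0r.
Qed.

Lemma lb_cpowC t k : lb t * cpow k = cpow (if odd t then - k else k) * lb t.
Proof. by rewrite lb_cpow cpow_lb. Qed.

Lemma two_neq0 : (2 : R[i]) != 0. Proof. by rewrite pnatr_eq0. Qed.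

Lemma halfD (V : lmodType R[i]) (x : V) : 2^-1 *: (x + x) = x.
Proof.
by rewrite -mulr2n -[x *+ 2]scaler_nat scalerA mulVf ?two_neq0 // scale1r.
Qed.

Lemma cos_add_sin k : cosg k + sing k = cpow k.
Proof.
by rewrite cosgE singE -scalerDr addrACA subrr addr0 halfD.
Qed.

Lemma cos_sub_sin k : cosg k - sing k = cpow (- k).
Proof.
by rewrite cosgE singE -scalerBr opprB [X in _ *: X]addrC addrA subrK halfD.
Qed.

Lemma lb_cosg t k : lb t * cosg k = cosg k * lb t.
Proof.
rewrite cosgE -scalerAl -scalerAr mulrDr mulrDl !lb_cpowC; congr (_ *: _).
by case: (odd t); rewrite ?opprK; [exact: addrC | reflexivity].
Qed.

Lemma lb_sing t k : sing k * lb t = ii (2 * t) *: (lb t * sing k).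
Proof.
rewrite singE -scalerAl -scalerAr scalerA mulrC -scalerA; congr (_ *: _).
have -> : ii (2 * t) = (-1) ^+ odd t.
  by rewrite -[t in LHS]natr_Zp -i4X i4_2 signr_odd.
rewrite mulrBr mulrBl !lb_cpowC.
case: (odd t); rewrite ?opprK; last by rewrite scale1r.
by rewrite expr1 scaleN1r opprB.
Qed.

Lemma proj_cosg q k : proj q * cosg k = cosg k * proj q.
Proof.
rewrite projE -scalerAl -scalerAr mulr_suml mulr_sumr; congr (_ *: _).
by apply: eq_bigr => s _; rewrite -scalerAl -scalerAr lb_cosg.
Qed.

(** [S_k] changes its sign under conjugation by [b], and [-1 = i^2] shifts the
    index of the projection by 2. *)
Lemma proj_sing q k : proj q * sing k = sing k * proj (q + 2).
Proof.
rewrite !projE -scalerAl -scalerAr mulr_suml mulr_sumr; congr (_ *: _).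
apply: eq_bigr => s _; rewrite -scalerAl -scalerAr lb_sing scalerA -i4D.
congr (ii _ *: _); ring.
Qed.

Lemma sing_proj q k : sing k * proj q = proj (q + 2) * sing k.
Proof.
rewrite proj_sing -addrA (_ : 2 + 2 = 0) ?addr0 //; exact: val_inj.
Qed.

Lemma star_cpow k : star (cpow k) = cpow (- k).
Proof. by rewrite !cpowE star_lam gelV // !oppr0. Qed.
Lemma gmap_inv_cpow k : gmap (@inv G) (cpow k) = cpow (- k).
Proof. by rewrite -star_cpow !cpowE gmap_lam star_lam. Qed.
Lemma gmap_diag_cpow k : gmap (@diag G) (cpow k) = gtens (cpow k) (cpow k).
Proof. by rewrite !cpowE gmap_lam gtens_lam. Qed.

Lemma star_cosg k : star (cosg k) = cosg k.
Proof.
rewrite cosgE starZ conj_half starD !star_cpow opprK; congr (_ *: _).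
exact: addrC.
Qed.

Lemma star_sing k : star (sing k) = - sing k.
Proof.
by rewrite singE starZ conj_half starD starN !star_cpow opprK -scalerN opprB addrC.
Qed.

Lemma gmap_inv_cosg k : gmap (@inv G) (cosg k) = cosg k.
Proof.
rewrite cosgE linearZ linearD /= !gmap_inv_cpow opprK; congr (_ *: _).
exact: addrC.
Qed.

Lemma gmap_inv_sing k : gmap (@inv G) (sing k) = - sing k.
Proof.
by rewrite singE linearZ linearB /= !gmap_inv_cpow opprK -scalerN opprB.
Qed.

Lemma gmap_diag_cosg k :
  gmap (@diag G) (cosg k) = gtens (cosg k) (cosg k) + gtens (sing k) (sing k).
Proof.
rewrite [in LHS]cosgE linearZ linearD /= !gmap_diag_cpow.
rewrite -cos_sub_sin -(cos_add_sin k) !(gtensDl, gtensDr).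
rewrite -[- sing k]scaleN1r !(gtensZl, gtensZr) scalerA mulrNN mulr1 scale1r.
rewrite !scaleN1r; set x := gtens _ _; set y := gtens _ _; set z := gtens _ _.
set w := gtens _ _.
have -> : x + y + (z + w) + (x - y + (- z + w)) = (x + w) + (x + w).
  rewrite addrACA [x + y + _]addrACA subrr addr0 [z + w + _]addrACA subrr add0r.
  by rewrite addrACA.
exact: halfD.
Qed.

Lemma gmap_diag_sing k :
  gmap (@diag G) (sing k) = gtens (cosg k) (sing k) + gtens (sing k) (cosg k).
Proof.
rewrite [in LHS]singE linearZ linearB /= !gmap_diag_cpow.
rewrite -cos_sub_sin -(cos_add_sin k) !(gtensDl, gtensDr).
rewrite -[- sing k]scaleN1r !(gtensZl, gtensZr) scalerA mulrNN mulr1 scale1r.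
rewrite !scaleN1r; set x := gtens _ _; set y := gtens _ _; set z := gtens _ _.
set w := gtens _ _.
have -> : x + y + (z + w) - (x - y + (- z + w)) = (y + z) + (y + z).
  rewrite !opprD !opprK addrACA [x + y + _]addrACA subrr add0r.
  by rewrite [z + w + _]addrACA subrr addr0 addrACA.
exact: halfD.
Qed.

(** The elements [P_q C_k] and [P_q S_k] span the group algebra: Fourier
    inversion writes [b^s] in the [P_q], and [c^k = C_k + S_k]. *)
Lemma cos_sin_span (P : A -> Prop) :
  (forall (c : R[i]) x y, P x -> P y -> P (c *: x + y)) ->
  (forall q k, P (proj q * cosg k)) -> (forall q k, P (proj q * sing k)) ->
  forall x, P x.
Proof.
move=> Plin Pcos Psin.
have P0 : P 0.
  by have := Plin (-1) _ _ (Pcos 0 0) (Pcos 0 0); rewrite scaleN1r addNr.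
have PZ c x : P x -> P (c *: x) by move=> Px; rewrite -[_ *: _]addr0; apply: Plin.
have PD x y : P x -> P y -> P (x + y) by move=> Px; rewrite -[x]scale1r; apply: Plin.
have Psum (I : finType) (F : I -> A) : (forall i, P (F i)) -> P (\sum_i F i).
  by move=> PF; elim/big_ind: _.
move=> x; rewrite (galg_sum x); apply: (Psum) => g; apply: (PZ).
rewrite (gel_coord g); set j := g.1; set s := gel_s g.
have -> : lam R (gel j s) =
    \sum_q ii (q * s) *: (proj q * cpow (if odd s then - j else j)).
  under eq_bigr do rewrite scalerAl.
  rewrite -mulr_suml -(lb_sum R b) lb_cpow.
  by case: (odd _); rewrite ?opprK.
apply: (Psum) => q; apply: (PZ); rewrite -cos_add_sin mulrDr.
by apply: PD; [apply: Pcos | apply: Psin].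
Qed.
End CosineSine.

(** * The self-duality pairing *)

(** The value of [c^j b^s] on [P_q S_k], up to the sine ([pairing_sing]). *)
HB.lock Definition dual_coef (R : realType) (o e : bool) (s q : 'Z_4) : R[i] :=
  2^-1 * i4 R (wexp o e s q).

(** The Fourier transform of [dual_coef], for values on [S_k b^t]; the shift by 2
    comes from moving [P_q] past [S_k]. *)
HB.lock Definition dual_sin (R : realType) (o e : bool) (s t : 'Z_4) : R[i] :=
  \sum_q i4 R (q * t) * dual_coef R o e s (q + 2).

(** The value of [g = c^j b^s] at [h = c^k b^t], with [C_k b^t] contributing the
    cosine and [S_k b^t] the sine. *)
HB.lock Definition dual_kernel (R : realType) (n : nat) (o e : bool)
    (g h : quat n) : R[i] :=
  i4 R (gel_s g * gel_s h) * cs R (g.1 * h.1)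
  + dual_sin R o e (gel_s g) (gel_s h) * sn R (g.1 * h.1).

HB.lock Definition dual_vec (R : realType) (n : nat) (o e : bool)
    (g : quat n) : vec R (quat n) := [ffun h => dual_kernel R o e g h].

Section DualPairing.
Variables (R : realType) (n : nat).
Hypothesis odd_n : odd n.
Local Notation G := (quat n).
Local Notation A := (galg R G).
Local Notation Zn := 'Z_(2 * n).
Local Notation ii := (i4 R).
Local Notation b := (qb n).
Local Notation b4 := (qb_exp4 (odd_gt0 odd_n)).
Local Notation lb := (@lb R G b).
Local Notation proj := (@proj R G b).
Local Notation Om := (@twistor R G b).
Local Notation Dl := (@tcomul R G b).
Local Notation gmap := (@gmap R _ _).
Local Notation cosg := (@cosg R n).
Local Notation sing := (@sing R n).
Implicit Types (j k l : Zn) (q s t p r : 'Z_4).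

(** * The coproduct of the even and odd parts *)

(** When [x] and [y] carry projections to projections, the twist and its adjoint
    only multiply a block by a scalar. *)
Lemma twist_block p r p' r' (x y : A) :
  proj p * x = x * proj p' -> proj r * y = y * proj r' ->
  Om * gtens (proj p * x) (proj r * y) * star Om
  = ii (omega_exp p r - omega_exp p' r') *: gtens (proj p * x) (proj r * y).
Proof.
move=> xp yr.
have tl := (diagonal_twistor R b4 (p, r)).2.
have tr := (diagonal_twistor_star R b4 (p', r')).1.
rewrite -[in LHS]gtensM mulrA [Om * _]tl -!scalerAl i4D -scalerA; congr (_ *: _).
rewrite [_ * gtens x y]gtensM xp yr -gtensM -mulrA.
by rewrite [_ * star Om]tr -scalerAr.
Qed.

Lemma tcomul_proj_mul q (x : A) :
  Dl (proj q * x) = \sum_p Om * (gtens (proj p) (proj (q - p)) * gmap (@diag G) x) * star Om.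
Proof.
rewrite tcomulE gmapM; last exact: diagM.
by rewrite (gmap_diag_proj R b) !(mulr_suml, mulr_sumr).
Qed.

Lemma tcomul_cosg q k : Dl (proj q * cosg k) = \sum_p
  (gtens (proj p * cosg k) (proj (q - p) * cosg k)
   + ii (omega_exp p (q - p) - omega_exp (p + 2) (q - p + 2)) *:
       gtens (proj p * sing k) (proj (q - p) * sing k)).
Proof.
rewrite tcomul_proj_mul; apply: eq_bigr => p _.
rewrite gmap_diag_cosg // mulrDr mulrDr mulrDl !gtensM.
rewrite (twist_block (proj_cosg R p k) (proj_cosg R (q - p) k)).
rewrite (twist_block (proj_sing R p k) (proj_sing R (q - p) k)).
by rewrite subrr i4_0 scale1r.
Qed.

Lemma tcomul_sing q k : Dl (proj q * sing k) = \sum_p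
  (ii (rho_exp p (q - p)) *: gtens (proj p * cosg k) (proj (q - p) * sing k)
   + ii (omega_exp p (q - p) - omega_exp (p + 2) (q - p)) *:
       gtens (proj p * sing k) (proj (q - p) * cosg k)).
Proof.
rewrite tcomul_proj_mul; apply: eq_bigr => p _.
rewrite gmap_diag_sing // mulrDr mulrDr mulrDl !gtensM.
rewrite (twist_block (proj_cosg R p k) (proj_sing R (q - p) k)).
by rewrite (twist_block (proj_sing R p k) (proj_cosg R (q - p) k)).
Qed.

(** * Values of the pairing *)

Section Values.
Variables o e : bool.
Local Notation W := (dual_coef R o e).
Local Notation M := (dual_sin R o e).
Local Notation K := (dual_kernel R o e).
Local Notation B := (@dual_vec R n o e).

Lemma dual_vecE g h : B g h = K g h.
Proof. by rewrite dual_vec.unlock ffunE. Qed.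

Lemma dual_kernel_gel j s k t :
  K (gel j s) (gel k t) = ii (s * t) * cs R (j * k) + M s t * sn R (j * k).
Proof.
have gelN : Ech R (- ((gel j s).1 * (gel k t).1)) = Ech R (- (j * k)).
  by rewrite !EchN // Ech_gel.
rewrite dual_kernel.unlock !gel_sK // !csE !snE.
by rewrite gelN Ech_gel.
Qed.

Lemma pairing_proj (f : vec R G) q (x : A) :
  pairing f (proj q * x) = 4^-1 * \sum_t ii (- (q * t)) * pairing f (lb t * x).
Proof.
rewrite projE -scalerAl linearZ mulr_suml linear_sum; congr (_ * _).
by apply: eq_bigr => t _; rewrite -scalerAl linearZ.
Qed.

Lemma pairing_comb (hT : finGroupType) (f : vec R hT) (c d : R[i]) (x y : galg R hT) :
  pairing f (c *: x + d *: y) = c * pairing f x + d * pairing f y.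
Proof. by rewrite [LHS]pairing_is_scalar linearZ. Qed.

Lemma pairing_lb_cosg j s k t :
  pairing (B (gel j s)) (lb t * cosg k) = ii (s * t) * cs R (j * k).
Proof.
rewrite cosgE -scalerAr mulrDr !lb_cpow // linearZ linearD /= !pairing_base !dual_vecE.
rewrite !dual_kernel_gel opprK.
have sgn (m : Zn) : cs R (j * - m) = cs R (j * m) by rewrite mulrN csN.
have sgn' (m : Zn) : sn R (j * - m) = - sn R (j * m) by rewrite mulrN snN.
by case: (odd t); rewrite sgn sgn'; field.
Qed.

Lemma pairing_lb_sing j s k t :
  pairing (B (gel j s)) (lb t * sing k) = ii (2 * t) * M s t * sn R (j * k).
Proof.
rewrite singE -scalerAr mulrBr !lb_cpow // linearZ linearB /= !pairing_base !dual_vecE.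
rewrite !dual_kernel_gel opprK.
have sgn (m : Zn) : cs R (j * - m) = cs R (j * m) by rewrite mulrN csN.
have sgn' (m : Zn) : sn R (j * - m) = - sn R (j * m) by rewrite mulrN snN.
have -> : ii (2 * t) = (-1) ^+ odd t.
  by rewrite -[t in LHS]natr_Zp -i4X i4_2 signr_odd.
by case: (odd t); rewrite sgn sgn' ?expr1 ?expr0; field.
Qed.

Lemma pairing_cosg j s q k :
  pairing (B (gel j s)) (proj q * cosg k) = (q == s)%:R * cs R (j * k).
Proof.
rewrite pairing_proj.
under eq_bigr => t _ do rewrite pairing_lb_cosg mulrA -i4D -mulNr -mulrDl.
rewrite -mulr_suml i4_sum mulrA mulrA mulVf ?four_neq0 // mul1r.
by rewrite addrC subr_eq0 eq_sym.
Qed.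

Lemma pairing_sing j s q k :
  pairing (B (gel j s)) (proj q * sing k) = W s q * sn R (j * k).
Proof.
rewrite pairing_proj.
under eq_bigr => t _ do rewrite pairing_lb_sing !mulrA -i4D.
rewrite -mulr_suml mulrA; congr (_ * _).
under eq_bigr => t _.
  rewrite dual_sin.unlock mulr_sumr.
  under eq_bigr => r _.
    rewrite mulrA -i4D (_ : - (q * t) + 2 * t + r * t = (r - q + 2) * t); last by ring.
    over.
  over.
rewrite exchange_big /=.
under eq_bigr => r _.
  rewrite -mulr_suml i4_sum (_ : (r - q + 2 == 0) = (q - 2 == r)); last first.
    by rewrite -[RHS]subr_eq0 -[LHS]oppr_eq0; congr (_ == _); ring.
  rewrite -mulrA.
  over.
rewrite -mulr_sumr sum_deltaM mulrA mulVf ?four_neq0 // mul1r.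
by congr (W s _); ring.
Qed.

(** * The pairing turns products into coproducts *)

Hypothesis eo : e ==> o.

Definition dual_prod (g h : G) : G := if e then (h * g)%g else (g * h)%g.

Lemma dual_prod_gel j s l r : exists2 m,
  dual_prod (gel j s) (gel l r) = gel m (s + r)
  & forall k, cs R (m * k) = cs R (j * k) * cs R (l * k)
        - ii (sgnl e r + sgnr e s) * sn R (j * k) * sn R (l * k)
     /\ sn R (m * k) = ii (sgnl e r) * sn R (j * k) * cs R (l * k)
        + ii (sgnr e s) * cs R (j * k) * sn R (l * k).
Proof.
have sgn (x : 'Z_4) : ii (2 * x) = (-1) ^+ odd x.
  by rewrite -[x in LHS]natr_Zp -i4X i4_2 signr_odd.
have csB (i m : Zn) : cs R (i - m) = cs R i * cs R m + sn R i * sn R m.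
  by rewrite csD // csN snN; ring.
have snB (i m : Zn) : sn R (i - m) = sn R i * cs R m - cs R i * sn R m.
  by rewrite snD // csN snN; ring.
rewrite /dual_prod /sgnl /sgnr; case: e; rewrite gelM //; rewrite ?add0r ?addr0 sgn i4_0.
  exists (if odd r then l - j else l + j); first by rewrite [s + r]addrC.
  move=> k; case: (odd r); rewrite ?mulrBl ?mulrDl ?expr0 ?expr1.
    by rewrite csB snB; split; ring.
  by rewrite csD // snD //; split; ring.
exists (if odd s then j - l else j + l) => // k.
case: (odd s); rewrite ?mulrBl ?mulrDl ?expr0 ?expr1.
  by rewrite csB snB; split; ring.
by rewrite csD // snD //; split; ring.
Qed.

Lemma dual_coef_sc s r q : ii (sgnl e r) * W (s + r) q
  = ii (omega_exp (q - r) r - omega_exp (q - r + 2) r) * W s (q - r).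
Proof.
by rewrite dual_coef.unlock mulrCA -i4D wexp_sc // i4D mulrCA.
Qed.

Lemma dual_coef_cs s r q : ii (sgnr e s) * W (s + r) q
  = ii (rho_exp s (q - s)) * W r (q - s).
Proof.
by rewrite dual_coef.unlock mulrCA -i4D wexp_cs // i4D mulrCA.
Qed.

Lemma dual_coef_ss s r q :
  \sum_p ii (omega_exp p (q - p) - omega_exp (p + 2) (q - p + 2)) *
    (W s p * W r (q - p))
  = - (q == s + r)%:R * ii (sgnl e r + sgnr e s).
Proof.
transitivity (4^-1 * \sum_p ii (ss_exp o e s r q p)).
  rewrite mulr_sumr; apply: eq_bigr => p _; rewrite dual_coef.unlock /ss_exp !i4D.
  by field.
rewrite (sum_i4_eq R (ss_exp_cnt s r q eo)) /ss_val.
case: eqP => _.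
  rewrite (i4D _ (2 + sgnl e r)) (i4D _ 2) (i4D _ (sgnl e r)) i4_2.
  by rewrite sumZ4 /=; field.
under eq_bigr do rewrite -[X in ii X]mul1r.
by rewrite i4_sum mulr0 /= !mulr0 oppr0 mul0r.
Qed.

(** On [P_q C_k] and [P_q S_k] both sides are expanded by the addition formulas:
    [dual_coef_ss] accounts for the sine times sine term of the cosine,
    [dual_coef_sc] and [dual_coef_cs] for the two terms of the sine. *)
Lemma dual_vec_prod g h (x : A) :
  pairing (B (dual_prod g h)) x = pairing (tens (B g) (B h)) (Dl x).
Proof.
rewrite (gel_coord g) (gel_coord h).
set j := g.1; set s := gel_s g; set l := h.1; set r := gel_s h.
have [m -> addm] := dual_prod_gel j s l r.
move: x; apply: cos_sin_span => [c x y Px Py|q k|q k].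
- by rewrite pairing_is_scalar Px Py linearP pairing_is_scalar.
- rewrite tcomul_cosg linear_sum.
  under eq_bigr => p _.
    rewrite linearD linearZ /= !gtensE !pairing_tens !pairing_cosg !pairing_sing.
    over.
  rewrite big_split /= pairing_cosg (addm k).1 mulrBr; congr (_ + _); apply/esym.
    transitivity (\sum_p (s == p)%:R
        * ((q - p == r)%:R * (cs R (j * k) * cs R (l * k)))).
      by apply: eq_bigr => p _; rewrite [p == s]eq_sym; ring.
    by rewrite sum_deltaM subr_eq addrC.
  transitivity ((\sum_p ii (omega_exp p (q - p) - omega_exp (p + 2) (q - p + 2))
      * (W s p * W r (q - p))) * (sn R (j * k) * sn R (l * k))).
    by rewrite mulr_suml; apply: eq_bigr => p _; ring.
  by rewrite dual_coef_ss; ring.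
- rewrite tcomul_sing linear_sum.
  under eq_bigr => p _.
    rewrite /= pairing_comb !gtensE !pairing_tens !pairing_cosg !pairing_sing.
    over.
  rewrite big_split /= pairing_sing (addm k).2 mulrDr addrC; congr (_ + _); apply/esym.
    transitivity (\sum_p (q - r == p)%:R
        * (ii (omega_exp p (q - p) - omega_exp (p + 2) (q - p)) * W s p
           * (sn R (j * k) * cs R (l * k)))).
      apply: eq_bigr => p _; rewrite (_ : (q - p == r) = (q - r == p)); first by ring.
      by rewrite !subr_eq addrC.
    rewrite sum_deltaM (_ : q - (q - r) = r) -?dual_coef_sc; by ring.
  transitivity (\sum_p (s == p)%:R * (ii (rho_exp p (q - p)) * W r (q - p)
      * (cs R (j * k) * sn R (l * k)))).
    by apply: eq_bigr => p _; rewrite [p == s]eq_sym; ring.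
  by rewrite sum_deltaM -dual_coef_cs; ring.
Qed.
End Values.
End DualPairing.

(** * The isomorphism for odd [n] *)

Lemma pairing_sym (R : realType) (I : finType) (f x : vec R I) :
  pairing f x = pairing x f.
Proof. by apply: eq_bigr => i _; rewrite mulrC. Qed.

Lemma pairing_linl (R : realType) (I : finType) (c : R[i]) (f h x : vec R I) :
  pairing (c *: f + h) x = c * pairing f x + pairing h x.
Proof. by rewrite !(pairing_sym _ x) pairing_is_scalar. Qed.

Lemma linear_inj_bij (R : realType) (I : finType) (f : {linear vec R I -> vec R I}) :
  (forall x, f x = 0 -> x = 0) -> bijective f.
Proof.
move=> f_inj.
pose toR (x : vec R I) : 'rV[R[i]]_#|I| := \row_j x (enum_val j).
pose ofR (v : 'rV[R[i]]_#|I|) : vec R I := [ffun i => v 0 (enum_rank i)].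
have toRK : cancel toR ofR.
  by move=> x; apply/ffunP => i; rewrite ffunE mxE enum_rankK.
have ofRK : cancel ofR toR.
  by move=> v; apply/rowP => j; rewrite mxE ffunE enum_valK.
pose M := \matrix_(i < #|I|) toR (f (vbase R (enum_val i))).
have fM x : toR (f x) = toR x *m M.
  apply/rowP => j; rewrite !mxE (linear_lext f) /lext vec_sumE.
  rewrite (reindex (@enum_val I predT)) /=; last first.
    by apply: onW_bij; apply: enum_val_bij.
  apply: eq_bigr => i _; rewrite vecZE !mxE.
  by [].
have M_free : row_free M.
  rewrite -kermx_eq0; apply/eqP/row_matrixP => i; rewrite row0.
  have kM : row i (kermx M) *m M = 0 by rewrite -row_mul mulmx_ker row0.
  rewrite -[LHS]ofRK (f_inj (ofR (row i (kermx M)))).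
    by apply/rowP => j; rewrite !mxE ffunE.
  by rewrite -[LHS]toRK fM ofRK kM; apply/ffunP => k; rewrite !ffunE mxE.
have M_unit : M \in unitmx by rewrite -row_free_unit.
exists (fun y => ofR (toR y *m invmx M)) => y.
  by rewrite fM mulmxK // toRK.
by apply: (can_inj toRK); rewrite fM ofRK mulmxKV.
Qed.

Lemma conjcD (R : realType) (x y : R[i]) : ((x + y)^*)%C = (x^*)%C + (y^*)%C.
Proof. exact: rmorphD. Qed.
Lemma conjcM (R : realType) (x y : R[i]) : ((x * y)^*)%C = (x^*)%C * (y^*)%C.
Proof. exact: rmorphM. Qed.

Section Isomorphism.
Variables (R : realType) (n : nat) (o : bool).
Hypothesis odd_n : odd n.
Local Notation G := (quat n).
Local Notation A := (galg R G).
Local Notation Zn := 'Z_(2 * n).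
Local Notation ii := (i4 R).
Local Notation b := (qb n).
Local Notation b4 := (qb_exp4 (odd_gt0 odd_n)).
Local Notation proj := (@proj R G b).
Local Notation Dl := (@tcomul R G b).
Local Notation u := (@tunit R G b).
Local Notation S' := (@tantipode R G b).
Local Notation cosg := (@cosg R n).
Local Notation sing := (@sing R n).
Local Notation B := (@dual_vec R n o false).
Local Notation BT := (@dual_vec R n o o).
Implicit Types (j k l : Zn) (q s t p r : 'Z_4) (x y z : A) (g h : G).

Lemma dual_sinE e s t : dual_sin R o e s t
  = 2^-1 * \sum_q ii (q * t + wexp o e s (q + 2)).
Proof.
rewrite dual_sin.unlock mulr_sumr; apply: eq_bigr => q _.
by rewrite dual_coef.unlock mulrCA -i4D.
Qed.

(** Transposing the pairing reverses the order of products when [o] asks for it: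
    comultiplicativity of the isomorphism is multiplicativity of the
    transpose. *)
Lemma dual_kernel_sym g h : B g h = BT h g.
Proof.
rewrite !dual_vecE dual_kernel.unlock mulrC [h.1 * _]mulrC; congr (_ + _ * _).
  by rewrite [gel_s h * _]mulrC mulrC.
by rewrite !dual_sinE (sum_i4_eq R (wexp_transpose_cnt _ _ _)).
Qed.

Definition psi x : vec R G := lext B x.

Lemma psi_is_linear : linear psi.
Proof. by move=> c x y; rewrite /psi linearP. Qed.
HB.instance Definition _ :=
  GRing.isLinear.Build R[i] A (vec R G) _ psi psi_is_linear.

Lemma psi_lam g : psi (lam R g) = B g.
Proof. exact: lext_base. Qed.

Lemma psiE x h : psi x h = pairing (BT h) x.
Proof.
rewrite /psi /lext vec_sumE; apply: eq_bigr => g _.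
by rewrite vecZE dual_kernel_sym mulrC.
Qed.

Lemma lam_span (P : A -> Prop) :
  (forall (c : R[i]) x y, P x -> P y -> P (c *: x + y)) ->
  (forall g, P (lam R g)) -> forall x, P x.
Proof.
move=> Plin Plam x; have P0 : P 0.
  by have := Plin (-1) _ _ (Plam 1%g) (Plam 1%g); rewrite scaleN1r addNr.
rewrite (galg_sum x); elim/big_rec: _ => // g y _; exact: Plin.
Qed.

Lemma pairing_tens_linl (c : R[i]) (f f' h : vec R G) (t : vec R (G * G)%type) :
  pairing (tens (c *: f + f') h) t = c * pairing (tens f h) t + pairing (tens f' h) t.
Proof.
by rewrite -[tens _ _]/(tensr h _) linearP pairing_linl.
Qed.

Lemma pairing_tens_linr (c : R[i]) (f f' h : vec R G) (t : vec R (G * G)%type) :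
  pairing (tens h (c *: f + f')) t = c * pairing (tens h f) t + pairing (tens h f') t.
Proof. by rewrite linearP pairing_linl. Qed.

Lemma psiM_pairing x y z : pairing (psi (x * y)) z = pairing (tens (psi x) (psi y)) (Dl z).
Proof.
move: x; apply: lam_span => [c x x' Px Px'|g].
  rewrite mulrDl -scalerAl [psi (_ + x' * y)]psi_is_linear pairing_linl.
  rewrite [psi (_ + x')]psi_is_linear pairing_tens_linl.
  by congr (_ * _ + _); [apply: Px | apply: Px'].
move: y; apply: lam_span => [c y y' Py Py'|h].
  rewrite mulrDr -scalerAr [psi (_ + _ * y')]psi_is_linear pairing_linl.
  rewrite [psi (_ + y')]psi_is_linear pairing_tens_linr.
  by congr (_ * _ + _); [apply: Py | apply: Py'].
rewrite -lamM !psi_lam; exact: (dual_vec_prod odd_n (e := false)).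
Qed.

Local Notation K := (KQ R n).

Lemma psiM (x y : kcar K) :
  psi (kmul x y) = @kmul R (dual o K) (psi x) (psi y).
Proof.
apply/ffunP => i; rewrite [RHS]ffunE -[LHS]pairing_base.
have -> : kmul x y = (x : A) * (y : A) by rewrite mulgalgE.
by rewrite psiM_pairing /= KQ_comulE.
Qed.

Lemma psi1 : psi (kone K) = kone (dual o K).
Proof.
apply/ffunP => h; rewrite [RHS]ffunE [RHS](aug_lam R h) [psi _]psi_lam.
rewrite dual_vecE -gel0 {1}(gel_coord h) dual_kernel_gel //.
by rewrite !mul0r i4_0 cs0 // sn0 // mulr0 addr0 mulr1.
Qed.

Lemma psi_comul (x : kcar K) :
  @kcomul R (dual o K) (psi x) = tmap psi psi (kcomul x).
Proof.
apply/ffunP => -[g h]; rewrite [LHS]ffunE /=.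
transitivity (psi x (dual_prod o g h)).
  by rewrite /dual_prod; case: (o); rewrite gmul_lam pairing_base.
rewrite psiE (dual_vec_prod odd_n); last exact: implybb.
rewrite KQ_comulE // /tmap vec_sumE; apply: eq_bigr => -[g' h'] _.
by rewrite vecZE !tensE /= -!dual_kernel_sym mulrC !psi_lam.
Qed.

(** * Compatibility with the involutions *)

Lemma tunit_cosg k : u * cosg k = cosg k * u.
Proof.
rewrite tunit.unlock mulr_suml mulr_sumr; apply: eq_bigr => p _.
by rewrite -scalerAl -scalerAr proj_cosg.
Qed.

Lemma star_antipode_cosg q k : star (S' (proj q * cosg k)) = proj (- q) * cosg k.
Proof.
rewrite tantipode_projl ?b4 // tantipodeE gmap_inv_cosg // tunit_cosg.
rewrite -[cosg k * u * _]mulrA (tunitVr R b4) mulr1.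
by rewrite starM (star_proj R b4) star_cosg.
Qed.

Lemma star_antipode_sing q k : star (S' (proj q * sing k))
  = ii (omega_exp (- q) q - omega_exp (2 - q) (- (2 - q))) *: (proj (- q) * sing k).
Proof.
rewrite tantipode_projl ?b4 // tantipodeE gmap_inv_sing //.
rewrite -[_ * star u * _]mulrA (diagonal_tunit_star R b4 _).2 -scalerAr.
rewrite mulrN mulNr -mulrA sing_proj // mulrA (diagonal_tunit R b4 _).2.
rewrite -scalerAl scalerN scalerA -i4D -sing_proj // starN starZ starM.
rewrite star_sing // (star_proj R b4) mulrN scalerN opprK conj_i4.
by congr (ii _ *: _); rewrite opprK addrC opprB [- q + 2]addrC.
Qed.

(** The involution of the dual at [z] is read off at [(S' z)^*].  On [P_q C_k]
    both sides are the same real cosine, on [P_q S_k] the phases agree by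
    [wexp_star]. *)
Lemma pairing_star g z :
  pairing (B g^-1%g) z = (pairing (B g) (star (S' z)))^*%C.
Proof.
rewrite (gel_coord g) gelV //; set j := g.1; set s := gel_s g.
move: z; apply: cos_sin_span => [c x y Px Py|q k|q k].
- rewrite pairing_is_scalar Px Py linearP star_semilinear pairing_is_scalar.
  by rewrite conjcD conjcM conjcK.
- rewrite star_antipode_cosg !pairing_cosg // conjcM conj_cs // conjc_nat.
  rewrite eqr_oppLR; congr (_ * _).
  by case: (odd s) => //; rewrite mulNr csN.
rewrite star_antipode_sing linearZ /= !pairing_sing // !conjcM conj_sn // conj_i4.
rewrite dual_coef.unlock conjcM conj_half conj_i4.
have -> : sn R ((if odd s then j else - j) * k) = ii (2 + 2 * s) * sn R (j * k).
  rewrite (i4D R 2) i4_2 (_ : ii (2 * s) = (-1) ^+ odd s); last first.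
    by rewrite -[s in LHS]natr_Zp -i4X i4_2 signr_odd.
  by case: (odd s); rewrite ?mulNr ?snN ?expr0 ?expr1; ring.
transitivity (2^-1 * (ii (2 + 2 * s) * ii (wexp o false (- s) q)) * sn R (j * k)).
  by ring.
by rewrite -i4D wexp_star [- (omega_exp _ _ - _)]opprB [in LHS]i4D; ring.
Qed.

Lemma psi_star (x : kcar K) :
  psi (kstar x) = @kstar R (dual o K) (psi x).
Proof.
have -> : kstar x = star (x : A) by rewrite star_gstar.
apply/ffunP => h; rewrite [RHS]ffunE.
have -> : @kstar R K (@kantipode R K (vbase R h)) = star (S' (lam R h)).
  by rewrite star_gstar [kantipode _]KQ_antipodeE ?odd_gt0.
move: x; apply: lam_span => [c x y Px Py|g].
  rewrite star_semilinear psi_is_linear vecDE vecZE psi_is_linear.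
  rewrite pairing_linl conjcD conjcM.
  by congr (_ * _ + _); [apply: Px | apply: Py].
by rewrite star_lam !psi_lam -pairing_star pairing_base.
Qed.
End Isomorphism.

(** * Bijectivity *)

Section Bijectivity.
Variables (R : realType) (n : nat) (o : bool).
Hypothesis odd_n : odd n.
Local Notation G := (quat n).
Local Notation A := (galg R G).
Local Notation Zn := 'Z_(2 * n).
Local Notation b := (qb n).
Local Notation b4 := (qb_exp4 (odd_gt0 odd_n)).
Local Notation lb := (@lb R G b).
Local Notation proj := (@proj R G b).
Local Notation B := (@dual_vec R n o false).
Local Notation psi := (@psi R n o).
Implicit Types (j k l : Zn) (q s t p r : 'Z_4) (x y z : A) (g h : G).

Lemma sum_lam_proj : \sum_h (lam R h : A) = proj 0 * \sum_h lam R h.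
Proof.
have lbN s : lb s * \sum_h lam R h = \sum_h (lam R h : A).
  rewrite lbE mulr_sumr [RHS](reindex_inj (mulgI (b ^+ s)%g)).
  by apply: eq_bigr => h _; rewrite -lamM.
apply/esym; rewrite projE -scalerAl mulr_suml.
under eq_bigr => s _ do rewrite mul0r oppr0 i4_0 scale1r lbN.
have N4 (N : A) : N + N + N + N = (4 : R[i]) *: N.
  by rewrite scaler_nat !mulrS mulr0n addr0 !addrA.
by rewrite sumZ4 N4 scalerA mulVf ?four_neq0 // scale1r.
Qed.

Lemma cs_sum j : \sum_k cs R (j * k) = (2 * n)%:R * (Ech R j == 1)%:R.
Proof.
under eq_bigr do rewrite csE.
rewrite -mulr_sumr big_split /= Ech_sum //.
have -> : \sum_k Ech R (- (j * k)) = (2 * n)%:R * (Ech R j == 1)%:R.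
  rewrite -Ech_sum // (reindex_inj (@oppr_inj Zn)).
  by apply: eq_bigr => k _; rewrite mulrN opprK.
by field.
Qed.

(** The sum of all group elements is [P_0] times itself, so that [P_0 S_k] and
    [P_0 C_k] compute the row sum: the sine terms of a rotation and of the
    matching reflection cancel, and the cosines add up to [0] unless the
    character is trivial. *)
Lemma aug_dual_vec g : aug (B g : A) = (4 * n)%:R * (g == 1%g)%:R.
Proof.
transitivity (pairing (B g) (\sum_h (lam R h : A))).
  by rewrite linear_sum; apply: eq_bigr => h _; rewrite /= pairing_base.
rewrite sum_lam_proj mulr_sumr linear_sum [in LHS](gel_coord g).
set j := g.1; set s := gel_s g.
have value h : pairing (B (gel j s)) (proj 0 * lam R h)
    = (0 == s)%:R * cs R (j * h.1)
      + (-1) ^+ h.2 * dual_coef R o false s 0 * sn R (j * h.1).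
  have odd_s : odd (gel_s h) = h.2.
    by rewrite /gel_s; case: (odd h.1) (h.2) => [] [].
  have -> : proj 0 * lam R h = proj 0 * cpow R (if h.2 then - h.1 else h.1).
    rewrite [in LHS](gel_coord h) -[in RHS]odd_s.
    have -> : lam R (gel h.1 (gel_s h)) =
        lb (gel_s h) * cpow R (if odd (gel_s h) then - h.1 else h.1).
      by rewrite lb_cpow; case: (odd _); rewrite ?opprK.
    by rewrite mulrA proj_lb ?b4 // mul0r i4_0 scale1r.
  rewrite -cos_add_sin mulrDr linearD /= pairing_cosg // pairing_sing //.
  by case: (h.2); rewrite ?mulrN ?csN ?snN ?expr0 ?expr1; ring.
rewrite (eq_bigr _ (fun h _ => value h)) /=.
rewrite -(pair_bigA _ (fun (k : Zn) (x : bool) => (0 == s)%:R * cs R (j * k)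
    + (-1) ^+ x * dual_coef R o false s 0 * sn R (j * k))) /=.
transitivity (2 * (0 == s)%:R * \sum_k cs R (j * k)).
  rewrite mulr_sumr; apply: eq_bigr => k _; rewrite big_bool /= expr0 expr1.
  by ring.
rewrite cs_sum -[(4 * n)%N]/(2 * 2 * n)%N -mulnA natrM.
suff -> : (g == 1%g) = (0 == s) && (Ech R j == 1).
  by case: (0 == s); case: (Ech R j == 1) => /=; ring.
apply/eqP/andP => [g1|[/eqP s0 /eqP j1]].
  by rewrite /s /j g1 /gel_s /= Ech0.
by rewrite (gel_coord g) -/j -/s -s0 -gel0 /gel (Ech_eq1 odd_n j1) mul0rn.
Qed.

(** By [aug_dual_vec] the sum of the entries of [psi y] is [4n] times the
    coefficient of [y] at 1; the kernel is a left ideal, so translating [x]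
    isolates every coefficient. *)
Lemma psi_kernel x : psi x = 0 -> x = 0.
Proof.
move=> x0; apply/ffunP => g; rewrite [RHS]ffunE.
have y0 : psi ((lam R g^-1%g : A) * x) = 0.
  apply/ffunP => h; rewrite -[LHS]pairing_base psiM_pairing // x0 linear0.
  rewrite [RHS]ffunE /pairing big1 // => p _; rewrite ffunE mul0r //.
have : aug (psi ((lam R g^-1%g : A) * x) : A) = (4 * n)%:R * x g.
  rewrite /psi /lext linear_sum (bigD1 1%g) //= big1 ?addr0; last first.
    move=> h h1; rewrite linearZ /= aug_dual_vec (negbTE h1) mulr0n !mulr0 //.
  by rewrite linearZ /= aug_dual_vec eqxx mulr1 lam_mul_coef invgK mulg1 mulrC.
rewrite y0 linear0 => /esym/eqP; rewrite mulf_eq0 pnatr_eq0 muln_eq0 /=.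
by rewrite eqn0Ngt odd_gt0 //= => /eqP.
Qed.

Lemma psi_iso : @kac_iso R (KQ R n) (dual o (KQ R n)) psi.
Proof.
split.
- split; first exact: psi_is_linear.
  exact: (linear_inj_bij psi_kernel).
- exact: psiM.
- exact: psi1.
- exact: psi_star.
- exact: psi_comul.
Qed.
End Bijectivity.

(** * The explicit formula *)

Section Formula.
Variables (R : realType) (n : nat) (o : bool).
Hypothesis odd_n : odd n.
Local Notation G := (quat n).
Local Notation Zn := 'Z_(2 * n).
Local Notation a := (qa n).
Local Notation b := (qb n).
Local Notation psi := (@psi R n o).
Local Notation ep := (eps R n).

Lemma sum_residues (F : nat -> R[i]) (m : Zn) :
  \sum_(k < 2 * n) F k * (m == (k : nat)%:R)%:R = F m.
Proof.
rewrite -(big_mkord xpredT (fun k => F k * (m == k%:R)%:R)).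
rewrite -[X in index_iota 0 X]Zp_cast ?n2_gt1 // big_mkord (bigD1 m) //=.
rewrite natr_Zp eqxx mulr1 big1 ?addr0 // => k km.
by rewrite natr_Zp eq_sym (negbTE km) mulr0.
Qed.

Lemma sum_rotations (F : nat -> R[i]) (m : Zn) (x : bool) :
  (\sum_(k < 2 * n) F k *: lam R (a ^+ k)%g) (m, x) = if x then 0 else F m.
Proof.
rewrite vec_sumE -[in RHS](sum_residues F m).
case: x; [apply: big1|apply: eq_bigr] => k _; rewrite vecZE vbaseE qa_exp xpair_eqE.
  by rewrite andbF mulr0.
by rewrite andbT.
Qed.

Lemma sum_reflections (F : nat -> R[i]) (m : Zn) (x : bool) :
  (\sum_(k < 2 * n) F k *: lam R (a ^+ k * b)%g) (m, x) = if x then F m else 0.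
Proof.
have ab k : (a ^+ k * b)%g = (k%:R, true) :> G.
  by rewrite qa_exp quat_mulE /quat_mul /= expr0 mulr0 !addr0.
rewrite vec_sumE -[in RHS](sum_residues F m).
case: x; [apply: eq_bigr|apply: big1] => k _; rewrite vecZE vbaseE ab xpair_eqE.
  by rewrite andbT.
by rewrite andbF mulr0.
Qed.

Lemma eps_neq0 : ep != 0.
Proof.
apply/eqP => ep0; have := eps_n R odd_n; rewrite ep0 expr0n.
by rewrite eqn0Ngt odd_gt0 //= => /esym/eqP; rewrite oppr_eq0 oner_eq0.
Qed.

Lemma eps_Ech (m : nat) : ep ^+ m = (-1) ^+ m * Ech R (m%:R : Zn).
Proof. by rewrite Ech_nat // /eta -exprMn mulN1r opprK. Qed.

(** As [eps ^+ n = -1], the power [n - 1] of [eps] is the inverse of [eta]. *)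
Lemma eps_pred (m : nat) : ep ^ ((n%:Z - 1) * m%:Z) = Ech R (- m%:R : Zn).
Proof.
rewrite mulrBl mul1r expfzDr ?eps_neq0 // -PoszM -exprnP exprM eps_n //.
rewrite -exprnN eps_Ech EchN // invfM invr_sign mulrA -expr2 sqrr_sign mul1r //.
Qed.

Lemma Ech_half_period : Ech R (n%:R : Zn) = 1.
Proof. by rewrite Ech_nat // eta_n. Qed.

Lemma e11_coef j (m : Zn) (x : bool) :
  (e11 R n j : vec R G) (m, x) = (2 * n)%:R^-1 * (if x then 0 else ep ^ (- (j * m%:Z))).
Proof. by rewrite /e11 vecZE (sum_rotations (fun k => ep ^ (- (j * k%:Z)))). Qed.

Lemma e22_coef j (m : Zn) (x : bool) :
  (e22 R n j : vec R G) (m, x) = (2 * n)%:R^-1 * (if x then 0 else ep ^ (j * m%:Z)).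
Proof. by rewrite /e22 vecZE (sum_rotations (fun k => ep ^ (j * k%:Z))). Qed.

Lemma e12_coef j (m : Zn) (x : bool) :
  (e12 R n j : vec R G) (m, x)
  = (2 * n)%:R^-1 * (if x then ep ^ (- (j * (m%:Z - n%:Z))) else 0).
Proof.
by rewrite /e12 vecZE (sum_reflections (fun k => ep ^ (- (j * (k%:Z - n%:Z))))).
Qed.

Lemma e21_coef j (m : Zn) (x : bool) :
  (e21 R n j : vec R G) (m, x) = (2 * n)%:R^-1 * (if x then ep ^ (j * m%:Z) else 0).
Proof. by rewrite /e21 vecZE (sum_reflections (fun k => ep ^ (j * k%:Z))). Qed.

Lemma e4_coef (m : Zn) (x : bool) :
  (e4 R n : vec R G) (m, x) = (4 * n)%:R^-1 * ((-1) ^+ m * 'i%C ^+ x).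
Proof.
rewrite /e4 vecZE; congr (_ * _).
under eq_bigr => k _ do rewrite scalerDr scalerA.
rewrite big_split /= vecDE (sum_rotations (fun k => (-1) ^+ k)).
rewrite (sum_reflections (fun k => (-1) ^+ k * 'i%C)).
by case: x; rewrite ?add0r ?addr0 ?expr1 ?expr0 ?mulr1.
Qed.

(** The two surviving values produce the terms with [i] and with the sign of
    the convention [o] in the formula for [a = c b^2]. *)
Lemma dual_sin2 (y x : bool) : dual_sin R o false 2 (2 *+ y + 1 *+ x)
  = if x then 0 else 'i%C - (-1) ^+ (y (+) ~~ o).
Proof.
rewrite dual_sinE; case: x.
  rewrite (sum_i4_eq R (E' := fun q => 1 * q)); last by case: o y => [] []; vm_compute.
  by rewrite i4_sum (_ : (1 == 0 :> 'Z_4) = false) // !mulr0n !mulr0.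
rewrite (sum_i4_eq R (E' := fun q : 'Z_4 => if (q < 2)%N then 1 else
  if y (+) ~~ o then 0 else 2)); last by case: o y => [] []; vm_compute.
rewrite sumZ4 /= i4_1; case: (y (+) _); rewrite ?i4_0 ?i4_2 ?expr0 ?expr1.
  by field.
by field.
Qed.

Lemma psi_a (m : Zn) (x : bool) : psi (lam R a) (m, x)
  = if x then - cs R m else cs R m + ('i%C - (-1) ^+ (odd m (+) ~~ o)) * sn R m.
Proof.
rewrite psi_lam dual_vecE [(m, x) in LHS]gel_coord qa_gel // dual_kernel_gel //=.
rewrite mul1r -[gel_s _]/(2 *+ odd m + 1 *+ x) dual_sin2.
have -> : 2 * (2 *+ odd m + 1 *+ x) = 2 *+ x :> 'Z_4.
  by case: (odd m); case: (x); apply: val_inj.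
by case: x; rewrite ?i4_2 ?i4_0; ring.
Qed.

Lemma psi_b (m : Zn) (x : bool) : psi (lam R b) (m, x) = (-1) ^+ m * 'i%C ^+ x.
Proof.
have b1 : b = gel 0 1 by rewrite /gel mul0rn addr0.
rewrite psi_lam dual_vecE [(m, x) in LHS]gel_coord b1 dual_kernel_gel //.
rewrite mul0r cs0 // sn0 // mulr0 addr0 mulr1 mul1r.
rewrite -signr_odd /gel_s /= i4D.
by case: (odd m); case: x;
  rewrite ?mulr0n ?mulr1n ?i4_0 ?i4_1 ?i4_2 ?expr0 ?expr1.
Qed.

Lemma psi_b_formula : psi (lam R b) = (4 * n)%:R *: hat o (e4 R n).
Proof.
apply/ffunP => -[m x]; rewrite psi_b.
transitivity ((4 * n)%:R * (e4 R n : vec R G) (m, x)); last by rewrite [RHS]ffunE.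
by rewrite e4_coef mulVKf // pnatr_eq0 -lt0n muln_gt0 (odd_gt0 odd_n).
Qed.

Lemma psi_a_formula : psi (lam R a) = (2 * n)%:R *:
   (hat o (e11 R n (n%:Z - 1))
    + 2^-1 *:
      (((-1) ^+ (~~ o) * 'i%C) *: (hat o (e22 R n 1) - hat o (e11 R n 1))
       - hat o (e12 R n (n%:Z - 1)) - hat o (e21 R n (n%:Z - 1)))).
Proof.
apply/ffunP => -[m x]; rewrite psi_a.
set u := (2 * n)%:R.
have u0 : u != 0 by rewrite pnatr_eq0 -lt0n muln_gt0 (odd_gt0 odd_n).
transitivity (u * (u^-1 * (if x then 0 else ep ^ (- ((n%:Z - 1) * (m : nat)%:Z)))
    + 2^-1 * ((-1) ^+ (~~ o) * 'i%C
        * (u^-1 * (if x then 0 else ep ^ (1 * (m : nat)%:Z))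
           - u^-1 * (if x then 0 else ep ^ (- (1 * (m : nat)%:Z))))
      - u^-1 * (if x then ep ^ (- ((n%:Z - 1) * ((m : nat)%:Z - n%:Z))) else 0)
      - u^-1 * (if x then ep ^ ((n%:Z - 1) * (m : nat)%:Z) else 0)))).
  have pred_m : ep ^ ((n%:Z - 1) * (m : nat)%:Z) = Ech R (- m).
    by rewrite eps_pred natr_Zp.
  have pred_mn : ep ^ (- ((n%:Z - 1) * ((m : nat)%:Z - n%:Z))) = Ech R m.
    rewrite mulrBr opprB expfzDr ?eps_neq0 // eps_pred EchN // Ech_half_period.
    by rewrite -invr_expz pred_m -EchN // opprK invr1 mul1r.
  rewrite pred_m pred_mn !mul1r -!invr_expz -!exprnP eps_Ech natr_Zp invfM invr_sign.
  rewrite pred_m -!EchN // opprK signr_addb !signr_odd.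
  clearbody u; case: x; first by rewrite csE; field.
  by rewrite mulrBl addrA cs_i_sn // snE; field.
have coef (c d : R[i]) (v1 v2 v3 v4 v5 : vec R G) h :
    (u *: (v1 + d *: (c *: (v2 - v3) - v4 - v5))) h
    = u * (v1 h + d * (c * (v2 h - v3 h) - v4 h - v5 h)).
  by rewrite !ffunE.
apply/esym; apply: etrans (coef _ _ _ _ _ _ _ _) _.
congr (_ * (_ + _ * (_ * (_ - _) - _ - _))).
- exact: e11_coef.
- exact: e22_coef.
- exact: e11_coef.
- exact: e12_coef.
- exact: e21_coef.
Qed.
End Formula.

Theorem theorem8p3 (R : realType) (n : nat) (o : bool) (hn : (0 < n)%N) :
  is_kac (KQ R n) /\
  (self_dual o (KQ R n) <-> odd n) /\
  (odd n ->
   exists psi : kcar (KQ R n) -> kcar (dual o (KQ R n)),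
     [/\ kac_iso psi,
         psi (lam R (qa n)) =
           (2 * n)%:R *:
             (hat o (e11 R n (n%:Z - 1))
              + 2^-1 *:
                (((-1) ^+ (~~ o) * 'i%C) *: (hat o (e22 R n 1) - hat o (e11 R n 1))
                 - hat o (e12 R n (n%:Z - 1)) - hat o (e21 R n (n%:Z - 1))))
       & psi (lam R (qb n)) = (4 * n)%:R *: hat o (e4 R n)]).
Proof.
split; first exact: KQ_is_kac.
have iso odd_n := psi_iso R o (odd_n : odd n).
split; [split; first exact: self_dual_odd|].
  by move=> odd_n; exists (@psi R n o); apply: iso.
move=> odd_n; exists (@psi R n o); split; first exact: iso.
  exact: psi_a_formula.
exact: psi_b_formula.
Qed.
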